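(* Let $\mathbb F$ be a field of characteristic $p>0$. (1) Let $L$ be a Lie algebra over $\mathbb F$, $\hat L$ its $p$-envelope, and $M$ a $w(\hat L)$-module. Then there is a comparison map $$\mathrm{HQ}^*_{\mathrm{RLie}}(\hat L;M)\to\mathrm{HQ}^*_{\mathrm{Lie}}(L;{}_{U(L)}M),$$ where ${}_{U(L)}M$ is $M$ viewed as a $U(L)$-module (via $U(L)\cong u(\hat L)\to w(\hat L)$). (2) Let $H$ be a restricted Lie algebra over $\mathbb F$ and $M$ a $w(H)$-module. Then there is a comparison map $$\mathrm{HQ}^*_{\mathrm{RLie}}(H;M)\to\mathrm{HQ}^*_{\mathrm{Lie}}(H;\theta^*M),$$ where $\theta:U(H)\to w(H)$ is the composite of the quotient map $U(H)\to u(H)$ with $u(H)\to w(H)$, $x\mapsto1\otimes x$.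
   Context: $\mathrm{RLie}$ is the category of restricted Lie algebras $(H,(-)^{[p]})$ over $\mathbb F$ (Jacobson). $U(L)$ is the universal enveloping algebra of a Lie algebra, and $u(H)=U(H)/(h^p-h^{[p]})$ the restricted enveloping algebra. The $p$-envelope $\hat L\subset U(L)$ of a Lie algebra $L$ is the Lie subalgebra of $U(L)$ (commutator bracket) containing $L$ and all iterated associative $p$-th powers; with the $p$-th power map it is a restricted Lie algebra, $L\mapsto\hat L$ is left adjoint to the forgetful functor $\mathcal U:\mathrm{RLie}\to\mathrm{Lie}$ with unit the inclusion $\eta_L:L\to\hat L$, and $U(L)\cong u(\hat L)$. $R_f$ is the ring of polynomials $\sum\lambda_if^i$, $\lambda_i\in\mathbb F$, with $f\lambda=\lambda^pf$; $w(H)=R_f\otimes_{\mathbb F}u(H)$ with the ring structure such that $R_f,u(H)$ are subrings, $(f\otimes1)(1\otimes h)=f\otimes h$ and $(1\otimes h)(f\otimes1)=0$ for $h\in H$. A left $w(H)$-module is the same as a restricted $H$-module $M$ with a $p$-semilinear map $f:M\to M^H=\{m:hm=0\ \forall h\in H\}$; these are equivalent to Beck modules over $H$ in $\mathrm{RLie}$ (abelian group objects in $\mathrm{RLie}/H$), $(M,f)$ corresponding to $H\ltimes_fM=H\oplus M$ with $[(h,m),(h',m')]=([h,h'],hm'-h'm)$, $(h,m)^{[p]}=(h^{[p]},h^{p-1}m+f(m))$. Beck modules over $L$ in Lie algebras are $U(L)$-modules (semidirect products $L\ltimes M$). Quillen cohomology in a category $\mathcal C$ (here $\mathrm{Lie}$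 or $\mathrm{RLie}$): $\mathrm{HQ}^n_{\mathcal C}(X;M)=\pi^n\mathrm{Hom}(Ab_X(C_\bullet\to X),M)$, where $C_\bullet\xrightarrow{\sim}X$ is a cofibrant replacement in simplicial objects (standard Quillen model structure) and $Ab_X$ is left adjoint to the forgetful functor from Beck modules over $X$ to $\mathcal C/X$; equivalently $\pi^n\mathrm{Hom}_{\mathcal C/X}(C_\bullet,E)$, $E\to X$ being the Beck module corresponding to $M$. Comparison maps. In (1): for cofibrant replacements $C_\bullet\to L$ in $s\mathrm{Lie}$ and $D_\bullet\to\hat L$ in $s\mathrm{RLie}$, choose $\hat C_\bullet\to D_\bullet$ over $\hat L$; the comparison map is induced by $\mathrm{Hom}_{/\hat L}(D_\bullet,E)\to\mathrm{Hom}_{/\hat L}(\hat C_\bullet,E)\cong\mathrm{Hom}_{/L}(C_\bullet,\eta_L^*\mathcal UE)$. In (2): for cofibrant replacements $D_\bullet\to H$ in $s\mathrm{RLie}$ and $C_\bullet\to\mathcal UH$ in $s\mathrm{Lie}$, choose $C_\bullet\to\mathcal UD_\bullet$ over $\mathcal UH$; the comparison map is induced by $\mathrm{Hom}_{/H}(D_\bullet,E)\to\mathrm{Hom}_{/\mathcal UH}(\mathcal UD_\bullet,\mathcal UE)\to\mathrm{Hom}_{/\mathcal UH}(C_\bullet,\mathcal UE)$. *)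

(* Defs.v *)
From HB Require Import structures.
From mathcomp Require Import all_boot all_order all_algebra.
From mathcomp Require Import generic_quotient ring_quotient.
From mathcomp Require Import boolp classical_sets functions.

Set Implicit Arguments.
Unset Strict Implicit.
Unset Printing Implicit Defensive.

Import GRing.Theory.
Local Open Scope ring_scope.
Local Open Scope quotient_scope.

HB.mixin Record isLie (F : fieldType) L of GRing.Lmodule F L := {
  bracket : L -> L -> L;
  bracket_linearl : forall y : L, linear (bracket^~ y);
  bracket_linearr : forall x : L, linear (bracket x);
  bracketxx : forall x : L, bracket x x = 0;
  jacobi : forall x y z : L,
    bracket x (bracket y z) + bracket y (bracket z x)
      + bracket z (bracket x y) = 0
}.

#[short(type="lieType")]
HB.structure Definition Lie (F : fieldType) :=
  {L of isLie F L & GRing.Lmodule F L}.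

Section LieTheory.
Variables (F : fieldType) (L : lieType F).
Implicit Types x y z : L.

Lemma bracketDl x y z : bracket (x + y) z = bracket x z + bracket y z.
Proof. by have := bracket_linearl z 1 x y; rewrite !scale1r. Qed.
Lemma bracketDr x y z : bracket z (x + y) = bracket z x + bracket z y.
Proof. by have := bracket_linearr z 1 x y; rewrite !scale1r. Qed.
Lemma bracket0l x : bracket 0 x = 0.
Proof. by apply: (@addrI _ (bracket 0 x)); rewrite -bracketDl !addr0. Qed.
Lemma bracket0r x : bracket x 0 = 0.
Proof. by apply: (@addrI _ (bracket x 0)); rewrite -bracketDr !addr0. Qed.
Lemma bracketZl a x y : bracket (a *: x) y = a *: bracket x y.
Proof.
by have := bracket_linearl y a x 0; rewrite !addr0 bracket0l addr0.
Qed.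
Lemma bracketZr a x y : bracket x (a *: y) = a *: bracket x y.
Proof.
by have := bracket_linearr x a y 0; rewrite !addr0 bracket0r addr0.
Qed.

End LieTheory.

(* [jac br x y k i] is the coefficient of t^i in ad(t x + y)^k (x), for the   *)
(* biadditive operation [br].                                                 *)
Fixpoint jac (V : zmodType) (br : V -> V -> V) (x y : V) (k i : nat) : V :=
  match k with
  | 0%N => if i == 0%N then x else 0
  | k'.+1 => br y (jac br x y k' i)
             + (if i is i'.+1 then br x (jac br x y k' i') else 0)
  end.

(* In [pmapD] the i-th summand is Jacobson's s_i(x, y), for which i s_i(x, y) *)
(* is the coefficient of t^(i-1) in ad(t x + y)^(p-1) (x).                    *)
HB.mixin Record Lie_isRestricted (p : nat) (F : fieldType) H of Lie F H := {
  pmap : H -> H;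
  pmapZ : forall (a : F) (x : H), pmap (a *: x) = a ^+ p *: pmap x;
  ad_pmap : forall x y : H, bracket (pmap x) y = iter p (bracket x) y;
  pmapD : forall x y : H, pmap (x + y) = pmap x + pmap y
    + \sum_(1 <= i < p) (i%:R : F)^-1 *: jac bracket x y p.-1 i.-1
}.

#[short(type="rlieType")]
HB.structure Definition RestrictedLie (p : nat) (F : fieldType) :=
  {H of Lie_isRestricted p F H & Lie F H}.

Definition lie_hom (F : fieldType) (L L' : lieType F) (f : L -> L') : Prop :=
  linear f /\ {morph f : x y / bracket x y}.

Definition rlie_hom (p : nat) (F : fieldType) (H H' : rlieType p F)
    (f : H -> H') : Prop :=
  lie_hom f /\ (forall x, f (pmap x) = pmap (f x)).

Definition commutator (R : pzRingType) (x y : R) : R := x * y - y * x.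

Section CommutatorPowers.
Variables (p : nat) (R : nzRingType) (pR : p \in [pchar R]).
Local Notation ad := (@commutator _).

Lemma iter_commutator (y a : R) k :
  iter k (ad y) a =
  \sum_(i < k.+1) (y ^+ (k - i) * a * y ^+ i) *+ 'C(k, i) * (-1) ^+ i.
Proof.
elim: k => [|k IHk].
  by rewrite big_ord1 /= !expr0 !mulr1 mul1r bin0.
rewrite iterS IHk /commutator mulr_sumr mulr_suml.
rewrite [RHS]big_ord_recl [in RHS]/= bin0 expr0 !mulr1 subn0.
rewrite [X in _ = _ + X](eq_bigr (fun i : 'I_k.+1 =>
    (y ^+ (k - i) * a * y ^+ i.+1) *+ 'C(k, i.+1) * (-1) ^+ i.+1
    + (y ^+ (k - i) * a * y ^+ i.+1) *+ 'C(k, i) * (-1) ^+ i.+1)); last first.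
  by move=> i _; rewrite /= /bump /= add1n subSS binS mulrnDr mulrDl.
rewrite big_split /= addrA; congr (_ + _).
  rewrite [LHS]big_ord_recl /= bin0 !expr0 !mulr1 subn0 mulr1n !mulrA -exprS.
  rewrite [in RHS]big_ord_recr /= bin_small // mulr0n mul0r addr0.
  congr (_ + _); apply: eq_bigr => i _; rewrite /bump /= add1n.
  have -> : (k - i = (k - i.+1).+1)%N by rewrite subnSK.
  by rewrite !mulrA mulrnAr !mulrA -exprS.
rewrite -sumrN; apply: eq_bigr => i _.
rewrite [(-1) ^+ _.+1]exprS mulN1r mulrN; congr (- _).
rewrite -[LHS]mulrA -(commrX i (commrN1 y)).
by rewrite !mulrA !mulrnAl exprSr !mulrA.
Qed.

Lemma bin_pred_pchar i : (i < p)%N -> 'C(p.-1, i)%:R = (-1) ^+ i :> R.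
Proof.
have p0 := prime_gt0 (pcharf_prime pR).
elim: i => [|i IHi] lt_ip; first by rewrite bin0.
have := bin_lt_pcharf_0 pR (k := i.+1); rewrite lt_ip => /(_ isT).
rewrite -{1}(prednK p0) binS natrD IHi 1?ltnW // => /eqP.
by rewrite addr_eq0 => /eqP->; rewrite exprS mulN1r.
Qed.

Lemma iter_commutator_pred (y a : R) :
  iter p.-1 (ad y) a = \sum_(i < p) y ^+ (p.-1 - i) * a * y ^+ i.
Proof.
have p0 := prime_gt0 (pcharf_prime pR).
rewrite iter_commutator (prednK p0); apply: eq_bigr => i _.
rewrite -[X in X * _ = _]mulr_natr -[LHS]mulrA bin_pred_pchar ?ltn_ord //.
by rewrite -exprD addnn -mul2n exprM sqrrN !expr1n mulr1.
Qed.

Lemma iter_commutator_pchar (y a : R) :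
  iter p (ad y) a = ad (y ^+ p) a.
Proof.
have p0 := prime_gt0 (pcharf_prime pR).
rewrite -{1}(prednK p0) iterS iter_commutator_pred /commutator.
case: p p0 => // q _ /=; rewrite mulr_sumr mulr_suml.
rewrite big_ord_recl big_ord_recr /= subn0 subnn !expr0 !mulr1 mul1r.
rewrite [y * (_ * a)]mulrA -exprS -[a * _ * y]mulrA -(exprSr y).
rewrite [X in _ - X]addrC opprD addrACA -[RHS]addr0; congr (_ + _).
rewrite -sumrB big1 // => i _; apply/eqP; rewrite subr_eq0.
rewrite /bump /= add1n -(mulrA _ _ y) -(exprSr y) !mulrA -(exprS y).
by rewrite subnSK.
Qed.

End CommutatorPowers.

Section Jacobson.
Variables (p : nat) (R : nzRingType) (pR : p \in [pchar R]).
Local Notation ad := (@commutator _).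

(* Jacobson's formula, the s_i being the coefficients of (t a + b)^p. *)
Lemma jacobson (a b : R) : exists s : nat -> R,
  (a + b) ^+ p = a ^+ p + b ^+ p + \sum_(1 <= i < p) s i
  /\ (forall i, (0 < i)%N -> s i *+ i = jac ad a b p.-1 i.-1).
Proof.
have p_pr := pcharf_prime pR; have p0 := prime_gt0 p_pr.
pose A : {poly R} := a *: 'X + b%:P.
have comX (q : {poly R}) : GRing.comm q 'X by apply: commr_polyX.
have adX (x : R) (q : {poly R}) i :
    (commutator (x%:P) q)`_i = ad x q`_i.
  by rewrite coefB coefCM coefMC.
have coefad k i : (iter k (commutator A) a%:P)`_i = jac ad a b k i.
  elim: k i => [|k IHk] i; first by rewrite /= coefC.
  rewrite iterS; set q := iter k _ _ in IHk *.
  have -> : commutator A q = commutator a%:P q * 'X + commutator b%:P q.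
    rewrite /A /commutator mulrDl mulrDr opprD addrACA -mul_polyC.
    by rewrite mulrBl -!mulrA -(commr_polyX q).
  rewrite coefD coefMX addrC; congr (_ + _); first by rewrite adX IHk.
  by case: i => //= i; rewrite adX IHk.
have szA n : (size (A ^+ n) <= n.+1)%N.
  elim: n => [|n IHn]; first by rewrite expr0 size_poly1.
  have szA1 : (size A <= 2)%N.
    apply: leq_trans (size_polyD _ _) _; rewrite geq_max.
    rewrite (leq_trans (size_scale_leq _ _)) ?size_polyX //.
    by rewrite (leq_trans (size_polyC_leq1 _)).
  rewrite exprS; apply: leq_trans (size_polyMleq _ _) _.
  case: (posnP (size A)) => [->|szA0].
    by rewrite add0n (leq_trans (leq_pred _)) // (leq_trans IHn).
  rewrite -ltnS prednK ?addn_gt0 ?szA0 //.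
  by apply: leq_trans (leq_add szA1 IHn) _; rewrite add2n.
have leadA n : (A ^+ n)`_n = a ^+ n.
  elim: n => [|n IHn]; first by rewrite !expr0 coef1.
  rewrite exprS mulrDl coefD -mul_polyC -mulrA -(comX (A ^+ n)) mulrA coefMX.
  rewrite /= coefCM IHn coefCM [X in _ + b * X]nth_default //.
  by rewrite mulr0 addr0 exprS.
have constA n : (A ^+ n)`_0 = b ^+ n.
  elim: n => [|n IHn]; first by rewrite !expr0 coef1.
  rewrite exprS mulrDl coefD -mul_polyC -mulrA -(comX (A ^+ n)) mulrA coefMX.
  by rewrite /= add0r coefCM IHn exprS.
have evalA n : (A ^+ n).[1] = (a + b) ^+ n.
  elim: n => [|n IHn]; first by rewrite !expr0 hornerC.
  have cA (q : {poly R}) : comm_poly q 1 by rewrite /comm_poly mul1r mulr1.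
  by rewrite !exprSr hornerM_comm // IHn !hornerE.
have dA n : (A ^+ n)^`() = \sum_(i < n) A ^+ (n.-1 - i) * a%:P * A ^+ i.
  have dA1 : A^`() = a%:P.
    by rewrite derivD derivZ derivX derivC addr0 alg_polyC.
  elim: n => [|n IHn]; first by rewrite big_ord0 expr0 derivC.
  rewrite exprSr derivM IHn dA1 big_ord_recl /= subn0 expr0 mulr1 addrC.
  congr (_ + _); rewrite mulr_suml; apply: eq_bigr => i _.
  rewrite /bump /= add1n -mulrA -exprSr; congr (_ ^+ _ * _ * _).
  by rewrite -subn1 -subnDA add1n.
exists (fun i => (A ^+ p)`_i); split=> [|[//|i] _]; last first.
  have pP : p \in [pchar {poly R}] by rewrite pchar_poly.
  have := coef_deriv (A ^+ p) i; rewrite dA => <-.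
  rewrite -coefad; congr (_`_i).
  by rewrite (iter_commutator_pred pP).
rewrite -evalA (horner_coef_wide _ (szA p)) big_ord_recr /= expr1n mulr1 leadA.
rewrite addrC -addrA; congr (_ + _).
under eq_bigr do rewrite expr1n mulr1.
rewrite -(big_mkord xpredT (fun i => (A ^+ p)`_i)).
by rewrite big_ltn // constA.
Qed.
End Jacobson.

Lemma addr_jacobi (V : zmodType) (a b c d e f : V) :
  a - b - (c - d) + (c - e - (f - b)) + (f - d - (a - e)) = 0.
Proof.
rewrite !opprB [c - e + _]addrC [X in X + _]addrACA (subrKA b) (subrKA c).
by rewrite addrACA (subrKA f) (subrKA e) -(opprB a) subrr.
Qed.

Lemma commutator_jacobi (R : pzRingType) (x y z : R) :
  commutator x (commutator y z) + commutator y (commutator z x)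
    + commutator z (commutator x y) = 0.
Proof. by rewrite /commutator !mulrBl !mulrBr !mulrA addr_jacobi. Qed.

Definition lie_rep (F : fieldType) (L : lieType F) (A : algType F)
    (g : L -> A) : Prop :=
  linear g /\ (forall x y, g (bracket x y) = commutator (g x) (g y)).

(* A model of the universal enveloping algebra U(L). *)
Record uea (F : fieldType) (L : lieType F) := Uea {
  uea_alg :> algType F;
  uea_in : L -> uea_alg;
  uea_in_rep : lie_rep uea_in;
  uea_ext : forall (A : algType F) (g : L -> A),
    lie_rep g -> {lrmorphism uea_alg -> A};
  uea_extE : forall (A : algType F) (g : L -> A) (g_rep : lie_rep g) x,
    uea_ext g_rep (uea_in x) = g x;
  uea_uniq : forall (A : algType F) (f1 f2 : {lrmorphism uea_alg -> A}),
    (forall x, f1 (uea_in x) = f2 (uea_in x)) -> f1 =1 f2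
}.
Arguments uea_in {F L} u _.
Arguments uea_ext {F L} u {A g} _.

Inductive ideal_gen (A : pzRingType) (S : A -> Prop) : A -> Prop :=
| ideal_gen_in x : S x -> ideal_gen S x
| ideal_gen0 : ideal_gen S 0
| ideal_genD x y : ideal_gen S x -> ideal_gen S y -> ideal_gen S (x + y)
| ideal_genM a x b : ideal_gen S x -> ideal_gen S (a * x * b).

(* A model of u(H) = U(H) / (h^p - h^[p]). *)
Record renv (p : nat) (F : fieldType) (H : rlieType p F) (U : uea H) := Renv {
  renv_alg :> algType F;
  renv_proj : {lrmorphism U -> renv_alg};
  renv_surj : forall y, exists x, renv_proj x = y;
  renv_ker : forall x, renv_proj x = 0 <->
    ideal_gen (fun z => exists h, z = uea_in U h ^+ p - uea_in U (pmap h)) x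
}.
Arguments renv_proj {p F H U} r.

Definition renv_in (p : nat) (F : fieldType) (H : rlieType p F) (U : uea H)
  (u : renv U) (h : H) : u := renv_proj u (uea_in U h).

Inductive p_closure (p : nat) (F : fieldType) (A : algType F)
    (S : A -> Prop) : A -> Prop :=
| p_closure_in x : S x -> p_closure p S x
| p_closure0 : p_closure p S 0
| p_closure_lin a x y :
    p_closure p S x -> p_closure p S y -> p_closure p S (a *: x + y)
| p_closure_comm x y :
    p_closure p S x -> p_closure p S y -> p_closure p S (commutator x y)
| p_closure_pow x : p_closure p S x -> p_closure p S (x ^+ p).

Section PEnvelope.
Variables (p : nat) (F : fieldType) (pF : p \in [pchar F]).
Variables (L : lieType F) (U : uea L).

Definition penv_pred : {pred U} :=
  fun x => `[< p_closure p (range (uea_in U)) x >].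

Record penv_sub := Penv { penv_val : U; penv_valP : penv_val \in penv_pred }.

Lemma penv_predP x : reflect (p_closure p (range (uea_in U)) x)
                             (x \in penv_pred).
Proof. exact: asboolP. Qed.

Lemma penv_submod : submod_closed penv_pred.
Proof.
split=> [|a x y /penv_predP xP /penv_predP yP]; apply/penv_predP.
  exact: p_closure0.
exact: p_closure_lin.
Qed.

HB.instance Definition _ := GRing.isSubmodClosed.Build F U penv_pred
  penv_submod.
HB.instance Definition _ := [isSub for penv_val].
HB.instance Definition _ := [Choice of penv_sub by <:].
HB.instance Definition _ := [SubChoice_isSubZmodule of penv_sub by <:].
HB.instance Definition _ := [SubZmodule_isSubLmodule of penv_sub by <:].

Lemma penv_comm_subproof (x y : penv_sub) :
  commutator (penv_val x) (penv_val y) \in penv_pred.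
Proof.
by apply/penv_predP/p_closure_comm; apply/penv_predP/penv_valP.
Qed.
Lemma penv_pow_subproof (x : penv_sub) : penv_val x ^+ p \in penv_pred.
Proof. by apply/penv_predP/p_closure_pow/penv_predP/penv_valP. Qed.

Definition penv_bracket (x y : penv_sub) : penv_sub :=
  Penv (penv_comm_subproof x y).
Definition penv_pmap (x : penv_sub) : penv_sub := Penv (penv_pow_subproof x).

Lemma penv_valD (x y : penv_sub) : penv_val (x + y) = penv_val x + penv_val y.
Proof. by []. Qed.
Lemma penv_valZ a (x : penv_sub) : penv_val (a *: x) = a *: penv_val x.
Proof. by []. Qed.
Lemma penv_val0 : penv_val 0 = 0.
Proof. by []. Qed.

Lemma penv_bracket_linearl (y : penv_sub) : linear (penv_bracket^~ y).
Proof.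
move=> a x z; apply: val_inj => /=.
rewrite /commutator mulrDl mulrDr -scalerAl -scalerAr.
by rewrite scalerBr opprD addrACA.
Qed.
Lemma penv_bracket_linearr (x : penv_sub) : linear (penv_bracket x).
Proof.
move=> a y z; apply: val_inj => /=.
rewrite /commutator mulrDl mulrDr -scalerAl -scalerAr.
by rewrite scalerBr opprD addrACA.
Qed.
Lemma penv_bracketxx (x : penv_sub) : penv_bracket x x = 0.
Proof. by apply: val_inj; rewrite /= /commutator subrr. Qed.

Lemma penv_jacobi (x y z : penv_sub) :
  penv_bracket x (penv_bracket y z) + penv_bracket y (penv_bracket z x)
    + penv_bracket z (penv_bracket x y) = 0.
Proof. by apply: val_inj; exact: commutator_jacobi. Qed.

HB.instance Definition _ := isLie.Build F penv_sub
  penv_bracket_linearl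
  penv_bracket_linearr penv_bracketxx penv_jacobi.

(* The restricted structure depends on pF, hence the dummy argument. *)
Definition penv : Type := (fun _ : p \in [pchar F] => penv_sub) pF.
HB.instance Definition _ := Lie.copy penv penv_sub.

Lemma penv_pmapZ a (x : penv) :
  penv_pmap (a *: x) = a ^+ p *: (penv_pmap x : penv).
Proof. by apply: val_inj; rewrite /= exprZn. Qed.

Lemma penv_ad_pmap (x y : penv) :
  bracket (penv_pmap x : penv) y = iter p (bracket x) y.
Proof.
apply: val_inj => /=.
have -> n : penv_val (iter n (bracket x) y) =
            iter n (commutator (penv_val x)) (penv_val y).
  by elim: n => //= n <-.
by rewrite iter_commutator_pchar // pchar_lalg.
Qed.

Lemma penv_pmapD (x y : penv) :
  penv_pmap (x + y) = (penv_pmap x : penv) + penv_pmap y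
  + \sum_(1 <= i < p) (i%:R : F)^-1 *: jac bracket x y p.-1 i.-1.
Proof.
have pU : p \in [pchar U] by rewrite pchar_lalg.
have [s [Es sJ]] := jacobson pU (penv_val x) (penv_val y).
apply: val_inj; rewrite /= Es; congr (_ + _).
have val_sum (f : nat -> penv) :
    penv_val (\sum_(1 <= i < p) f i) = \sum_(1 <= i < p) penv_val (f i).
  exact: (raddf_sum (val : penv_sub -> U)).
rewrite val_sum; apply: eq_big_nat => i /andP[i_gt0 lt_ip].
have valJ k j : penv_val (jac bracket x y k j) =
                jac (@commutator U) (penv_val x) (penv_val y) k j.
  elim: k j => [|k IHk] [|j] //=; by rewrite ?penv_valD /= ?IHk ?penv_val0.
rewrite penv_valZ valJ -sJ // -scaler_nat scalerA mulVf ?scale1r //.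
by rewrite -(dvdn_pcharf pF) gtnNdvd.
Qed.

HB.instance Definition _ := Lie_isRestricted.Build p F penv
  penv_pmapZ
  penv_ad_pmap penv_pmapD.

Lemma penv_unit_subproof x : uea_in U x \in penv_pred.
Proof. by apply/penv_predP/p_closure_in; exists x. Qed.
Definition penv_unit (x : L) : penv := Penv (penv_unit_subproof x).

Lemma penv_unit_hom : lie_hom penv_unit.
Proof.
have [lin_in br_in] := uea_in_rep U.
by split=> [a x y|x y]; apply: val_inj; rewrite /= ?lin_in ?br_in.
Qed.

End PEnvelope.
Arguments penv_pred {p F L} U.
Arguments penv_unit {p F} pF {L} U _.

Section PEnvelopeMap.
Variables (p : nat) (F : fieldType) (pF : p \in [pchar F]).
Variables (L L' : lieType F) (U : uea L) (U' : uea L').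
Variables (g : L -> L') (g_hom : lie_hom g).

Lemma uea_in_comp_rep : lie_rep (uea_in U' \o g).
Proof.
have [lin_in br_in] := uea_in_rep U'; have [lin_g br_g] := g_hom.
by split=> [a x y|x y] /=; rewrite ?lin_g ?br_g ?lin_in ?br_in.
Qed.

Definition uea_map : {lrmorphism U -> U'} := uea_ext U uea_in_comp_rep.

Lemma uea_mapE x : uea_map (uea_in U x) = uea_in U' (g x).
Proof. exact: uea_extE. Qed.

Lemma penv_map_subproof (x : penv pF U) :
  uea_map (penv_val x) \in penv_pred (p := p) U'.
Proof.
apply/penv_predP; case: x => x /= /penv_predP; elim=> {x}.
- move=> _ [x _ <-]; rewrite uea_mapE; apply: p_closure_in; by exists (g x).
- by rewrite rmorph0; apply: p_closure0.
- by move=> a x y _ IHx _ IHy; rewrite linearP; apply: p_closure_lin.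
- move=> x y _ IHx _ IHy; rewrite rmorphB !rmorphM; exact: p_closure_comm.
- by move=> x _ IHx; rewrite rmorphXn; apply: p_closure_pow.
Qed.

Definition penv_map (x : penv pF U) : penv pF U' := Penv (penv_map_subproof x).

Lemma penv_map_hom : rlie_hom penv_map.
Proof.
split; first split=> [a x y|x y]; last move=> x; apply: val_inj => /=.
- exact: linearP.
- by rewrite rmorphB !rmorphM.
- exact: rmorphXn.
Qed.

Lemma penv_map_unit x : penv_map (penv_unit pF U x) = penv_unit pF U' (g x).
Proof. by apply: val_inj; rewrite /= uea_mapE. Qed.

End PEnvelopeMap.
Arguments uea_map {F L L'} U U' {g} g_hom.
Arguments penv_map {p F} pF {L L'} U U' {g} g_hom x.
Arguments penv_map_hom {p F} pF {L L'} U U' {g} g_hom.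

Lemma penv_map_id (p : nat) (F : fieldType) (pF : p \in [pchar F])
    (L : lieType F) (U : uea L) (g : L -> L) (g_hom : lie_hom g) :
  g =1 id -> penv_map pF U U g_hom =1 id.
Proof.
move=> g1 x; apply: val_inj => /=.
by apply: (uea_uniq (f2 := idfun)) => y; rewrite uea_mapE g1.
Qed.

Lemma penv_map_comp (p : nat) (F : fieldType) (pF : p \in [pchar F])
    (L1 L2 L3 : lieType F) (U1 : uea L1) (U2 : uea L2) (U3 : uea L3)
    (g : L1 -> L2) (g_hom : lie_hom g) (f : L2 -> L3) (f_hom : lie_hom f)
    (h : L1 -> L3) (h_hom : lie_hom h) :
  h =1 f \o g ->
  penv_map pF U1 U3 h_hom =1
    penv_map pF U2 U3 f_hom \o penv_map pF U1 U2 g_hom.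
Proof.
move=> hE x; apply: val_inj => /=.
pose fg : {lrmorphism U1 -> U3} :=
  uea_map U2 U3 f_hom \o uea_map U1 U2 g_hom.
by apply: (uea_uniq (f2 := fg)) => y; rewrite /= !uea_mapE hE.
Qed.

(* A model of R_f: every element is a unique left F-combination of powers of  *)
(* f.                                                                         *)
Record skew_poly (p : nat) (F : fieldType) := SkewPoly {
  sp_ring :> nzRingType;
  sp_const : {rmorphism F -> sp_ring};
  sp_f : sp_ring;
  sp_comm : forall c : F, sp_f * sp_const c = sp_const (c ^+ p) * sp_f;
  sp_basis : forall r : sp_ring, exists! P : {poly F},
    r = \sum_(i < size P) sp_const P`_i * sp_f ^+ i
}.
Arguments sp_const {p F} s.
Arguments sp_f {p F} s.

(* Biadditive maps balanced over F, for the right F-module structure          *)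
(* r . c = r c on R_f.                                                        *)
Definition balanced (p : nat) (F : fieldType) (R : skew_poly p F)
    (A : algType F) (T : zmodType) (b : R -> A -> T) : Prop :=
  [/\ forall r s x, b (r + s) x = b r x + b s x,
      forall r x y, b r (x + y) = b r x + b r y
    & forall r c x, b (r * sp_const R c) x = b r (c *: x)].

(* A model of w(H): a ring which, through (r, x) |-> (r (x) 1) (1 (x) x), is  *)
(* the tensor product of R_f and u(H) over F, and in which                    *)
(* (1 (x) h) (f (x) 1) = 0 for h in H.                                        *)
Record wring (p : nat) (F : fieldType) (H : rlieType p F) (U : uea H)
    (u : renv U) (R : skew_poly p F) := Wring {
  w_ring :> nzRingType;
  w_skew : {rmorphism R -> w_ring};
  w_env : {rmorphism u -> w_ring};
  w_balanced : balanced (fun r x => w_skew r * w_env x);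
  w_tensor : forall (T : zmodType) (b : R -> u -> T), balanced b ->
    exists! g : {additive w_ring -> T},
      forall r x, g (w_skew r * w_env x) = b r x;
  w_zero : forall h : H, w_env (renv_in u h) * w_skew (sp_f R) = 0
}.
Arguments w_skew {p F H U u R} w.
Arguments w_env {p F H U u R} w.

Definition restr (R S : pzRingType) (phi : {rmorphism R -> S})
  (M : lmodType S) : Type := M.

Section Restr.
Variables (R S : pzRingType) (phi : {rmorphism R -> S}) (M : lmodType S).
HB.instance Definition _ := GRing.Zmodule.copy (restr phi M) M.
Definition restr_scale (a : R) (m : restr phi M) : restr phi M :=
  phi a *: (m : M).
Lemma restr_scaleA a b v :
  restr_scale a (restr_scale b v) = restr_scale (a * b) v.
Proof. by rewrite /restr_scale scalerA rmorphM. Qed.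
Lemma restr_scale1 : left_id 1 restr_scale.
Proof. by move=> m; rewrite /restr_scale rmorph1 scale1r. Qed.
Lemma restr_scaleDr : right_distributive restr_scale +%R.
Proof. by move=> a m n; rewrite /restr_scale scalerDr. Qed.
Lemma restr_scaleDl v : {morph restr_scale^~ v : a b / a + b}.
Proof. by move=> a b; rewrite /restr_scale rmorphD scalerDl. Qed.
HB.instance Definition _ := GRing.Zmodule_isLmodule.Build R (restr phi M)
  restr_scaleA restr_scale1 restr_scaleDr restr_scaleDl.
End Restr.

Section SemidirectBracket.
Variables (F : fieldType) (L : lieType F) (V : lmodType F).
Variable act : L -> V -> V.
Hypothesis act_linearl : forall v, linear (act^~ v).
Hypothesis act_linearr : forall x, linear (act x).
Hypothesis act_bracket : forall x y v,
  act (bracket x y) v = act x (act y v) - act y (act x v).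

Definition semi_bracket (X Y : L * V) : L * V :=
  (bracket X.1 Y.1, act X.1 Y.2 - act Y.1 X.2).

Lemma semi_bracket_linearl Y : linear (semi_bracket^~ Y).
Proof.
move=> a X Z; congr pair; first exact: bracket_linearl.
rewrite /= act_linearl act_linearr.
by rewrite scalerBr opprD addrACA.
Qed.
Lemma semi_bracket_linearr X : linear (semi_bracket X).
Proof.
move=> a Y Z; congr pair; first exact: bracket_linearr.
rewrite /= act_linearl act_linearr.
by rewrite scalerBr opprD addrACA.
Qed.
Lemma semi_bracketxx X : semi_bracket X X = 0.
Proof. by rewrite /semi_bracket bracketxx subrr. Qed.
Lemma semi_jacobi X Y Z :
  semi_bracket X (semi_bracket Y Z) + semi_bracket Y (semi_bracket Z X)
    + semi_bracket Z (semi_bracket X Y) = 0.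
Proof.
have actB x v w : act x (v - w) = act x v - act x w.
  by rewrite -scaleN1r addrC act_linearr scaleN1r addrC.
congr pair; first exact: jacobi.
by rewrite /= !act_bracket !actB addr_jacobi.
Qed.

Definition semi_hom (A : lieType F) (a : A -> L) (d : A -> V) : Prop :=
  linear (fun x => (a x, d x)) /\
  (forall x y, (a (bracket x y), d (bracket x y)) =
               semi_bracket (a x, d x) (a y, d y)).

Lemma act0r x : act x 0 = 0.
Proof.
by have := act_linearr x (-1) 0 0; rewrite !scaleN1r oppr0 addr0 addNr.
Qed.

Lemma semi_hom0 (A : lieType F) (a : A -> L) :
  lie_hom a -> semi_hom a (fun _ => 0).
Proof.
move=> [lin_a br_a]; split=> [c x y|x y]; congr pair; first exact: lin_a.
- by rewrite /= scaler0 addr0.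
- exact: br_a.
- by rewrite /= !act0r subrr.
Qed.

Lemma semi_homB (A : lieType F) (a : A -> L) (d d' : A -> V) :
  semi_hom a d -> semi_hom a d' -> semi_hom a (fun x => d x - d' x).
Proof.
have actB x v w : act x (v - w) = act x v - act x w.
  by rewrite -scaleN1r addrC act_linearr scaleN1r addrC.
move=> [lin_d br_d] [lin_d' br_d']; split=> [c x y|x y].
  have [-> ->] := lin_d c x y; have [_ ->] := lin_d' c x y; congr pair.
  by rewrite /= scalerBr opprD addrACA.
have [-> ->] := br_d x y; have [_ ->] := br_d' x y; congr pair.
by rewrite /= !actB !opprD !opprK addrACA.
Qed.
End SemidirectBracket.

(* L |x N for a U(L)-module N; F acts on N through U(L). *)
Section LieSemidirect.
Variables (F : fieldType) (L : lieType F) (U : uea L) (N : lmodType U).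

Definition uact (x : L) (n : restr (in_alg U) N) : restr (in_alg U) N :=
  uea_in U x *: (n : N).

Lemma uact_linearl n : linear (uact^~ n).
Proof.
move=> a x y; rewrite /uact (uea_in_rep U).1 scalerDl; congr (_ + _).
by rewrite -mulr_algl -scalerA.
Qed.
Lemma uact_linearr x : linear (uact x).
Proof.
move=> a m n; rewrite /uact scalerDr; congr (_ + _).
by rewrite [LHS]scalerA [RHS]scalerA mulr_algl mulr_algr.
Qed.
Lemma uact_bracket x y n :
  uact (bracket x y) n = uact x (uact y n) - uact y (uact x n).
Proof.
by rewrite /uact (uea_in_rep U).2 scalerBl -!scalerA.
Qed.

Definition lsemi : Type := (L * restr (in_alg U) N)%type.
HB.instance Definition _ := GRing.Lmodule.on lsemi.
HB.instance Definition _ := isLie.Build F lsemi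
  (semi_bracket_linearl uact_linearl uact_linearr)
  (semi_bracket_linearr uact_linearl uact_linearr)
  (semi_bracketxx uact)
  (semi_jacobi uact_linearr uact_bracket).
End LieSemidirect.

(* The ring of matrices [[w, m], [0, n]]. *)
Section Triangular.
Variables (p : nat) (W : nzRingType) (pW : p \in [pchar W]) (M : lmodType W).

Definition triang : Type := (fun _ : p \in [pchar W] => (W * M * 'F_p)%type) pW.
HB.instance Definition _ := GRing.Zmodule.copy triang (W * M * 'F_p)%type.

Definition Fp_to (n : 'F_p) : W := (n : nat)%:R.
Local Notation c := Fp_to.
Let p_pr := pcharf_prime pW.

Let c_mod (n : nat) : (n %% (Zp_trunc (pdiv p)).+2)%:R = n%:R :> W.
Proof. by rewrite Fp_cast // (GRing.natr_mod_pchar pW). Qed.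
Let cD m n : c (m + n) = c m + c n.
Proof. by rewrite /Fp_to /= c_mod natrD. Qed.
Let cM m n : c (m * n) = c m * c n.
Proof. by rewrite /Fp_to /= c_mod natrM. Qed.
Let c1 : c 1 = 1.
Proof. by rewrite /Fp_to /= c_mod. Qed.

Definition triang_mul (x y : triang) : triang :=
  (x.1.1 * y.1.1, x.1.1 *: y.1.2 + c y.2 *: x.1.2, x.2 * y.2).
Definition triang_one : triang := (1, 0, 1).

Lemma triang_mulA : associative triang_mul.
Proof.
move=> [[w m] n] [[w' m'] n'] [[w'' m''] n'']; rewrite /triang_mul /=.
congr (_, _, _); rewrite ?mulrA // cM !scalerDr !scalerA addrA.
by rewrite [w * c n'']commr_nat [c n' * c n'']commr_nat.
Qed.
Lemma triang_mul1 : left_id triang_one triang_mul.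
Proof.
by move=> [[w m] n]; rewrite /triang_mul /= !mul1r scale1r scaler0 addr0.
Qed.
Lemma triang_mulr1 : right_id triang_one triang_mul.
Proof.
move=> [[w m] n]; rewrite /triang_mul /= c1.
by rewrite !mulr1 scale1r scaler0 add0r.
Qed.
Lemma triang_mulDl : left_distributive triang_mul +%R.
Proof.
move=> [[w m] n] [[w' m'] n'] [[w'' m''] n'']; rewrite /triang_mul /=.
by congr (_, _, _); rewrite /= ?mulrDl // scalerDl scalerDr addrACA.
Qed.
Lemma triang_mulDr : right_distributive triang_mul +%R.
Proof.
move=> [[w m] n] [[w' m'] n'] [[w'' m''] n'']; rewrite /triang_mul /=.
congr (_, _, _); rewrite /= ?mulrDr // cD scalerDl scalerDr.
by rewrite addrACA.
Qed.
Lemma triang_1neq0 : triang_one != 0.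
Proof. by apply/eqP => -[/eqP]; rewrite oner_eq0. Qed.
HB.instance Definition _ := GRing.Zmodule_isNzRing.Build triang
  triang_mulA triang_mul1 triang_mulr1 triang_mulDl triang_mulDr triang_1neq0.

Lemma triang_pchar : p \in [pchar triang].
Proof.
apply/andP; split=> //; apply/eqP.
have E k : k%:R = (k%:R, 0, k%:R) :> triang.
  elim: k => // k IHk; rewrite mulrS IHk; congr (_, _, _).
  - by rewrite mulrS.
  - by rewrite /= addr0.
  - by rewrite mulrS.
rewrite E pcharf0 //; congr (_, _, _).
by rewrite -(pcharf0 (pchar_Fp p_pr)).
Qed.
End Triangular.

(* H |x_f M for a w(H)-module M; F acts on M through R_f. *)
Section RestrictedSemidirect.
Variables (p : nat) (F : fieldType) (pF : p \in [pchar F]).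
Variables (H : rlieType p F) (U : uea H) (u : renv U) (R : skew_poly p F).
Variables (W : wring u R).

Definition w_scal : {rmorphism F -> W} := w_skew W \o sp_const R.
Definition w_act (h : H) : W := w_env W (renv_in u h).

Lemma w_scalE c : w_scal c = w_env W c%:A.
Proof.
have [_ _ /(_ 1 c 1)] := w_balanced W.
by rewrite mul1r !rmorph1 mulr1 mul1r.
Qed.

Lemma w_act_linear a x y : w_act (a *: x + y) = w_scal a * w_act x + w_act y.
Proof.
rewrite /w_act /renv_in (uea_in_rep U).1 linearP rmorphD w_scalE -rmorphM.
by rewrite mulr_algl.
Qed.

Lemma w_act_bracket x y : w_act (bracket x y) = commutator (w_act x) (w_act y).
Proof.
by rewrite /w_act /renv_in (uea_in_rep U).2 !(rmorphB, rmorphM).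
Qed.

Lemma w_act_pmap x : w_act (pmap x) = w_act x ^+ p.
Proof.
rewrite /w_act -rmorphXn /renv_in -rmorphXn; congr (w_env W _).
apply/esym/eqP; rewrite -subr_eq0 -rmorphB; apply/eqP/renv_ker.
by apply: ideal_gen_in; exists x.
Qed.

Lemma w_scal_act c x : w_scal c * w_act x = w_act x * w_scal c.
Proof. by rewrite w_scalE /w_act -!rmorphM mulr_algl mulr_algr. Qed.

Lemma w_act_f x : w_act x * w_skew W (sp_f R) = 0.
Proof. exact: w_zero. Qed.

Lemma w_pchar : p \in [pchar W].
Proof. exact: (rmorph_pchar w_scal pF). Qed.

Variable M : lmodType W.
Local Notation M' := (restr w_scal M).

Definition ract (x : H) (m : M') : M' := w_act x *: (m : M).

Lemma ract_linearl m : linear (ract^~ m).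
Proof. by move=> a x y; rewrite /ract w_act_linear scalerDl -scalerA. Qed.
Lemma ract_linearr x : linear (ract x).
Proof.
move=> a m n; rewrite /ract scalerDr; congr (_ + _).
by rewrite [LHS]scalerA [RHS]scalerA w_scal_act.
Qed.
Lemma ract_bracket x y m :
  ract (bracket x y) m = ract x (ract y m) - ract y (ract x m).
Proof. by rewrite /ract w_act_bracket scalerBl -!scalerA. Qed.

Definition rsemi : Type := (fun _ : p \in [pchar F] => (H * M')%type) pF.
HB.instance Definition _ := GRing.Lmodule.copy rsemi (H * M')%type.
HB.instance Definition _ := isLie.Build F rsemi
  (semi_bracket_linearl ract_linearl ract_linearr)
  (semi_bracket_linearr ract_linearl ract_linearr)
  (semi_bracketxx ract)
  (semi_jacobi ract_linearr ract_bracket).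

Definition rsemi_pmap (X : rsemi) : rsemi :=
  (pmap X.1,
   (w_act X.1 ^+ p.-1 *: (X.2 : M) + w_skew W (sp_f R) *: (X.2 : M) : M')).

Let T := triang w_pchar M.
Let tri (X : rsemi) : T := (w_act X.1, X.2 : M, 0).

Let w_actD x y : w_act (x + y) = w_act x + w_act y.
Proof. by rewrite -{1}[x]scale1r w_act_linear rmorph1 mul1r. Qed.

Let p_gt0 : (0 < p)%N.
Proof. exact: prime_gt0 (pcharf_prime pF). Qed.

Let triD X Y : tri (X + Y) = tri X + tri Y.
Proof. by congr (_, _, _); rewrite /= ?w_actD // addr0. Qed.
Let tri0 : tri 0 = 0.
Proof. by apply: (@addrI _ (tri 0)); rewrite -triD !addr0. Qed.
Let tri_bracket X Y : tri (bracket X Y) = commutator (tri X) (tri Y).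
Proof.
congr (_, _, _); rewrite /= ?w_act_bracket //.
  by rewrite /Fp_to /= !scale0r !addr0.
by rewrite mul0r subr0.
Qed.
Let triX X k : tri X ^+ k.+1 =
  (w_act X.1 ^+ k.+1, w_act X.1 ^+ k *: (X.2 : M), 0) :> T.
Proof.
elim: k => [|k IHk]; first by rewrite !expr1 expr0 scale1r.
rewrite exprS IHk; congr (_, _, _); rewrite /= ?mulr0 ?(exprS _ k.+1) //.
by rewrite /Fp_to /= scale0r addr0 scalerA -exprS.
Qed.

Let triXp X : tri X ^+ p =
  (w_act X.1 ^+ p, w_act X.1 ^+ p.-1 *: (X.2 : M), 0) :> T.
Proof. by have := triX X p.-1; rewrite (prednK p_gt0). Qed.

Lemma rsemi_pmapZ a X : rsemi_pmap (a *: X) = a ^+ p *: rsemi_pmap X.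
Proof.
have wZ x : w_act (a *: x) = w_scal a * w_act x.
  have := w_act_linear a x 0; rewrite addr0 => ->.
  by rewrite -[RHS]addr0; congr (_ + _); apply: (@addrI _ (w_act 0));
     rewrite -w_actD !addr0.
congr pair; first exact: pmapZ.
have cX k x : (w_scal a * w_act x) ^+ k = w_scal a ^+ k * w_act x ^+ k.
  by rewrite exprMn_comm //; apply: w_scal_act.
rewrite /= wZ cX.
rewrite -[RHS]/(w_scal (a ^+ p) *: _ : M) scalerDr; congr (_ + _).
  rewrite -[in LHS]/(w_scal a *: (X.2 : M)) !scalerA.
  apply: (congr1 (fun w : W => w *: (X.2 : M))).
  rewrite -mulrA -(commrX p.-1 (w_scal_act a X.1)) mulrA -exprSr prednK //.
  by rewrite rmorphXn.
rewrite -[in LHS]/(w_scal a *: (X.2 : M)) !scalerA.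
apply: (congr1 (fun w : W => w *: (X.2 : M))).
by rewrite -rmorphM sp_comm rmorphM.
Qed.

Lemma rsemi_ad_pmap (X Y : rsemi) :
  bracket (rsemi_pmap X) Y = iter p (bracket X) Y.
Proof.
have fstI n : (iter n (bracket X) Y).1 = iter n (bracket X.1) Y.1.
  by elim: n => //= n <-.
have triI n : tri (iter n (bracket X) Y) = iter n (commutator (tri X)) (tri Y).
  by elim: n => //= n <-; rewrite tri_bracket.
rewrite [RHS]surjective_pairing fstI; congr pair; first exact: ad_pmap.
have := triI p; rewrite iter_commutator_pchar; last exact: triang_pchar.
rewrite triXp; move/(congr1 (fun t : T => t.1.2)) => /= ->.
rewrite /Fp_to /= !scale0r !addr0 /ract w_act_pmap scalerDr !scalerA w_act_f.
by rewrite scale0r addr0.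
Qed.

Lemma rsemi_pmapD (X Y : rsemi) :
  rsemi_pmap (X + Y) = rsemi_pmap X + rsemi_pmap Y
    + \sum_(1 <= i < p) (i%:R : F)^-1 *: jac bracket X Y p.-1 i.-1.
Proof.
have fst_sum (f : nat -> rsemi) :
    (\sum_(1 <= i < p) f i).1 = \sum_(1 <= i < p) (f i).1.
  exact: (raddf_sum (fst : rsemi -> H)).
have snd_sum (f : nat -> rsemi) :
    (\sum_(1 <= i < p) f i).2 = \sum_(1 <= i < p) (f i).2.
  exact: (raddf_sum (snd : rsemi -> M')).
have fstJ k j : (jac bracket X Y k j).1 = jac bracket X.1 Y.1 k j.
  by elim: k j => [|k IHk] [|j] //=; rewrite !IHk.
have triJ k j : tri (jac bracket X Y k j) =
                jac (@commutator T) (tri X) (tri Y) k j.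
  elim: k j => [|k IHk] [|j] //=; rewrite ?tri0 //.
    by rewrite triD tri_bracket IHk tri0.
  by rewrite triD !tri_bracket !IHk.
have [s [Es sJ]] := jacobson (triang_pchar w_pchar M) (tri X) (tri Y).
rewrite [RHS]surjective_pairing; congr pair.
  rewrite /= fst_sum pmapD; congr (_ + _).
  by apply: eq_bigr => i _; rewrite -fstJ.
move: Es; rewrite -triD !triXp => /(congr1 (fun t : T => t.1.2)).
have mid_sum (f : nat -> T) :
    (\sum_(1 <= i < p) f i).1.2 = \sum_(1 <= i < p) (f i).1.2.
  exact: (raddf_sum (snd \o fst : W * M * 'F_p -> M)).
rewrite /= mid_sum => ->.
rewrite [LHS]addrAC scalerDr addrACA; congr (_ + _).
rewrite snd_sum; apply: eq_big_nat => i /andP[i_gt0 lt_ip].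
have := sJ i i_gt0; rewrite -triJ => /(congr1 (fun t : T => t.1.2)).
have -> : (s i *+ i).1.2 = (s i).1.2 *+ i.
  exact: (raddfMn (snd \o fst : W * M * 'F_p -> M)).
rewrite [in X in X -> _]/= => Ei.
rewrite -[RHS]/((i%:R : F)^-1 *: (jac bracket X Y p.-1 i.-1).2) -Ei.
rewrite -[in RHS](@scaler_nat F M') scalerA mulVf ?scale1r //.
by rewrite -(dvdn_pcharf pF) gtnNdvd.
Qed.

HB.instance Definition _ := Lie_isRestricted.Build p F rsemi
  rsemi_pmapZ rsemi_ad_pmap rsemi_pmapD.

End RestrictedSemidirect.
Arguments lsemi {F L U} N.
Arguments rsemi {p F} pF {H U u R W} M.

(* A category of sets with structure; morphisms are the maps satisfying       *)
(* [cc_hom].                                                                  *)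
Record concrete_cat := ConcreteCat {
  cc_obj :> Type;
  cc_el : cc_obj -> Type;
  cc_hom : forall A B : cc_obj, (cc_el A -> cc_el B) -> Prop;
  cc_id : forall A, cc_hom (fun x : cc_el A => x);
  cc_comp : forall A B C (f : cc_el A -> cc_el B) (g : cc_el B -> cc_el C),
    cc_hom f -> cc_hom g -> cc_hom (fun x => g (f x))
}.
Arguments cc_hom {c A B} f.

Lemma lie_hom_id (F : fieldType) (L : lieType F) : lie_hom (fun x : L => x).
Proof. by split. Qed.
Lemma lie_hom_comp (F : fieldType) (A B C : lieType F) (f : A -> B)
    (g : B -> C) : lie_hom f -> lie_hom g -> lie_hom (fun x => g (f x)).
Proof.
by move=> [lf bf] [lg bg]; split=> [a x y|x y]; rewrite ?lf ?lg ?bf ?bg.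
Qed.
Lemma rlie_hom_id (p : nat) (F : fieldType) (H : rlieType p F) :
  rlie_hom (fun x : H => x).
Proof. by split=> //; exact: lie_hom_id. Qed.
Lemma rlie_hom_comp (p : nat) (F : fieldType) (A B C : rlieType p F)
    (f : A -> B) (g : B -> C) :
  rlie_hom f -> rlie_hom g -> rlie_hom (fun x => g (f x)).
Proof.
move=> [lf pf] [lg pg]; split=> [|x]; rewrite ?pf ?pg //.
exact: lie_hom_comp.
Qed.

Definition LieCat (F : fieldType) : concrete_cat :=
  ConcreteCat (@lie_hom_id F) (@lie_hom_comp F).
Definition RLieCat (p : nat) (F : fieldType) : concrete_cat :=
  ConcreteCat (@rlie_hom_id p F) (@rlie_hom_comp p F).

Record mor (K : concrete_cat) (A B : K) := Mor {
  mor_fun :> cc_el A -> cc_el B;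
  mor_hom : cc_hom mor_fun
}.

(* [Delta m n]: the nondecreasing maps [m] -> [n]. *)
Definition monotone (m n : nat) (f : {ffun 'I_m.+1 -> 'I_n.+1}) : bool :=
  [forall i : 'I_m.+1, forall j : 'I_m.+1, (i <= j)%N ==> (f i <= f j)%N].
Definition Delta (m n : nat) : Type :=
  {f : {ffun 'I_m.+1 -> 'I_n.+1} | monotone f}.

Lemma monotoneP (m n : nat) (f : {ffun 'I_m.+1 -> 'I_n.+1}) :
  reflect (forall i j : 'I_m.+1, (i <= j)%N -> (f i <= f j)%N) (monotone f).
Proof.
apply: (iffP forallP) => [mf i j le_ij|mf i].
  by have /forallP/(_ j)/implyP/(_ le_ij) := mf i.
by apply/forallP => j; apply/implyP; exact: mf.
Qed.

Lemma delta_id_subproof n : monotone [ffun i : 'I_n.+1 => i].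
Proof. by apply/monotoneP => i j; rewrite !ffunE. Qed.
Definition delta_id n : Delta n n := 
  exist (fun f => monotone f) _ (delta_id_subproof n).

Lemma delta_comp_subproof (l m n : nat) (f : Delta m n) (g : Delta l m) :
  monotone [ffun i => val f (val g i)].
Proof.
apply/monotoneP => i j le_ij; rewrite !ffunE.
by apply: (monotoneP _ (valP f)); apply: (monotoneP _ (valP g)).
Qed.
Definition delta_comp (l m n : nat) (f : Delta m n) (g : Delta l m) :
  Delta l n := exist (fun f => monotone f) _ (delta_comp_subproof f g).

(* The coface [n] -> [n+1] omitting i, and the unique map [n] -> [0]. *)
Lemma coface_subproof n (i : 'I_n.+2) : monotone [ffun j : 'I_n.+1 => lift i j].
Proof.
by apply/monotoneP => j k le_jk; rewrite !ffunE /= leq_bump2.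
Qed.
Definition coface n (i : 'I_n.+2) : Delta n n.+1 :=
  exist (fun f => monotone f) _ (coface_subproof i).

Lemma delta_pt_subproof n : monotone [ffun _ : 'I_n.+1 => ord0 : 'I_1].
Proof. by apply/monotoneP => j k _; rewrite !ffunE. Qed.
Definition delta_pt n : Delta n 0 :=
  exist (fun f => monotone f) _ (delta_pt_subproof n).

Record simplicial (K : concrete_cat) := Simplicial {
  s_obj :> nat -> K;
  s_map : forall m n, Delta m n -> mor (s_obj n) (s_obj m);
  s_map_id : forall n x, s_map (delta_id n) x = x;
  s_map_comp : forall l m n (f : Delta m n) (g : Delta l m) x,
    s_map (delta_comp f g) x = s_map g (s_map f x)
}.
Arguments s_map {K} s {m n} _.

Record smap (K : concrete_cat) (X Y : simplicial K) := SMap {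
  smap_fun :> forall n, mor (X n) (Y n);
  smap_nat : forall m n (f : Delta m n) x,
    smap_fun m (s_map X f x) = s_map Y f (smap_fun n x)
}.

Definition mor_id (K : concrete_cat) (A : K) : mor A A := Mor (cc_id A).
Definition mor_comp (K : concrete_cat) (A B C : K) (g : mor B C)
  (f : mor A B) : mor A C := Mor (cc_comp (mor_hom f) (mor_hom g)).

Definition sconst (K : concrete_cat) (A : K) : simplicial K :=
  @Simplicial K (fun _ => A) (fun m n _ => mor_id A)
    (fun _ _ => erefl) (fun _ _ _ _ _ _ => erefl).

(* Fibrations and weak equivalences are those of the underlying simplicial    *)
(* sets; the homotopy groups below are the right ones because simplicial      *)
(* groups are Kan complexes.                                                  *)
Section ModelStructure.
Variable K : concrete_cat.

(* The simplex f of Delta[n.+1] lies on the k-th horn. *)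
Definition in_horn n (k : 'I_n.+2) m (f : Delta m n.+1) : Prop :=
  exists2 i : 'I_n.+2, i != k & forall j, val f j != i.

(* Right lifting property against the horns Lambda^k[n+1] -> Delta[n+1]; the  *)
(* values of the horn [x] outside Lambda^k[n+1] are irrelevant.               *)
Definition kan_fibration (X Y : simplicial K) (q : smap X Y) : Prop :=
  forall n (k : 'I_n.+2) (x : forall m, Delta m n.+1 -> cc_el (X m))
    (y : cc_el (Y n.+1)),
  (forall m (f : Delta m n.+1), in_horn k f ->
     (forall l (g : Delta l m), x l (delta_comp f g) = s_map X g (x m f))
     /\ q m (x m f) = s_map Y f y) ->
  exists z : cc_el (X n.+1), q n.+1 z = y /\
    (forall m (f : Delta m n.+1), in_horn k f -> s_map X f z = x m f).

Definition basept (X : simplicial K) (v : cc_el (X 0)) n : cc_el (X n) :=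
  s_map X (delta_pt n) v.

(* n-simplices whose boundary is at the vertex v. *)
Definition spherical (X : simplicial K) (v : cc_el (X 0)) n
    (x : cc_el (X n)) : Prop :=
  forall m (f : Delta m n), (m < n)%N -> s_map X f x = basept v m.

Definition homotopic (X : simplicial K) (v : cc_el (X 0)) n
    (x y : cc_el (X n)) : Prop :=
  exists w : cc_el (X n.+1), forall i : 'I_n.+2,
    s_map X (coface i) w =
      if i == n.+1 :> nat then y else if i == n :> nat then x else basept v n.

Definition weak_equivalence (X Y : simplicial K) (q : smap X Y) : Prop :=
  forall (v : cc_el (X 0)) n,
    (forall x x' : cc_el (X n), spherical v x -> spherical v x' ->
       homotopic (q 0%N v) (q n x) (q n x') -> homotopic v x x')
    /\ (forall y : cc_el (Y n), spherical (q 0%N v) y ->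
       exists2 x, spherical v x & homotopic (q 0%N v) (q n x) y).

Definition cofibrant (C : simplicial K) : Prop :=
  forall (X Y : simplicial K) (q : smap X Y),
    kan_fibration q -> weak_equivalence q ->
  forall g : smap C Y, exists h : smap C X, forall n x, q n (h n x) = g n x.

Record augmented (A : K) := Augmented {
  aug_obj :> simplicial K;
  aug_map : smap aug_obj (sconst A)
}.

Record cofibrant_replacement (A : K) := CofibrantReplacement {
  cr_aug :> augmented A;
  cr_cofibrant : cofibrant cr_aug;
  cr_weq : weak_equivalence (aug_map cr_aug)
}.

Record over_map (A : K) (C D : augmented A) := OverMap {
  over_fun :> smap C D;
  over_aug : forall n x, aug_map D n (over_fun n x) = aug_map C n x
}.

End ModelStructure.

Record cosimplicial := Cosimplicial {
  cs_obj :> nat -> zmodType;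
  cs_map : forall m n, Delta m n -> {additive cs_obj m -> cs_obj n};
  cs_map_id : forall n x, cs_map (delta_id n) x = x;
  cs_map_comp : forall l m n (f : Delta m n) (g : Delta l m) x,
    cs_map (delta_comp f g) x = cs_map f (cs_map g x)
}.
Arguments cs_map c {m n} _.

Record csmap (A B : cosimplicial) := CSMap {
  csmap_fun :> forall n, {additive A n -> B n};
  csmap_nat : forall m n (f : Delta m n) x,
    csmap_fun n (cs_map A f x) = cs_map B f (csmap_fun m x)
}.

(* pi^n is the cohomology at A n of the cochain complex with differential     *)
(* the alternating sum of the cofaces.                                        *)
Section Cohomotopy.
Variables (A : cosimplicial) (n : nat).

Definition cobound k (x : A k) : A k.+1 :=
  \sum_(i < k.+2) cs_map A (coface i) x *~ (-1) ^+ i.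

Lemma cobound_is_additive k : zmod_morphism (@cobound k).
Proof.
move=> x y; rewrite /cobound -sumrB; apply: eq_bigr => i _.
by rewrite raddfB mulrzBl.
Qed.
HB.instance Definition _ k :=
  GRing.isZmodMorphism.Build (A k) (A k.+1) (@cobound k)
    (@cobound_is_additive k).

Definition is_cocycle : {pred A n} := fun x => cobound x == 0.
Lemma is_cocycle_zmod : zmod_closed is_cocycle.
Proof.
split=> [|x y]; rewrite /is_cocycle !unfold_in ?raddf0 // => /eqP x0 /eqP y0.
by rewrite raddfB /= x0 y0 subrr.
Qed.
HB.instance Definition _ := GRing.isZmodClosed.Build (A n) is_cocycle
  is_cocycle_zmod.

Record cocycle := Cocycle {
  cocycle_val : A n; cocycle_valP : cocycle_val \in is_cocycle }.
HB.instance Definition _ := [isSub for cocycle_val].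
HB.instance Definition _ := [Choice of cocycle by <:].
HB.instance Definition _ := [SubChoice_isSubZmodule of cocycle by <:].

Definition is_coboundary k : A k -> Prop :=
  match k with
  | 0%N => fun x => x = 0
  | k'.+1 => fun x => exists y : A k', x = cobound y
  end.

Definition coboundary : {pred cocycle} :=
  fun x => `[< is_coboundary (cocycle_val x) >].
Lemma coboundary_zmod : zmod_closed coboundary.
Proof.
suff H k : is_coboundary (0 : A k) /\ forall x y : A k,
    is_coboundary x -> is_coboundary y -> is_coboundary (x - y).
  split=> [|x y /asboolP bx /asboolP by_]; apply/asboolP; first exact: (H n).1.
  exact: (H n).2.
case: k => [|k] /=; split=> //.
- by move=> x y -> ->; rewrite subrr.
- by exists 0; rewrite raddf0.
- by move=> x y [x' ->] [y' ->]; exists (x' - y'); rewrite raddfB.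
Qed.
HB.instance Definition _ := GRing.isZmodClosed.Build cocycle coboundary
  coboundary_zmod.

Definition cohomotopy : zmodType := Quotient.quot coboundary.
Definition cohclass (z : cocycle) : cohomotopy :=
  \pi_(Quotient.quot coboundary) z.

End Cohomotopy.
Arguments is_cocycle A n : clear implicits.
Arguments coboundary A n : clear implicits.
Arguments cohclass {A n} z.

Section CohomotopyMap.
Variables (A B : cosimplicial) (phi : csmap A B) (n : nat).

Lemma cobound_csmap k (x : A k) : cobound (phi k x) = phi k.+1 (cobound x).
Proof.
rewrite raddf_sum; apply: eq_bigr => i _.
by rewrite raddfMz csmap_nat.
Qed.

Lemma cocycle_map_subproof (z : cocycle A n) :
  phi n (cocycle_val z) \in is_cocycle B n.
Proof.
case: z => z /= /eqP z0; apply/eqP.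
by rewrite cobound_csmap z0 raddf0.
Qed.
Definition cocycle_map (z : cocycle A n) : cocycle B n :=
  Cocycle (cocycle_map_subproof z).

Definition cohomotopy_fun (x : cohomotopy A n) : cohomotopy B n :=
  cohclass (cocycle_map (repr x)).

Lemma cohomotopy_funE z :
  cohomotopy_fun (cohclass z) = cohclass (cocycle_map z).
Proof.
apply/eqP; rewrite -Quotient.idealrBE; apply/asboolP.
have : repr (cohclass z) - z \in coboundary A n.
  by rewrite Quotient.idealrBE reprK.
move=> /asboolP.
have push k (x : A k) : is_coboundary x -> is_coboundary (phi k x).
  case: k x => [x /= ->|k x /= [y ->]]; first exact: raddf0.
  by exists (phi k y); rewrite cobound_csmap.
by move=> /push /=; rewrite raddfB.
Qed.

Lemma cohomotopy_fun_additive : zmod_morphism cohomotopy_fun.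
Proof.
move=> x y; rewrite -[x]reprK -[y]reprK -[_ - _](raddfB \pi_(Quotient.quot (coboundary A n))).
rewrite !(cohomotopy_funE : forall z, cohomotopy_fun (\pi z) = _).
rewrite -[RHS](raddfB \pi_(Quotient.quot (coboundary B n))); congr cohclass.
by apply: val_inj; rewrite /= raddfB.
Qed.
HB.instance Definition _ :=
  GRing.isZmodMorphism.Build (cohomotopy A n) (cohomotopy B n) cohomotopy_fun
    cohomotopy_fun_additive.
Definition cohomotopy_map : {additive cohomotopy A n -> cohomotopy B n} :=
  cohomotopy_fun.

End CohomotopyMap.

(* An abelian group object E -> X: E is X x M as a set, and the fibrewise     *)
(* operations of M make each Hom_{/X}(A, E) a group.                          *)
Record beck (K : concrete_cat) (X : K) := Beck {
  bk_mod : zmodType;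
  bk_obj : K;
  bk_pair : cc_el X * bk_mod -> cc_el bk_obj;
  bk_split : cc_el bk_obj -> cc_el X * bk_mod;
  bk_pairK : cancel bk_pair bk_split;
  bk_splitK : cancel bk_split bk_pair;
  bk_proj_hom : cc_hom (fun e => (bk_split e).1);
  bk_closed : forall (A : K) (a : mor A X),
    cc_hom (fun x => bk_pair (a x, 0)) /\
    forall d d' : cc_el A -> bk_mod,
      cc_hom (fun x => bk_pair (a x, d x)) ->
      cc_hom (fun x => bk_pair (a x, d' x)) ->
      cc_hom (fun x => bk_pair (a x, d x - d' x))
}.

Arguments bk_pair {K X} b _.
Arguments bk_split {K X} b _.

(* Hom_{/X}(A, E), a morphism x |-> (a x, d x) being recorded by d. *)
Section HomOver.
Variables (K : concrete_cat) (X : K) (E : beck X) (A : K) (a : mor A X).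

Definition is_over : {pred cc_el A -> bk_mod E} :=
  fun d => `[< cc_hom (fun x => bk_pair E (a x, d x)) >].

Lemma is_over_zmod : zmod_closed is_over.
Proof.
have [h0 hB] := bk_closed E a.
split=> [|d d' /asboolP hd /asboolP hd']; apply/asboolP; first exact: h0.
exact: hB.
Qed.
HB.instance Definition _ := GRing.isZmodClosed.Build (cc_el A -> bk_mod E)
  is_over is_over_zmod.

Record hom_over := HomOver {
  hom_over_val :> cc_el A -> bk_mod E; hom_overP : hom_over_val \in is_over }.
HB.instance Definition _ := [isSub for hom_over_val].
HB.instance Definition _ := [Choice of hom_over by <:].
HB.instance Definition _ := [SubChoice_isSubZmodule of hom_over by <:].

End HomOver.

Arguments is_over {K X} E {A} a.

Section HomOverMaps.
Variables (K : concrete_cat) (X : K) (E : beck X).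
Variables (A B : K) (a : mor A X) (b : mor B X) (f : mor A B).
Hypothesis f_over : forall x, b (f x) = a x.

Lemma pull_subproof (d : hom_over E b) : (fun x => d (f x)) \in is_over E a.
Proof.
apply/asboolP; have /asboolP hd := hom_overP d.
rewrite (_ : (fun x => _) = fun x => bk_pair E (b (f x), d (f x))).
  exact: cc_comp (mor_hom f) hd.
by apply/funext => x; rewrite f_over.
Qed.
Definition pull (d : hom_over E b) : hom_over E a := HomOver (pull_subproof d).
Lemma pull_additive : zmod_morphism pull.
Proof. by move=> d d'; apply: val_inj. Qed.
HB.instance Definition _ :=
  GRing.isZmodMorphism.Build (hom_over E b) (hom_over E a) pull pull_additive.

End HomOverMaps.

Section QuillenCohomology.
Variables (K : concrete_cat) (X : K) (E : beck X).

Lemma aug_over (C : augmented X) m n (f : Delta m n) x :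
  aug_map C m (s_map C f x) = aug_map C n x.
Proof. exact: (smap_nat (aug_map C)). Qed.

Lemma hom_cosimplicial_id (C : augmented X) n
    (d : hom_over E (aug_map C n)) :
  pull (aug_over (C := C) (delta_id n)) d = d.
Proof. by apply: val_inj; apply/funext => y /=; rewrite s_map_id. Qed.

Lemma hom_cosimplicial_comp (C : augmented X) l m n (f : Delta m n)
    (g : Delta l m) (d : hom_over E (aug_map C l)) :
  pull (aug_over (C := C) (delta_comp f g)) d =
  pull (aug_over (C := C) f) (pull (aug_over (C := C) g) d).
Proof. by apply: val_inj; apply/funext => y /=; rewrite s_map_comp. Qed.

Definition hom_cosimplicial (C : augmented X) : cosimplicial :=
  @Cosimplicial (fun n => hom_over E (aug_map C n))
    (fun m n f => pull (E := E) (aug_over (C := C) f))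
    (@hom_cosimplicial_id C) (@hom_cosimplicial_comp C).

Definition HQ (C : cofibrant_replacement X) (n : nat) : zmodType :=
  cohomotopy (hom_cosimplicial C) n.

Lemma over_pull_nat (C D : augmented X) (t : over_map C D) m n
    (f : Delta m n) (d : hom_over E (aug_map D m)) :
  pull (E := E) (over_aug t (n := n)) (cs_map (hom_cosimplicial D) f d) =
  cs_map (hom_cosimplicial C) f (pull (E := E) (over_aug t (n := m)) d).
Proof.
by apply: val_inj; apply/funext => x /=; rewrite smap_nat.
Qed.

Definition hom_pull (C D : augmented X) (t : over_map C D) :
  csmap (hom_cosimplicial D) (hom_cosimplicial C) :=
  @CSMap (hom_cosimplicial D) (hom_cosimplicial C)
    (fun n => pull (E := E) (over_aug t (n := n))) (over_pull_nat t).

Definition HQ_pull (C D : cofibrant_replacement X) (t : over_map C D) n :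
  {additive HQ D n -> HQ C n} := cohomotopy_map (hom_pull t) n.

End QuillenCohomology.

Section LieBeck.
Variables (F : fieldType) (L : lieType F) (U : uea L) (N : lmodType U).

Lemma lie_beck_proj : lie_hom (fun X : lsemi N => X.1).
Proof. by split. Qed.

Lemma lie_beck_closed (A : lieType F) (a : mor (A : LieCat F) (L : LieCat F)) :
  lie_hom (fun x => (a x, 0) : lsemi N) /\
  forall d d' : A -> N,
    lie_hom (fun x => (a x, d x) : lsemi N) ->
    lie_hom (fun x => (a x, d' x) : lsemi N) ->
    lie_hom (fun x => (a x, d x - d' x) : lsemi N).
Proof.
split; first exact: (semi_hom0 (@uact_linearr _ _ _ _) (mor_hom a)).
by move=> d d'; exact: (semi_homB (@uact_linearr _ _ _ _)).
Qed.

Definition lie_beck : beck (L : LieCat F) :=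
  @Beck (LieCat F) L N (lsemi N) (fun X => X) (fun X => X)
    (fun _ => erefl) (fun _ => erefl) lie_beck_proj lie_beck_closed.
End LieBeck.
Arguments lie_beck {F L U} N.

Section RestrictedLieBeck.
Variables (p : nat) (F : fieldType) (pF : p \in [pchar F]).
Variables (H : rlieType p F) (U : uea H) (u : renv U) (R : skew_poly p F).
Variables (W : wring u R) (M : lmodType W).
Local Notation E := (rsemi pF M).

Lemma rlie_beck_proj : rlie_hom (fun X : E => X.1).
Proof. by split. Qed.

Lemma rlie_beck_closed (A : rlieType p F)
    (a : mor (A : RLieCat p F) (H : RLieCat p F)) :
  rlie_hom (fun x => (a x, 0) : E) /\
  forall d d' : A -> M,
    rlie_hom (fun x => (a x, d x) : E) ->
    rlie_hom (fun x => (a x, d' x) : E) ->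
    rlie_hom (fun x => (a x, d x - d' x) : E).
Proof.
have [a_lie a_p] := mor_hom a; split.
  split; first exact: (semi_hom0 (@ract_linearr _ _ _ _ _ _ _ _) a_lie).
  by move=> x; congr pair; rewrite ?a_p //= !scaler0 addr0.
move=> d d' [hd hdp] [hd' hdp']; split.
  exact: (semi_homB (@ract_linearr _ _ _ _ _ _ _ _) hd hd').
move=> x; congr pair; first exact: a_p.
have [_ ->] := hdp x; have [_ ->] := hdp' x.
by rewrite /= !scalerBr opprD addrACA.
Qed.

Definition rlie_beck : beck (H : RLieCat p F) :=
  @Beck (RLieCat p F) H M E (fun X => X) (fun X => X)
    (fun _ => erefl) (fun _ => erefl) rlie_beck_proj rlie_beck_closed.
End RestrictedLieBeck.
Arguments rlie_beck {p F} pF {H U u R W} M.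

Section Forget.
Variables (p : nat) (F : fieldType).

Definition forget_mor (A B : RLieCat p F) (f : mor A B) :
    mor ((A : rlieType p F) : LieCat F) ((B : rlieType p F) : LieCat F) :=
  @Mor (LieCat F) A B f (mor_hom f).1.

Definition forget (X : simplicial (RLieCat p F)) : simplicial (LieCat F) :=
  @Simplicial (LieCat F) (fun n => (X n : rlieType p F))
    (fun m n f => forget_mor (s_map X f)) (@s_map_id _ X) (@s_map_comp _ X).

Definition forget_aug (H : rlieType p F)
    (D : augmented (H : RLieCat p F)) : augmented (H : LieCat F) :=
  @Augmented (LieCat F) H (forget D)
    (@SMap (LieCat F) (forget D) (sconst (H : LieCat F))
       (fun n => forget_mor (aug_map D n)) (smap_nat (aug_map D))).
End Forget.

Section Envelope.
Variables (p : nat) (F : fieldType) (pF : p \in [pchar F]).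

Definition env_mor (A B : LieCat F) (UA : uea (A : lieType F))
    (UB : uea (B : lieType F)) (f : mor A B) :
    mor (penv pF UA : RLieCat p F) (penv pF UB : RLieCat p F) :=
  @Mor (RLieCat p F) (penv pF UA) (penv pF UB)
    (penv_map pF UA UB (mor_hom f)) (penv_map_hom pF UA UB (mor_hom f)).

Variables (C : simplicial (LieCat F)).
Variables (UC : forall n, uea (C n : lieType F)).

Lemma env_map_id n x :
  env_mor (UC n) (UC n) (s_map C (delta_id n)) x = x.
Proof. by apply: penv_map_id => y; rewrite s_map_id. Qed.

Lemma env_map_comp l m n (f : Delta m n) (g : Delta l m) x :
  env_mor (UC n) (UC l) (s_map C (delta_comp f g)) x =
  env_mor (UC m) (UC l) (s_map C g) (env_mor (UC n) (UC m) (s_map C f) x).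
Proof. by apply: penv_map_comp => y; rewrite /= s_map_comp. Qed.

Definition env : simplicial (RLieCat p F) :=
  @Simplicial (RLieCat p F) (fun n => penv pF (UC n))
    (fun m n f => env_mor (UC n) (UC m) (s_map C f)) env_map_id env_map_comp.

End Envelope.

Section EnvelopeAugmented.
Variables (p : nat) (F : fieldType) (pF : p \in [pchar F]).
Variables (L : lieType F) (U : uea L) (C : augmented (L : LieCat F)).
Variables (UC : forall n, uea (C n : lieType F)).

Lemma env_aug_nat m n (f : Delta m n) x :
  env_mor pF (UC m) U (aug_map C m) (env_mor pF (UC n) (UC m) (s_map C f) x) =
  env_mor pF (UC n) U (aug_map C n) x.
Proof.
symmetry; apply: penv_map_comp => y /=.
by rewrite (smap_nat (aug_map C)).
Qed.

Definition env_aug : augmented (penv pF U : RLieCat p F) :=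
  @Augmented (RLieCat p F) (penv pF U) (env pF UC)
    (@SMap (RLieCat p F) (env pF UC) (sconst (penv pF U : RLieCat p F))
       (fun n => env_mor pF (UC n) U (aug_map C n)) env_aug_nat).
End EnvelopeAugmented.

Definition csmap_comp_nat (A B C : cosimplicial) (psi : csmap B C)
    (phi : csmap A B) m n (f : Delta m n) (x : A m) :
  (psi n \o phi n) (cs_map A f x) = cs_map C f ((psi m \o phi m) x).
Proof. by rewrite /= !csmap_nat. Qed.
Definition csmap_comp (A B C : cosimplicial) (psi : csmap B C)
  (phi : csmap A B) : csmap A C :=
  @CSMap A C (fun n => psi n \o phi n) (@csmap_comp_nat A B C psi phi).

(* Along g : L -> H and s : C -> D over g, d |-> d s is a map                 *)
(* Hom_{RLie/H}(D, H |x_f M) -> Hom_{Lie/L}(C, L |x M), where U(L) acts on M  *)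
(* through phi : U(L) -> w(H) extending g.                                    *)
Section Restriction.
Variables (p : nat) (F : fieldType) (pF : p \in [pchar F]).
Variables (H : rlieType p F) (U : uea H) (u : renv U) (R : skew_poly p F).
Variables (W : wring u R) (M : lmodType W).
Variables (L : lieType F) (UL : uea L) (g : L -> H).
Variables (phi : {rmorphism UL -> W}).
Hypothesis phi_in : forall x, phi (uea_in UL x) = w_act W (g x).
Hypothesis phi_scal : forall c, phi c%:A = w_scal W c.
Variables (D : augmented (H : RLieCat p F)) (C : augmented (L : LieCat F)).
Variable s : smap C (forget D).
Hypothesis s_over : forall n x, aug_map D n (s n x) = g (aug_map C n x).

Lemma lie_restrict_subproof n (d : hom_over (rlie_beck pF M) (aug_map D n)) :
  (fun x => hom_over_val d (s n x)) \in
    is_over (lie_beck (restr phi M)) (aug_map C n).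
Proof.
have /asboolP[[d_lin d_br] _] := hom_overP d.
have [s_lin s_br] := mor_hom (s n); have [a_lin a_br] := mor_hom (aug_map C n).
apply/asboolP; split=> [c x y|x y]; congr pair.
- exact: a_lin.
- rewrite /= s_lin; have [_ ->] := d_lin c (s n x) (s n y).
  congr (_ + _); rewrite -[RHS]/(phi c%:A *: (hom_over_val d (s n x) : M)).
  by rewrite phi_scal.
- exact: a_br.
- rewrite /= s_br; have [_ ->] := d_br (s n x) (s n y).
  rewrite -[RHS]/(phi (uea_in UL (aug_map C n x)) *: (hom_over_val d (s n y) : M)
     - phi (uea_in UL (aug_map C n y)) *: (hom_over_val d (s n x) : M)).
  by rewrite !phi_in -!s_over.
Qed.

Definition lie_restrict_fun n (d : hom_cosimplicial (rlie_beck pF M) D n) :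
  hom_cosimplicial (lie_beck (restr phi M)) C n :=
  HomOver (lie_restrict_subproof d).

Lemma lie_restrict_additive n : zmod_morphism (@lie_restrict_fun n).
Proof. by move=> d d'; apply: val_inj. Qed.
HB.instance Definition _ n := GRing.isZmodMorphism.Build
  (hom_cosimplicial (rlie_beck pF M) D n)
  (hom_cosimplicial (lie_beck (restr phi M)) C n)
  (@lie_restrict_fun n) (@lie_restrict_additive n).

Lemma lie_restrict_nat m n (f : Delta m n)
    (d : hom_cosimplicial (rlie_beck pF M) D m) :
  lie_restrict_fun (cs_map (hom_cosimplicial (rlie_beck pF M) D) f d) =
  cs_map (hom_cosimplicial (lie_beck (restr phi M)) C) f (lie_restrict_fun d).
Proof.
apply: val_inj; apply/funext => x /=.
by rewrite smap_nat.
Qed.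

Definition lie_restrict : csmap (hom_cosimplicial (rlie_beck pF M) D)
                                (hom_cosimplicial (lie_beck (restr phi M)) C) :=
  @CSMap (hom_cosimplicial (rlie_beck pF M) D)
    (hom_cosimplicial (lie_beck (restr phi M)) C)
    (fun n => @lie_restrict_fun n) lie_restrict_nat.

End Restriction.

Section EnvelopeComparison.
Variables (p : nat) (F : fieldType) (pF : p \in [pchar F]).
Variables (L : lieType F) (U : uea L).
Local Notation Lh := (penv pF U).
Variables (V : uea Lh) (u : renv V) (R : skew_poly p F) (W : wring u R).

Lemma renv_penv_rep : lie_rep (fun x => renv_in u (penv_unit pF U x)).
Proof.
have [v_lin v_br] := uea_in_rep V; have [e_lin e_br] := penv_unit_hom pF U.
split=> [a x y|x y]; rewrite /renv_in.
  by rewrite e_lin v_lin linearP.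
by rewrite e_br v_br rmorphB !rmorphM.
Qed.

(* The isomorphism U(L) -> u(L^). *)
Definition uea_to_renv : {lrmorphism U -> u} := uea_ext U renv_penv_rep.
(* U(L) -> u(L^) -> w(L^) *)
Definition uea_to_w : {rmorphism U -> W} := w_env W \o uea_to_renv.

Lemma uea_to_w_in x : uea_to_w (uea_in U x) = w_act W (penv_unit pF U x).
Proof. by rewrite /= uea_extE. Qed.
Lemma uea_to_w_scal c : uea_to_w c%:A = w_scal W c.
Proof. by rewrite w_scalE /= linearZ rmorph1. Qed.

Variables (M : lmodType W).
Variables (C : augmented (L : LieCat F)) (UC : forall n, uea (C n : lieType F)).

Definition env_unit n :
    mor (C n) ((penv pF (UC n) : lieType F) : LieCat F) :=
  @Mor (LieCat F) (C n) (penv pF (UC n))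
    (penv_unit pF (UC n)) (penv_unit_hom pF (UC n)).

Lemma env_unit_nat m n (f : Delta m n) x :
  env_unit m (s_map C f x) = s_map (forget (env pF UC)) f (env_unit n x).
Proof. by rewrite /= penv_map_unit. Qed.

Definition env_unit_smap : smap C (forget (env_aug pF U UC)) :=
  @SMap (LieCat F) C (forget (env_aug pF U UC)) env_unit env_unit_nat.

Lemma env_unit_over n x :
  aug_map (env_aug pF U UC) n (env_unit_smap n x) =
  penv_unit pF U (aug_map C n x).
Proof. exact: penv_map_unit. Qed.

(* Hom_{/L^}(D, E) -> Hom_{/L^}(C^, E) ~= Hom_{/L}(C, eta^* E) *)
Definition env_comparison (D : augmented (Lh : RLieCat p F))
    (t : over_map (env_aug pF U UC) D) :
  csmap (hom_cosimplicial (rlie_beck pF M) D)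
        (hom_cosimplicial (lie_beck (restr uea_to_w M)) C) :=
  csmap_comp (lie_restrict pF M uea_to_w_in uea_to_w_scal env_unit_over)
             (hom_pull (rlie_beck pF M) t).
End EnvelopeComparison.
Arguments uea_to_w {p F pF L U V u R} W.

Section ForgetComparison.
Variables (p : nat) (F : fieldType) (pF : p \in [pchar F]).
Variables (H : rlieType p F) (U : uea H) (u : renv U) (R : skew_poly p F).
Variables (W : wring u R).

(* theta : U(H) -> u(H) -> w(H) *)
Definition theta : {rmorphism U -> W} := w_env W \o renv_proj u.

Lemma theta_scal c : theta c%:A = w_scal W c.
Proof. by rewrite w_scalE /= linearZ rmorph1. Qed.

Variables (M : lmodType W).

(* Hom_{/H}(D, E) -> Hom_{/H}(D, E) in Lie -> Hom_{/H}(C, E) *)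
Definition forget_comparison (D : augmented (H : RLieCat p F))
    (C : augmented (H : LieCat F)) (t : over_map C (forget_aug D)) :
  csmap (hom_cosimplicial (rlie_beck pF M) D)
        (hom_cosimplicial (lie_beck (restr theta M)) C) :=
  lie_restrict pF M (g := id)
    (fun x => erefl (theta (uea_in U x))) theta_scal
    (s := t) (over_aug t).
End ForgetComparison.
Arguments theta {p F H U u R} W.

(* Main.v *)
From HB Require Import structures.
From mathcomp Require Import all_boot all_order all_algebra.
From mathcomp Require Import boolp classical_sets functions wochoice.
From mathcomp Require Import zify ring.
Require Import Defs.

(** The cochain complexes that compute the two sides are the groups of
    derivations [D n -> M] and [C n -> M] over the base. Composition with a
    simplicial Lie algebra map [s : C -> forget D] over [g : L -> H] sends the
    first kind to the second, so everything rests on the existence of [s] and on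
    its uniqueness up to homotopy. In case (1), [g] is the unit [L -> L^], in
    case (2) the identity.

    Existence ([lift_over]). The augmentation of [D] is a weak equivalence onto
    a constant object; as simplicial groups are Kan complexes, it is also a
    fibration, and [C] is cofibrant. This is proved in the form
    [weq_const_lifting]: such an augmentation has the right lifting property
    against every inclusion of a subcomplex into a standard simplex.

    Uniqueness ([lift_cohomotopy]). The simplicial Lie algebra [paths] of maps
    [Delta[n] x Delta[1] -> D n] over a point of the base maps to the fibre
    product [pairs] by evaluation at the two ends. A prism embeds in a simplex,
    so the general lifting property of the augmentation makes this map an
    acyclic fibration ([ends_lifting]). Hence two maps [s], [s'] over [g] lift to
    [paths], and the prism operator turns the lift into a cochain homotopy
    ([ends_cohomotopy]). Independence of all choices and naturality follow at
    once, and the second half of the statement is proved.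

    The first half also claims that the augmented object [C^], obtained from [C]
    by taking p-envelopes in each degree, maps to [D]. Such a map is the
    extension of [s], and its existence is the universal property of the
    p-envelope ([penv_extension]): a Lie algebra map [g : L -> H] to a restricted
    Lie algebra extends to the p-envelope inside [U(L)]. For this one needs to
    know that the associative p-th powers of the elements of a basis satisfy no
    unexpected linear relation in [U(H)], which is a consequence of the theorem
    of Poincare, Birkhoff and Witt. That theorem is proved here in dual form, for
    Lie algebras of any dimension: [pbw_functional_rel] constructs linear
    functionals on [U(H)] with prescribed values on sorted words in a basis, by
    straightening words and checking confluence (the Jacobi identity resolves
    overlapping descents). The restricted Lie algebra generated by [H] in the
    endomorphisms of the space of all such functionals, paired with [H] itself,
    is the span [power_span] of the pairs [(x^(p^k), x^[p]^k)]; a functional with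
    suitable values on the powers [x^(p^k)] shows that it is the graph of a
    function. *)

Set Implicit Arguments.
Unset Strict Implicit.
Unset Printing Implicit Defensive.
Import GRing.Theory.
Local Open Scope ring_scope.

(** * Subcomplexes of simplices and the lifting property *)

Lemma ord_eqE n (i j : 'I_n) : (i == j) = (i == j :> nat).
Proof. by []. Qed.

Lemma deltaP m n (f g : Delta m n) : (forall i, val f i = val g i :> nat) -> f = g.
Proof. by move=> fg; apply/val_inj/ffunP => i; apply/val_inj/fg. Qed.

Lemma delta_mono m n (f : Delta m n) (i j : 'I_m.+1) :
  (i <= j)%N -> (val f i <= val f j)%N.
Proof. exact: (monotoneP _ (valP f)). Qed.

Lemma delta_compE l m n (f : Delta m n) (g : Delta l m) i :
  val (delta_comp f g) i = val f (val g i).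
Proof. by rewrite /= ffunE. Qed.

Lemma delta_idE n i : val (delta_id n) i = i.
Proof. by rewrite /= ffunE. Qed.

Lemma delta_compA k l m n (f : Delta m n) (g : Delta l m) (h : Delta k l) :
  delta_comp f (delta_comp g h) = delta_comp (delta_comp f g) h.
Proof. by apply: deltaP => i; rewrite !delta_compE. Qed.

Lemma delta_comp1 m n (f : Delta m n) : delta_comp f (delta_id m) = f.
Proof. by apply: deltaP => i; rewrite delta_compE delta_idE. Qed.

Lemma delta_1comp m n (f : Delta m n) : delta_comp (delta_id n) f = f.
Proof. by apply: deltaP => i; rewrite delta_compE delta_idE. Qed.

Section DeltaMk.
Variables (m n : nat) (f : 'I_m.+1 -> 'I_n.+1).
Hypothesis f_mono : forall i j : 'I_m.+1, (i <= j)%N -> (f i <= f j)%N.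
Lemma delta_mk_subproof : monotone [ffun i => f i].
Proof. by apply/monotoneP => i j le_ij; rewrite !ffunE f_mono. Qed.
Definition delta_mk : Delta m n := exist (fun f => monotone f) _ delta_mk_subproof.
Lemma delta_mkE i : val delta_mk i = f i.
Proof. by rewrite /= ffunE. Qed.
End DeltaMk.

Lemma cofaceE n (i : 'I_n.+2) j : val (coface i) j = lift i j.
Proof. by rewrite /= ffunE. Qed.

Definition misses m n (f : Delta m n) (i : 'I_n.+1) : Prop :=
  forall j, val f j != i.

Definition in_boundary m n (f : Delta m n) : Prop := exists i, misses f i.

Lemma misses_comp l m n (f : Delta m n) (g : Delta l m) i :
  misses f i -> misses (delta_comp f g) i.
Proof. by move=> fi j; rewrite delta_compE. Qed.

Lemma coface_misses n (i : 'I_n.+2) : misses (coface i) i.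
Proof. by move=> j; rewrite cofaceE eq_sym neq_lift. Qed.

Lemma codeg_mono n (r : 'I_n.+2) (i j : 'I_n.+2) : (i <= j)%N ->
  ((inord (minn (unbump r i) n) : 'I_n.+1) <=
   (inord (minn (unbump r j) n) : 'I_n.+1))%N.
Proof.
move=> le_ij; rewrite !inordK ?ltnS ?geq_minr // leq_min geq_minr andbT.
by rewrite (leq_trans (geq_minl _ _)) // /unbump; lia.
Qed.
(** A left inverse of the coface omitting [r], defined uniformly: the minimum
    differs from [unbump] only at the last vertex, when [r] is the last one. *)
Definition codeg n (r : 'I_n.+2) : Delta n.+1 n := delta_mk (@codeg_mono n r).

Lemma codegE n (r : 'I_n.+2) i : val (codeg r) i = minn (unbump r i) n :> nat.
Proof. by rewrite delta_mkE inordK // ltnS geq_minr. Qed.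

Lemma codegK n (r : 'I_n.+2) : delta_comp (codeg r) (coface r) = delta_id n.
Proof.
apply: deltaP => i; rewrite delta_compE delta_idE codegE cofaceE /= bumpK.
by apply/minn_idPl; rewrite -ltnS.
Qed.

Lemma misses_factor m n (r : 'I_n.+2) (f : Delta m n.+1) :
  misses f r -> f = delta_comp (coface r) (delta_comp (codeg r) f).
Proof.
move=> fr; apply: deltaP => i; rewrite !delta_compE cofaceE /= codegE.
have := fr i; rewrite ord_eqE /=; have := ltn_ord (val f i); have := ltn_ord r.
rewrite /unbump /bump; move: (nat_of_ord _) => a; move: (nat_of_ord _) => b.
by lia.
Qed.

Lemma misses0 m (f : Delta m 0) i : ~ misses f i.
Proof. by move=> /(_ ord0); rewrite !ord1. Qed.

(** Hence a subcomplex that contains a surjective simplex is the whole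
    simplex. *)
Lemma surjective_section m n (f : Delta m n) : ~ in_boundary f ->
  exists g : Delta n m, delta_comp f g = delta_id n.
Proof.
move=> fS; have pre i : exists j, val f j == i.
  apply: contrapT => nf; apply: fS; exists i => j.
  by apply/negP => fj; apply: nf; exists j.
pose g i := xchoose (pre i); have gP i : val f (g i) = i.
  exact/eqP/(xchooseP (pre i)).
have g_mono (i j : 'I_n.+1) : (i <= j)%N -> (g i <= g j)%N.
  rewrite leq_eqVlt => /orP[/eqP/val_inj-> //|lt_ij].
  rewrite leqNgt; apply/negP => /ltnW/(delta_mono f); rewrite !gP leqNgt.
  by rewrite lt_ij.
exists (delta_mk g_mono); apply: deltaP => i.
by rewrite delta_compE delta_mkE gP delta_idE.
Qed.

Section Extension.
Variable K : concrete_cat.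

Definition compatible (X : simplicial K) n (P : forall m, Delta m n -> Prop)
    (x : forall m, Delta m n -> cc_el (X m)) : Prop :=
  forall l m (f : Delta m n) (g : Delta l m), P m f ->
    P l (delta_comp f g) /\ x l (delta_comp f g) = s_map X g (x m f).

(** The right lifting property against all inclusions of a subcomplex
    [P] into a standard simplex. Unlike the homotopical definition of acyclic
    fibrations, it passes to path objects at once. *)
Definition simplex_lifting (X Y : simplicial K) (q : smap X Y) : Prop :=
  forall n (P : forall m, Delta m n -> Prop)
    (x : forall m, Delta m n -> cc_el (X m)) (y : cc_el (Y n)),
  compatible P x -> (forall m f, P m f -> q m (x m f) = s_map Y f y) ->
  exists z, q n z = y /\ forall m f, P m f -> s_map X f z = x m f.

Lemma s_basept (X : simplicial K) v m n (f : Delta m n) :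
  s_map X f (basept v n) = basept v m.
Proof.
rewrite /basept -s_map_comp; congr (mor_fun (s_map _ _) _).
by apply: deltaP => i; rewrite !ord1.
Qed.

Lemma spherical_boundary (X : simplicial K) v n (x : cc_el (X n)) m
    (f : Delta m n) :
  spherical v x -> in_boundary f -> s_map X f x = basept v m.
Proof.
case: n x f => [|n] x f vx [i fi]; first by case: (misses0 fi).
by rewrite (misses_factor fi) s_map_comp vx ?s_basept.
Qed.

Lemma homotopic_refl (X : simplicial K) v n (x : cc_el (X n)) :
  spherical v x -> homotopic v x x.
Proof.
move=> vx; pose c : 'I_n.+2 := inord n; have cE : c = n :> nat by rewrite inordK.
exists (s_map X (codeg c) x) => i; rewrite -s_map_comp.
have idc : (i == n.+1 :> nat) || (i == n :> nat) ->
    s_map X (delta_comp (codeg c) (coface i)) x = x.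
  move=> i_big; rewrite -[RHS]s_map_id; congr (mor_fun (s_map _ _) _).
  apply: deltaP => j; rewrite delta_compE delta_idE codegE cofaceE /= cE.
  by have := ltn_ord j; move: i_big; rewrite /bump /unbump; lia.
case: ifP idc => [_ -> //|ni1]; case: ifP => [_ -> //|ni _].
have lt_in : (i < n)%N by have := ltn_ord i; lia.
apply: spherical_boundary => //; exists (Ordinal (leqW lt_in)) => j.
by rewrite delta_compE ord_eqE codegE cofaceE /= cE /unbump /bump; lia.
Qed.

Lemma simplex_lifting_kan (X Y : simplicial K) (q : smap X Y) :
  simplex_lifting q -> kan_fibration q.
Proof.
move=> qL n k x y xP; have [|m f /xP[] //|z [qz zP]] := qL _ (in_horn k) x y.
  move=> l m f g fk; have [xg _] := xP _ _ fk; split=> //.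
  by case: fk => i ik fi; exists i => //; exact: misses_comp.
by exists z; split.
Qed.

(** Injectivity on homotopy lifts a homotopy downstairs along its boundary, which
    consists of the two given simplices and base points; surjectivity lifts a
    sphere along a constant boundary. *)
Lemma simplex_lifting_weq (X Y : simplicial K) (q : smap X Y) :
  simplex_lifting q -> weak_equivalence q.
Proof.
move=> qL v n; split=> [x x' vx vx' [w wP]|y vy].
- pose c : 'I_n.+2 := inord n; have cE : c = n :> nat by rewrite inordK.
  have c_max : delta_comp (codeg c) (coface ord_max) = delta_id n.
    apply: deltaP => j; rewrite delta_compE delta_idE codegE cofaceE /= cE.
    by have := ltn_ord j; rewrite /bump /unbump; lia.
  have codeg_misses m (f : Delta m n.+1) i : (i < n)%N -> misses f (inord i) ->
      in_boundary (delta_comp (codeg c) f).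
    move=> lt_in fi; exists (inord i) => j.
    rewrite delta_compE ord_eqE codegE /= cE inordK; last exact: leqW.
    have := fi j; rewrite ord_eqE /= inordK; last by rewrite ltnS ltnW ?leqW.
    by have := ltn_ord (sval f j); rewrite /unbump; lia.
  have codeg_misses2 m (f : Delta m n.+1) : misses f ord_max -> misses f c ->
      in_boundary (delta_comp (codeg c) f).
    move=> fM fc; exists ord_max => j.
    rewrite delta_compE ord_eqE codegE /= cE.
    have := fM j; have := fc j; rewrite !ord_eqE /= cE.
       by have := ltn_ord (sval f j); rewrite /unbump; lia.
  have factor_max m (f : Delta m n.+1) : misses f ord_max ->
      f = delta_comp (coface ord_max) (delta_comp (codeg c) f).
    move=> fM; apply: deltaP => j; rewrite !delta_compE cofaceE /= codegE cE.
    have := fM j; rewrite ord_eqE /=.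
    by have := ltn_ord (sval f j); rewrite /unbump /bump; lia.
  have low m (f : Delta m n.+1) : in_boundary f -> ~ misses f ord_max ->
      ~ misses f c -> exists2 i : 'I_n.+2, (i < n)%N & misses f i.
    move=> [i fi] fM fc; exists i => //.
    have := ltn_ord i; rewrite ltnS leq_eqVlt => /orP[/eqP iM|].
      by case: fM; rewrite (_ : ord_max = i) //; apply: val_inj.
    rewrite ltnS leq_eqVlt => /orP[/eqP ic|//].
    by case: fc; rewrite (_ : c = i) //; apply: val_inj; rewrite /= cE.
  (* [codeg c] is a left inverse of both of the last two cofaces, so the
     restriction of the desired boundary to either face is a pullback along
     it. *)
  pose z m (f : Delta m n.+1) : cc_el (X m) :=
    if `[< misses f ord_max >] then s_map X (delta_comp (codeg c) f) x'
    else if `[< misses f c >] then s_map X (delta_comp (codeg c) f) x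
    else basept v m.
  have zlow m (f : Delta m n.+1) i : (i < n)%N -> misses f (inord i) ->
      z m f = basept v m.
    move=> lt_in fi; have ds := codeg_misses _ _ _ lt_in fi.
    rewrite /z; case: asboolP => [?|?]; first exact: spherical_boundary.
    by case: asboolP => [?|?] //; exact: spherical_boundary.
  have zmax m (f : Delta m n.+1) : misses f ord_max ->
      z m f = s_map X (delta_comp (codeg c) f) x'.
    by rewrite /z; case: asboolP.
  have zc m (f : Delta m n.+1) : misses f c ->
      z m f = s_map X (delta_comp (codeg c) f) x.
    move=> fc; rewrite /z; case: asboolP => [fM|?]; last by case: asboolP.
    have ds := codeg_misses2 _ _ fM fc.
    by rewrite (spherical_boundary vx' ds) (spherical_boundary vx ds).
  have [|m f|u [qu uP]] := qL n.+1 (fun m f => @in_boundary m n.+1 f) z w.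
  + move=> l m f g fd; split.
      by have [i fi] := fd; exists i; exact: misses_comp.
    have [fM|fM] := pselect (misses f ord_max).
      rewrite !zmax //; last exact: misses_comp.
      by rewrite delta_compA s_map_comp.
    have [fc|fc] := pselect (misses f c).
      rewrite !zc //; last exact: misses_comp.
      by rewrite delta_compA s_map_comp.
    have [i lt_in fi] := low _ _ fd fM fc.
    rewrite -[i]inord_val in fi; rewrite !(zlow _ _ _ lt_in) ?s_basept //.
    exact: misses_comp.
  + move=> fd; have [fM|fM] := pselect (misses f ord_max).
      rewrite zmax // {2}(factor_max _ _ fM) !s_map_comp wP eqxx.
      by rewrite !smap_nat.
    have [fc|fc] := pselect (misses f c).
      rewrite zc // {2}(misses_factor fc) !s_map_comp wP cE eqxx.
      by rewrite ltn_eqF // !smap_nat.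
    have [i lt_in fi] := low _ _ fd fM fc.
    rewrite {2}(misses_factor fi) s_map_comp wP !ltn_eqF ?leqW //.
    rewrite -[i]inord_val in fi; rewrite (zlow _ _ _ lt_in) // s_basept.
    by rewrite /basept smap_nat.
  exists u => i; rewrite uP; last by exists i; exact: coface_misses.
  case: ifP => [/eqP iM|iM].
    rewrite (_ : i = ord_max); last exact: val_inj.
    rewrite zmax; last exact: coface_misses.
    by rewrite c_max s_map_id.
  case: ifP => [/eqP ic|ic].
    rewrite (_ : i = c); last by apply: val_inj; rewrite /= cE.
    rewrite zc; last exact: coface_misses.
    by rewrite codegK s_map_id.
  rewrite (zlow _ _ i) //; first by have := ltn_ord i; lia.
  by rewrite inord_val; exact: coface_misses.
- have [|m f fd|z [qz zP]] :=
      qL n (fun m f => @in_boundary m n f) (fun m _ => basept v m) y.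
  + move=> l m f g [i fi]; split; first by exists i; exact: misses_comp.
    by rewrite s_basept.
  + by rewrite (spherical_boundary vy fd) /basept smap_nat.
  have vz : spherical v z.
    move=> m f lt_mn; apply: zP; apply: contrapT => /surjective_section[g fg].
    have : injective (val g).
      move=> i j /(congr1 (val f)); rewrite -!delta_compE fg !delta_idE.
      by [].
    by move=> /leq_card; rewrite !card_ord ltnS leqNgt lt_mn.
  exists z => //; rewrite qz; exact: homotopic_refl.
Qed.

End Extension.

(** * Weak equivalences onto constant simplicial Lie algebras *)

Section LieMorphisms.
Variables (F : fieldType) (A B : lieType F) (f : mor (A : LieCat F) (B : LieCat F)).

Lemma lmorP c (x y : A) : f (c *: x + y) = c *: (f x : B) + (f y : B).
Proof. by have [f_lin _] := mor_hom f; exact: f_lin. Qed.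
Lemma lmor_bracket (x y : A) : f (bracket x y) = bracket (f x : B) (f y).
Proof. by have [_ f_br] := mor_hom f; exact: f_br. Qed.
Lemma lmorD (x y : A) : f (x + y) = (f x : B) + (f y : B).
Proof. by have := lmorP 1 x y; rewrite !scale1r. Qed.
Lemma lmor0 : f (0 : A) = 0 :> B.
Proof. by apply: (@addrI _ (f (0 : A) : B)); rewrite -lmorD !addr0. Qed.
Lemma lmorB (x y : A) : f (x - y) = (f x : B) - (f y : B).
Proof. by rewrite addrC -scaleN1r lmorP scaleN1r addrC. Qed.
End LieMorphisms.

Section ConstantTarget.
Variables (F : fieldType) (X : lieType F) (Y : simplicial (LieCat F)).
Variable a : smap Y (sconst (X : LieCat F)).
Hypothesis a_weq : weak_equivalence a.
Local Notation Yl n := (s_obj Y n : lieType F).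

Lemma const_aug_s m n (f : Delta m n) (x : Yl n) : a m (s_map Y f x) = a n x.
Proof. exact: smap_nat. Qed.

Lemma const_aug_surj n (x : X) : exists y : Yl n, a n y = x.
Proof.
have [_ /(_ x)[//|y _ [w wP]]] := a_weq (0 : Yl 0) 0.
exists (s_map Y (delta_pt n) y); rewrite const_aug_s.
by have := wP ord0; have := wP ord_max; rewrite /= => <- <-.
Qed.

Lemma basept0 n : basept (X := Y) (0 : Yl 0) n = (0 : Yl n).
Proof. exact: lmor0. Qed.

(** Vanishing of the homotopy groups of the kernel of [a]. Together with
    surjectivity, this is all that the weak equivalence provides. *)
Lemma bounding_simplex n (u : Yl n) :
  (forall m (f : Delta m n), in_boundary f -> s_map Y f u = (0 : Yl m)) ->
  a n u = (0 : X) ->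
  exists w : Yl n.+1, forall i, s_map Y (coface i) w =
    if i == ord_max then u else (0 : Yl n).
Proof.
move=> u_sph au; have [inj _] := a_weq (0 : Yl 0) n.
have sph0 : spherical (X := Y) (0 : Yl 0) (0 : Yl n).
  by move=> m f _; rewrite basept0; exact: lmor0.
have sphu : spherical (X := Y) (0 : Yl 0) u.
  move=> m f lt_mn; rewrite basept0; apply: u_sph; apply: contrapT.
  move=> /surjective_section[g fg]; have : injective (val g).
    by move=> i j /(congr1 (val f)); rewrite -!delta_compE fg !delta_idE.
  by move=> /leq_card; rewrite !card_ord ltnS leqNgt lt_mn.
have [|w wP] := inj 0 u sph0 sphu.
  exists (0 : X) => i; rewrite au /basept /=.
  by rewrite !lmor0; case: ifP => // _; case: ifP.
exists w => i; rewrite wP basept0 ord_eqE /=.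
by case: ifP => // _; case: ifP.
Qed.

Lemma push_mono n (r : 'I_n.+2) (i j : 'I_n.+2) : (i <= j)%N ->
  ((inord (minn (if i == r then i.+1 else i) n.+1) : 'I_n.+2) <=
   (inord (minn (if j == r then j.+1 else j) n.+1) : 'I_n.+2))%N.
Proof.
move=> le_ij; rewrite !inordK ?ltnS ?geq_minr // !ord_eqE.
by case: eqP => ir; case: eqP => jr; lia.
Qed.
(** For [r <= n], the vertex [r] moves to [r + 1] and the others are fixed; the
    minimum keeps the formula within range for the last vertex. *)
Definition push n (r : 'I_n.+2) : Delta n.+1 n.+1 := delta_mk (@push_mono n r).

Lemma pushE n (r : 'I_n.+2) i :
  val (push r) i = minn (if i == r then i.+1 else i) n.+1 :> nat.
Proof. by rewrite delta_mkE inordK // ltnS geq_minr. Qed.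

Section Boundary.
Variables (n : nat) (P : forall m, Delta m n.+1 -> Prop).
Variable x : forall m, Delta m n.+1 -> Yl m.
Hypothesis x_comp : compatible (X := Y) P x.
Hypothesis x_aug : forall m (f : Delta m n.+1), P f -> a m (x f) = (0 : X).
Hypothesis P_face : forall m (f : Delta m n.+1), in_boundary f -> P f.

(** Moore's argument for horns. If [z] restricts correctly to the faces
    opposite to the vertices below [r], then so does
    [z + x_push - push^* z], which is moreover correct on the face opposite to
    [r], as [push r] is the identity on it. *)
Lemma fill_horn (r : nat) : (r <= n.+1)%N -> exists z : Yl n.+1,
  forall m (f : Delta m n.+1) (i : 'I_n.+2),
    (i < r)%N -> misses f i -> s_map Y f z = x f.
Proof.
elim: r => [|r IHr] lt_rn; first by exists 0.
have [z zP] := IHr (ltnW lt_rn).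
pose ro : 'I_n.+2 := inord r; have roE : ro = r :> nat by rewrite inordK // ltnS ltnW.
have pP : P (push ro).
  apply: P_face; exists ro => j; rewrite ord_eqE pushE ord_eqE roE.
  move: (ltn_ord j); move: (nat_of_ord j) => k lt_k.
  by case: ifP => jr; lia.
exists (z + (x (push ro) - s_map Y (push ro) z)) => m f i lt_ir fi.
rewrite lmorD lmorB.
have [_ /= <-] := x_comp f pP; rewrite -s_map_comp.
have [ir|ir] := eqVneq (i : nat) r.
  have -> : delta_comp (push ro) f = f.
    apply: deltaP => j; rewrite delta_compE pushE ord_eqE roE.
    have := fi j; rewrite ord_eqE ir => /negPf->.
    by apply/minn_idPl; rewrite -ltnS.
  by rewrite addrC subrK.
have lt_ir' : (i < r)%N by lia.
rewrite (zP _ _ i) // (zP _ (delta_comp (push ro) f) i) ?subrr ?addr0 //.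
move=> j; rewrite delta_compE ord_eqE pushE ord_eqE roE.
have := fi j; rewrite ord_eqE; have := ltn_ord i; have := ltn_ord (sval f j) => /=.
by case: ifP => fj; lia.
Qed.

(** Once a horn is filled, the error on the remaining face has zero boundary,
    and is corrected by a simplex that it bounds. *)
Lemma fill_boundary : exists z : Yl n.+1,
  forall m (f : Delta m n.+1), in_boundary f -> s_map Y f z = x f.
Proof.
have [z zP] := fill_horn (leqnn n.+1).
have az : a n.+1 z = (0 : X).
  have c0 : misses (coface (ord0 : 'I_n.+2)) ord0 by exact: coface_misses.
  rewrite -(const_aug_s (coface (ord0 : 'I_n.+2)) z) (zP _ _ ord0) // x_aug //.
  by apply: P_face; exists ord0.
have PM : P (coface (ord_max : 'I_n.+2)).
  by apply: P_face; exists ord_max; exact: coface_misses.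
pose u : Yl n := x (coface ord_max) - s_map Y (coface ord_max) z.
have [m f [i fi]||w wP] := @bounding_simplex n u.
- rewrite lmorB; have [_ /= <-] := x_comp f PM; rewrite -s_map_comp.
  rewrite (zP _ _ (widen_ord (leqnSn _) i)) ?subrr //= => j.
  rewrite delta_compE cofaceE ord_eqE /=.
  have := fi j; rewrite ord_eqE /bump.
  by have := ltn_ord (sval f j); rewrite /=; lia.
- by rewrite lmorB x_aug // const_aug_s az subr0.
exists (z + w) => m f [i fi].
have [lt_in|ge_in] := ltnP i n.+1.
  rewrite lmorD (zP _ _ i) // {2}(misses_factor fi) s_map_comp wP.
  by rewrite ifN ?lmor0 ?addr0 // ord_eqE /= ltn_eqF.
have iM : i = ord_max by apply: val_inj => /=; have := ltn_ord i; lia.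
rewrite lmorD {2}(misses_factor fi) s_map_comp wP iM eqxx lmorB.
have [_ /= <-] := x_comp (delta_comp (codeg ord_max) f) PM.
by rewrite -s_map_comp -iM -misses_factor // addrC subrK.
Qed.
End Boundary.

(** Faces are filled one at a time, by induction on the dimension, until the
    whole boundary is reached. *)
Lemma fill_subcomplex n (P : forall m, Delta m n -> Prop)
    (x : forall m, Delta m n -> Yl m) :
  compatible (X := Y) P x ->
  (forall m (f : Delta m n), P m f -> a m (x m f) = (0 : X)) ->
  exists z : Yl n, a n z = (0 : X) /\
    forall m f, P m f -> s_map Y f z = x m f.
Proof.
(* The condition on the augmentation comes for free: it can be read off on
   any simplex of the subcomplex. *)
have aug0 k (Q : forall m, Delta m k -> Prop) (y : forall m, Delta m k -> Yl m) :
    (forall m (f : Delta m k), Q m f -> a m (y m f) = (0 : X)) ->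
    (exists z : Yl k, forall m f, Q m f -> s_map Y f z = y m f) ->
    exists z : Yl k, a k z = (0 : X) /\ forall m f, Q m f -> s_map Y f z = y m f.
  move=> ya [z zP].
  have [[m [f Qf]]|Qe] := pselect (exists m (f : Delta m k), Q m f).
    by exists z; split; rewrite // -(const_aug_s f z) zP // ya.
  exists 0; split=> [|m f Qf]; first exact: lmor0.
  by case: Qe; exists m, f.
move=> xP xa; apply: (aug0) => //; move: xP xa; elim: n P x => [|n IHn] P x xP xa.
  have [Pid|nPid] := pselect (P _ (delta_id 0)).
    exists (x _ (delta_id 0)) => m f _; have [_ /= <-] := xP _ _ _ f Pid.
    by rewrite delta_1comp.
  exists 0 => m f Pf; have [|g fg] := @surjective_section m 0 f.
    by case=> i; exact: misses0.
  by case: nPid; rewrite -fg; have [] := xP _ _ f g Pf.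
have [Pid|nPid] := pselect (P _ (delta_id n.+1)).
  exists (x _ (delta_id n.+1)) => m f _; have [_ /= <-] := xP _ _ _ f Pid.
  by rewrite delta_1comp.
have grow r : (r <= n.+2)%N -> exists (Q : forall m, Delta m n.+1 -> Prop)
    (y : forall m, Delta m n.+1 -> Yl m),
  [/\ compatible (X := Y) Q y,
      forall m f, Q m f -> a m (y m f) = (0 : X),
      forall m f, P m f -> Q m f /\ y m f = x m f
    & forall m (f : Delta m n.+1) (i : 'I_n.+2),
        (i < r)%N -> misses f i -> Q m f].
  elim: r => [|r IHr] lt_rn; first by exists P, x; split.
  have [Q [y [yQ ya PQ Qr]]] := IHr (ltnW lt_rn).
  pose ro : 'I_n.+2 := Ordinal lt_rn.
  pose Qr' m (f : Delta m n) := Q m (delta_comp (coface ro) f).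
  pose y' m (f : Delta m n) : Yl m := y m (delta_comp (coface ro) f).
  have ya' m f : Qr' m f -> a m (y' m f) = (0 : X) by exact: ya.
  have [|z [az zP]] := aug0 n Qr' y' ya'.
    by apply: IHn => // l m f g Qf; rewrite /Qr' /y' delta_compA; exact: yQ.
  have face m (f : Delta m n.+1) : misses f ro -> Q m f ->
      y m f = s_map Y (delta_comp (codeg ro) f) z.
    by move=> fr Qf; rewrite zP /y' /Qr' -?misses_factor.
  pose y2 m (f : Delta m n.+1) : Yl m :=
    if `[< Q m f >] then y m f else s_map Y (delta_comp (codeg ro) f) z.
  have y2Q m f : Q m f -> y2 m f = y m f by rewrite /y2; case: asboolP.
  have y2r m f : misses f ro -> y2 m f = s_map Y (delta_comp (codeg ro) f) z.
    by move=> fr; rewrite /y2; case: asboolP => // Qf; rewrite face.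
  exists (fun m f => Q m f \/ misses f ro), y2; split.
  - move=> l m f g [Qf|fr].
      by have [Qfg e] := yQ _ _ _ g Qf; split; [left|rewrite !y2Q].
    have fgr := misses_comp g fr; split; first by right.
    by rewrite !y2r // delta_compA s_map_comp.
  - move=> m f [Qf|fr]; first by rewrite y2Q // ya.
    by rewrite y2r // const_aug_s.
  - by move=> m f /PQ[Qf yf]; split; [left|rewrite y2Q].
  - move=> m f i; rewrite ltnS leq_eqVlt => /orP[/eqP ir|lt_ir] fi.
      by right; rewrite (_ : ro = i) //; apply: val_inj.
    by left; exact: Qr fi.
have [Q [y [yQ ya PQ Qall]]] := grow _ (leqnn n.+2).
have Qd m (f : Delta m n.+1) : in_boundary f -> Q m f.
  by move=> [i fi]; exact: Qall fi.
have [z zP] := fill_boundary yQ ya Qd.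
exists z => m f Pf; have [_ <-] := PQ _ _ Pf; apply: zP; apply: contrapT.
move=> /surjective_section[g fg]; apply: nPid; rewrite -fg.
by have [] := xP _ _ _ g Pf.
Qed.

(** Subtracting a preimage of [y] moves the problem to the kernel of [a]. *)
Lemma weq_const_lifting : simplex_lifting a.
Proof.
move=> n P x y xP xy; have [y0 ay0] := const_aug_surj n y.
have [|m f Pf|z [az zP]] :=
    @fill_subcomplex n P (fun m f => (x m f : Yl m) - s_map Y f y0).
- move=> l m f g Pf; have [Pfg xfg] := xP _ _ _ g Pf; split=> //.
  by rewrite lmorB xfg s_map_comp.
- rewrite lmorB const_aug_s ay0 xy //; exact: subrr.
exists ((z : Yl n) + y0); split; first by rewrite lmorD az add0r.
by move=> m f Pf; rewrite lmorD zP // subrK.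
Qed.

End ConstantTarget.

(** * Path objects *)

(** A Lie subalgebra of a product, as a predicate on families. Both the fibre
    product [pairs] and the mapping object [paths] below have this form. *)
Record lie_subfamily (F : fieldType) (J : Type) (Y : J -> lieType F) :=
  LieSubfamily {
    lsf_pred :> (forall j, Y j) -> Prop;
    lsf0 : lsf_pred (fun j => 0);
    lsf_lin : forall c u v, lsf_pred u -> lsf_pred v ->
      lsf_pred (fun j => c *: u j + v j);
    lsf_bracket : forall u v, lsf_pred u -> lsf_pred v ->
      lsf_pred (fun j => bracket (u j) (v j))
  }.

Section Subproduct.
Variables (F : fieldType) (J : Type) (Y : J -> lieType F) (S : lie_subfamily Y).

Record subproduct := Subproduct {
  sp_val :> forall j, Y j;
  sp_valP : S sp_val
}.

Lemma subproductP (u v : subproduct) : (forall j, u j = v j) -> u = v.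
Proof.
case: u v => [u uS] [v vS] /= uv.
have e : u = v by exact: functional_extensionality_dep.
by rewrite e in uS *; congr Subproduct; exact: Prop_irrelevance.
Qed.

HB.instance Definition _ := gen_eqMixin subproduct.
HB.instance Definition _ := gen_choiceMixin subproduct.

Lemma sp_scale_subproof c (u : subproduct) : S (fun j => c *: u j).
Proof.
rewrite (_ : (fun j => _) = fun j => c *: u j + 0).
  by apply: lsf_lin; [exact: sp_valP|exact: lsf0].
by apply: functional_extensionality_dep => j; rewrite addr0.
Qed.
Lemma sp_add_subproof (u v : subproduct) : S (fun j => u j + v j).
Proof.
rewrite (_ : (fun j => _) = fun j => 1 *: u j + v j).
  by apply: lsf_lin; exact: sp_valP.
by apply: functional_extensionality_dep => j; rewrite scale1r.
Qed.
Lemma sp_opp_subproof (u : subproduct) : S (fun j => - u j).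
Proof.
rewrite (_ : (fun j => _) = fun j => (-1) *: u j); first exact: sp_scale_subproof.
by apply: functional_extensionality_dep => j; rewrite scaleN1r.
Qed.

Definition sp_zero := Subproduct (lsf0 S).
Definition sp_scale c u := Subproduct (sp_scale_subproof c u).
Definition sp_add u v := Subproduct (sp_add_subproof u v).
Definition sp_opp u := Subproduct (sp_opp_subproof u).
Definition sp_bracket (u v : subproduct) :=
  Subproduct (lsf_bracket (sp_valP u) (sp_valP v)).

Lemma sp_addA : associative sp_add.
Proof. by move=> u v w; apply: subproductP => j /=; rewrite addrA. Qed.
Lemma sp_addC : commutative sp_add.
Proof. by move=> u v; apply: subproductP => j /=; rewrite addrC. Qed.
Lemma sp_add0 : left_id sp_zero sp_add.
Proof. by move=> u; apply: subproductP => j /=; rewrite add0r. Qed.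
Lemma sp_addN : left_inverse sp_zero sp_opp sp_add.
Proof. by move=> u; apply: subproductP => j /=; rewrite addNr. Qed.
HB.instance Definition _ := GRing.isZmodule.Build subproduct
  sp_addA sp_addC sp_add0 sp_addN.

Lemma sp_scaleA a b v : sp_scale a (sp_scale b v) = sp_scale (a * b) v.
Proof. by apply: subproductP => j /=; rewrite scalerA. Qed.
Lemma sp_scale1 : left_id 1 sp_scale.
Proof. by move=> u; apply: subproductP => j /=; rewrite scale1r. Qed.
Lemma sp_scaleDr : right_distributive sp_scale +%R.
Proof. by move=> a u v; apply: subproductP => j /=; rewrite scalerDr. Qed.
Lemma sp_scaleDl v : {morph sp_scale^~ v : a b / a + b}.
Proof. by move=> a b; apply: subproductP => j /=; rewrite scalerDl. Qed.
HB.instance Definition _ := GRing.Zmodule_isLmodule.Build F subproduct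
  sp_scaleA sp_scale1 sp_scaleDr sp_scaleDl.

Lemma sp_bracket_linearl v : linear (sp_bracket^~ v).
Proof. by move=> a u w; apply: subproductP => j; exact: bracket_linearl. Qed.
Lemma sp_bracket_linearr u : linear (sp_bracket u).
Proof. by move=> a v w; apply: subproductP => j; exact: bracket_linearr. Qed.
Lemma sp_bracketxx u : sp_bracket u u = 0.
Proof. by apply: subproductP => j; exact: bracketxx. Qed.
Lemma sp_jacobi u v w :
  sp_bracket u (sp_bracket v w) + sp_bracket v (sp_bracket w u)
    + sp_bracket w (sp_bracket u v) = 0.
Proof. by apply: subproductP => j; exact: jacobi. Qed.
HB.instance Definition _ := isLie.Build F subproduct
  sp_bracket_linearl sp_bracket_linearr sp_bracketxx sp_jacobi.

End Subproduct.

Lemma delta_const_mono m n (i : 'I_n.+1) (j k : 'I_m.+1) :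
  (j <= k)%N -> (i <= i)%N.
Proof. by []. Qed.
Definition delta_const m n (i : 'I_n.+1) : Delta m n :=
  delta_mk (@delta_const_mono m n i).
Lemma delta_constE m n (i : 'I_n.+1) j : val (@delta_const m n i) j = i.
Proof. exact: delta_mkE. Qed.

(** The lexicographic order on the vertices embeds the prism
    [Delta[n] x Delta[1]] into a simplex, [(i, e)] going to [2 i + e]. The half
    of a monotone map is monotone, so a simplex of the latter belongs to the
    prism as soon as the parity of its vertices increases. *)
Section Lexicographic.
Variable n : nat.
Local Notation N := (n.*2.+1).

Lemma lex_subproof (i : 'I_n.+1) (e : 'I_2) : (i.*2 + e < N.+1)%N.
Proof. by have := ltn_ord i; have := ltn_ord e; lia. Qed.
Lemma lex_mono m (g : Delta m n) (h : Delta m 1) (i j : 'I_m.+1) : (i <= j)%N ->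
  (Ordinal (lex_subproof (val g i) (val h i)) <=
   Ordinal (lex_subproof (val g j) (val h j)))%N.
Proof.
by move=> le_ij /=; apply: leq_add; rewrite ?leq_double; exact: delta_mono.
Qed.
Definition lex m (g : Delta m n) (h : Delta m 1) : Delta m N :=
  delta_mk (@lex_mono m g h).
Lemma lexE m (g : Delta m n) (h : Delta m 1) i :
  val (lex g h) i = ((val g i).*2 + val h i)%N :> nat.
Proof. by rewrite delta_mkE. Qed.

Lemma lex_comp l m (g : Delta m n) (h : Delta m 1) (f : Delta l m) :
  delta_comp (lex g h) f = lex (delta_comp g f) (delta_comp h f).
Proof. by apply: deltaP => i; rewrite delta_compE !lexE !delta_compE. Qed.

Lemma lex_half_mono m (f : Delta m N) (i j : 'I_m.+1) : (i <= j)%N ->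
  ((inord (val f i)./2 : 'I_n.+1) <= (inord (val f j)./2 : 'I_n.+1))%N.
Proof.
move=> le_ij; rewrite !inordK ?half_leq ?delta_mono //.
  by have := ltn_ord (val f j); lia.
by have := ltn_ord (val f i); lia.
Qed.
Definition lex_fst m (f : Delta m N) : Delta m n := delta_mk (@lex_half_mono m f).

Definition prismal m (f : Delta m N) : Prop :=
  forall i j : 'I_m.+1, (i <= j)%N -> (odd (val f i) <= odd (val f j))%N.

(** Off the prism the parity is not monotone, hence the default value. *)
Definition lex_snd_fun m (f : Delta m N) (i : 'I_m.+1) : 'I_2 :=
  if `[< prismal f >] then inord (odd (val f i)) else ord0.
Lemma lex_snd_mono m (f : Delta m N) (i j : 'I_m.+1) : (i <= j)%N ->
  (lex_snd_fun f i <= lex_snd_fun f j)%N.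
Proof.
rewrite /lex_snd_fun; case: asboolP => // fP le_ij.
by rewrite !inordK ?fP //; case: odd.
Qed.
Definition lex_snd m (f : Delta m N) : Delta m 1 := delta_mk (@lex_snd_mono m f).

Lemma lex_prismal m (g : Delta m n) (h : Delta m 1) : prismal (lex g h).
Proof.
move=> i j le_ij; have := delta_mono h le_ij; rewrite !lexE !oddD !odd_double /=.
have := ltn_ord (sval h i); have := ltn_ord (sval h j) => /=.
by case: (nat_of_ord (sval h i)) => [|[]] //; case: (nat_of_ord (sval h j)) => [|[]].
Qed.

Lemma lexK m (f : Delta m N) : prismal f -> lex (lex_fst f) (lex_snd f) = f.
Proof.
move=> fP; apply: deltaP => i; rewrite lexE !delta_mkE /lex_snd_fun.
case: asboolP => // _; rewrite !inordK; last first.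
- by have := ltn_ord (val f i); lia.
- by case: odd.
by rewrite addnC odd_double_half.
Qed.

Lemma lex_fstK m (g : Delta m n) (h : Delta m 1) : lex_fst (lex g h) = g.
Proof.
apply: deltaP => i; rewrite delta_mkE lexE.
have lt_h := ltn_ord (sval h i); have lt_g := ltn_ord (sval g i).
rewrite (_ : ((val g i).*2 + val h i)./2 = val g i) ?inordK //.
by move: (nat_of_ord (sval h i)) lt_h => b lt_b /=; lia.
Qed.

Lemma lex_inj m (g g' : Delta m n) (h h' : Delta m 1) :
  lex g h = lex g' h' -> g = g' /\ h = h'.
Proof.
move=> e; have gg : g = g' by rewrite -(lex_fstK g h) e lex_fstK.
split=> //; apply: deltaP => i.
have := congr1 (fun f : Delta _ _ => nat_of_ord (val f i)) e.
by rewrite !lexE gg => /addnI.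
Qed.
Lemma lex_sndK m (g : Delta m n) (h : Delta m 1) : lex_snd (lex g h) = h.
Proof. by have [] := lex_inj (lexK (lex_prismal g h)). Qed.

End Lexicographic.

Section PathObject.
Variables (F : fieldType) (X : lieType F) (Y : simplicial (LieCat F)).
Variable a : smap Y (sconst (X : LieCat F)).
Local Notation Yl n := (s_obj Y n : lieType F).

Definition over_pair n (u : bool -> Yl n) : Prop :=
  a n (u true) = a n (u false) :> X.
Lemma over_pair0 n : over_pair (fun _ => 0 : Yl n).
Proof. by []. Qed.
Lemma over_pair_lin n c (u v : bool -> Yl n) : over_pair u -> over_pair v ->
  over_pair (fun b => c *: u b + v b).
Proof. by rewrite /over_pair !lmorP => -> ->. Qed.
Lemma over_pair_bracket n (u v : bool -> Yl n) : over_pair u -> over_pair v ->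
  over_pair (fun b => bracket (u b) (v b)).
Proof. by rewrite /over_pair !lmor_bracket => -> ->. Qed.
Definition pair_family n : lie_subfamily (fun _ : bool => Yl n) :=
  LieSubfamily (@over_pair0 n) (@over_pair_lin n) (@over_pair_bracket n).

Lemma pair_map_subproof m n (f : Delta m n) (u : subproduct (pair_family n)) :
  over_pair (fun b => s_map Y f (u b) : Yl m).
Proof. by rewrite /over_pair !const_aug_s; exact: (sp_valP u). Qed.
Definition pair_map m n (f : Delta m n) (u : subproduct (pair_family n)) :
  subproduct (pair_family m) :=
  @Subproduct _ _ _ (pair_family m) _ (pair_map_subproof f u).
Lemma pair_map_hom m n (f : Delta m n) : lie_hom (pair_map f).
Proof.
by split=> [c u v|u v]; apply: subproductP => b /=; rewrite (lmorP, lmor_bracket).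
Qed.

Lemma pair_map_id n u : @Mor (LieCat F) _ _ _ (pair_map_hom (delta_id n)) u = u.
Proof. by apply: subproductP => b /=; exact: (@s_map_id _ Y). Qed.
Lemma pair_map_comp l m n (f : Delta m n) (g : Delta l m) u :
  @Mor (LieCat F) _ _ _ (pair_map_hom (delta_comp f g)) u =
  @Mor (LieCat F) _ _ _ (pair_map_hom g) (@Mor (LieCat F) _ _ _ (pair_map_hom f) u).
Proof. by apply: subproductP => b /=; exact: (@s_map_comp _ Y). Qed.

(** The fibre product of [Y] with itself over [X]. *)
Definition pairs : simplicial (LieCat F) :=
  @Simplicial (LieCat F) (fun n => subproduct (pair_family n))
    (fun m n f => @Mor (LieCat F) _ _ _ (pair_map_hom f))
    pair_map_id pair_map_comp.

Definition prism n : Type := {m & (Delta m n * Delta m 1)%type}.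
Definition cell n m (g : Delta m n) (h : Delta m 1) : prism n :=
  existT (fun m => (Delta m n * Delta m 1)%type) m (g, h).

(** A simplicial map from the prism to [Y], given on simplices of all
    dimensions, whose image lies over a single point of [X]. *)
Definition prism_map n (u : forall j : prism n, Yl (projT1 j)) : Prop :=
  (forall l m (g : Delta m n) (h : Delta m 1) (f : Delta l m),
     u (cell (delta_comp g f) (delta_comp h f)) =
     s_map Y f (u (cell g h))) /\
  (forall j k : prism n, a _ (u j) = a _ (u k) :> X).
Lemma prism_map0 n : prism_map (n := n) (fun j => 0).
Proof. by split=> [l m g h f|j k]; rewrite !lmor0. Qed.
Lemma prism_map_lin n c (u v : forall j : prism n, Yl (projT1 j)) :
  prism_map u -> prism_map v -> prism_map (fun j => c *: u j + v j).
Proof.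
move=> [us ua] [vs va]; split=> [l m g h f|j k].
  by rewrite us vs lmorP.
by rewrite !lmorP (ua j k) (va j k).
Qed.
Lemma prism_map_bracket n (u v : forall j : prism n, Yl (projT1 j)) :
  prism_map u -> prism_map v -> prism_map (fun j => bracket (u j) (v j)).
Proof.
move=> [us ua] [vs va]; split=> [l m g h f|j k].
  by rewrite us vs lmor_bracket.
by rewrite !lmor_bracket (ua j k) (va j k).
Qed.
Definition prism_family n : lie_subfamily (fun j : prism n => Yl (projT1 j)) :=
  LieSubfamily (@prism_map0 n) (@prism_map_lin n) (@prism_map_bracket n).

Definition prism_comp m n (f : Delta m n) (j : prism m) : prism n :=
  cell (delta_comp f (projT2 j).1) (projT2 j).2.

Lemma path_map_subproof m n (f : Delta m n) (u : subproduct (prism_family n)) :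
  prism_map (fun j => u (prism_comp f j)).
Proof.
have [us ua] := sp_valP u; split=> [l k g h e|j k]; last exact: ua.
by rewrite -us /prism_comp /= delta_compA.
Qed.
Definition path_map m n (f : Delta m n) (u : subproduct (prism_family n)) :
  subproduct (prism_family m) :=
  @Subproduct _ _ _ (prism_family m) _ (path_map_subproof f u).
Lemma path_map_hom m n (f : Delta m n) : lie_hom (path_map f).
Proof. by split=> [c u v|u v]; apply: subproductP => j. Qed.

Lemma path_map_id n u : @Mor (LieCat F) _ _ _ (path_map_hom (delta_id n)) u = u.
Proof.
apply: subproductP => -[m [g h]] /=.
by rewrite /prism_comp /= delta_1comp.
Qed.
Lemma path_map_comp l m n (f : Delta m n) (g : Delta l m) u :
  @Mor (LieCat F) _ _ _ (path_map_hom (delta_comp f g)) u =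
  @Mor (LieCat F) _ _ _ (path_map_hom g) (@Mor (LieCat F) _ _ _ (path_map_hom f) u).
Proof.
apply: subproductP => -[k [e h]] /=.
by rewrite /prism_comp /= delta_compA.
Qed.

(** The path object of [Y] over [X]. *)
Definition paths : simplicial (LieCat F) :=
  @Simplicial (LieCat F) (fun n => subproduct (prism_family n))
    (fun m n f => @Mor (LieCat F) _ _ _ (path_map_hom f))
    path_map_id path_map_comp.

Definition end_cell n (b : bool) : prism n :=
  cell (delta_id n) (delta_const n (if b then ord_max else ord0)).

Lemma ends_subproof n (u : paths n) :
  over_pair (fun b => (u : subproduct (prism_family n)) (end_cell n b)).
Proof. by have [_ ua] := sp_valP (u : subproduct (prism_family n)); exact: ua. Qed.
Definition ends_fun n (u : paths n) : pairs n :=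
  @Subproduct _ _ _ (pair_family n) _ (ends_subproof u).
Lemma ends_hom n : lie_hom (@ends_fun n : (paths n : lieType F) -> (pairs n : lieType F)).
Proof. by split=> [c u v|u v]; apply: subproductP => j. Qed.
Lemma ends_nat m n (f : Delta m n) (u : paths n) :
  @Mor (LieCat F) (paths m) (pairs m) _ (ends_hom m) (s_map paths f u) =
  s_map pairs f (@Mor (LieCat F) (paths n) (pairs n) _ (ends_hom n) u).
Proof.
apply: subproductP => b /=.
have [us _] := sp_valP (u : subproduct (prism_family n)); rewrite /end_cell -us.
rewrite /prism_comp /= delta_comp1 delta_1comp; congr (sp_val _ (cell _ _)).
by apply: deltaP => i; rewrite delta_compE !delta_constE.
Qed.
Definition ends : smap paths pairs :=
  @SMap (LieCat F) paths pairs
    (fun n => @Mor (LieCat F) (paths n) (pairs n) _ (ends_hom n)) ends_nat.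

Hypothesis a_lift : simplex_lifting a.

Section EndsLifting.
Variables (n : nat) (P : forall m, Delta m n -> Prop).
Variables (x : forall m, Delta m n -> paths m) (y : pairs n).
Hypothesis x_comp : compatible (X := paths) P x.
Hypothesis x_ends : forall m (f : Delta m n), P f -> ends m (x f) = s_map pairs f y.

Let bit (b : bool) : 'I_2 := if b then ord_max else ord0.
Let pth m (f : Delta m n) : subproduct (prism_family m) := x f.
Let yb : bool -> Yl n := sp_val (y : subproduct (pair_family n)).

(* The part of the prism over [P], together with the two ends. *)
Let Pt m (f : Delta m n.*2.+1) : Prop := prismal f /\
  (P (lex_fst f) \/ exists b, lex_snd f = delta_const m (bit b)).
Let xt m (f : Delta m n.*2.+1) : Yl m :=
  if `[< P (lex_fst f) >] then pth (lex_fst f) (cell (delta_id m) (lex_snd f))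
  else s_map Y (lex_fst f) (yb `[< lex_snd f = delta_const m ord_max >]).

Let pth_end m (g : Delta m n) b : P g ->
  pth g (cell (delta_id m) (delta_const m (bit b))) = s_map Y g (yb b).
Proof.
move=> Pg; have := x_ends Pg.
by move/(congr1 (fun u : subproduct (pair_family m) => u b)).
Qed.

Let xt_P m (g : Delta m n) h : P g ->
  xt (lex g h) = pth g (cell (delta_id m) h).
Proof. by rewrite /xt lex_fstK lex_sndK; case: asboolP. Qed.
Let xt_end m (g : Delta m n) b :
  xt (lex g (delta_const m (bit b))) = s_map Y g (yb b).
Proof.
have [Pg|nPg] := pselect (P g); first by rewrite xt_P // pth_end.
rewrite /xt lex_fstK lex_sndK; case: asboolP => // _.
congr (s_map Y g (yb _)); apply/asboolP/idP => [|-> //].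
move/(congr1 (fun f : Delta _ _ => nat_of_ord (val f ord0))).
by rewrite !delta_constE; case: b.
Qed.

Let aug_yb b b' : a n (yb b) = a n (yb b').
Proof.
have := sp_valP (y : subproduct (pair_family n)); rewrite /over_pair => e.
by case: b b' => [] [].
Qed.

Lemma ends_lifting_subproof :
  exists z, ends n z = y /\ forall m (f : Delta m n), P f -> s_map paths f z = x f.
Proof.
have [||z [az zP]] := a_lift (P := Pt) (x := xt) (y := a n (yb true)).
- move=> l m f e [fP]; rewrite -[f](lexK fP) lex_comp.
  rewrite lex_fstK lex_sndK; set g := lex_fst f; set h := lex_snd f => fT.
  rewrite /Pt !lex_fstK !lex_sndK; case: fT => [Pg|[b hb]].
    have [Pge xge] := x_comp e Pg; split.
      by split; [exact: lex_prismal|left].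
    rewrite !xt_P // /pth xge.
    have [us _] := sp_valP (pth g); rewrite -us /= /prism_comp /=.
    by rewrite delta_comp1 delta_1comp.
  have hbe : delta_comp h e = delta_const l (bit b).
    by apply: deltaP => i; rewrite hb delta_compE !delta_constE.
  split; first by split; [exact: lex_prismal|right; exists b].
  by rewrite hbe hb !xt_end s_map_comp.
- move=> m f [fP]; rewrite -[f](lexK fP) lex_fstK lex_sndK.
  move: (lex_fst f) (lex_snd f) => g h /= [Pg|[b ->]]; last first.
    by rewrite xt_end const_aug_s (aug_yb b true).
  have [_ ua] := sp_valP (pth g); rewrite xt_P //.
  rewrite (ua (cell (delta_id m) h) (end_cell m true) : a m _ = a m _).
  by rewrite [pth _ _](pth_end true Pg) const_aug_s.
have u_prism : prism_map
    (fun j : prism n => s_map Y (lex (projT2 j).1 (projT2 j).2) z : Yl _).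
  split=> [l m g h f|j k] /=; last by rewrite !const_aug_s.
  by rewrite -s_map_comp lex_comp.
pose u := @Subproduct _ _ _ (prism_family n) _ u_prism.
exists (u : paths n); split.
  apply: subproductP => b /=; rewrite zP; last first.
    split; first exact: lex_prismal.
    by right; exists b; rewrite lex_sndK.
  by rewrite xt_end s_map_id.
move=> m f Pf; apply: subproductP => -[l [g h]] /=.
have [Pfg xfg] := x_comp g Pf.
rewrite zP; last by split; [exact: lex_prismal|left; rewrite lex_fstK].
rewrite xt_P // /pth xfg /= /prism_comp /=.
by rewrite delta_comp1.
Qed.
End EndsLifting.

(** A lifting problem for [ends] over [Delta[n]] is an extension problem for [Y]
    over the prism, hence over the simplex that contains the prism. *)
Lemma ends_lifting : simplex_lifting ends.
Proof. exact: ends_lifting_subproof. Qed.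

End PathObject.

(** * The prism operator *)

(** In the alternating sum over the faces of the simplices of a prism, the inner
    faces [A i i] and [A i i.+1] telescope to the two ends of the prism; the
    other faces cancel the prism [G] over the boundary. *)
Lemma prism_sum (V : zmodType) n (A G : nat -> nat -> V) (B : nat -> V) :
  (forall i j, (j < i)%N -> (i <= n)%N -> A i j = G i.-1 j) ->
  (forall i, (i <= n)%N -> A i i = B i /\ A i i.+1 = B i.+1) ->
  (forall i j, (i.+1 < j)%N -> (j <= n.+1)%N -> A i j = G i j.-1) ->
  \sum_(0 <= i < n.+1) \sum_(0 <= j < n.+2) A i j *~ (-1) ^+ (i + j)
  + \sum_(0 <= j < n.+1) \sum_(0 <= i < n) G i j *~ (-1) ^+ (i + j)
  = B 0%N - B n.+1.
Proof.
move=> lo mid hi.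
have signS (x : V) k : x *~ (-1) ^+ k.+1 = - (x *~ (-1) ^+ k).
  by rewrite exprS mulN1r mulrNz.
have even (x : V) i : x *~ (-1) ^+ (i + i) = x.
  by rewrite addnn -mul2n exprM sqrrN !expr1n mulr1z.
have -> : \sum_(0 <= i < n.+1) \sum_(0 <= j < n.+2) A i j *~ (-1) ^+ (i + j) =
    \sum_(0 <= i < n.+1) (\sum_(0 <= j < i) G i.-1 j *~ (-1) ^+ (i + j)
      + ((B i - B i.+1)
      + \sum_(i.+1 <= j < n.+1) - (G i j *~ (-1) ^+ (i + j)))).
  apply: eq_big_nat => i /andP[_ lt_in].
  rewrite (@big_cat_nat _ _ _ i) //=; last by rewrite ltnW // ltnW.
  congr (_ + _).
    by apply: eq_big_nat => j /andP[_ lt_ji]; rewrite lo.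
  have [Ai Ai1] := mid i lt_in.
  rewrite big_ltn; last exact: ltnW.
  rewrite big_ltn // Ai Ai1 even addnS signS even addrA; congr (_ + _).
  rewrite big_add1 /=; apply: eq_big_nat => j /andP[lt_ij lt_jn].
  by rewrite hi // addnS signS.
have tel : \sum_(0 <= i < n.+1) (B i - B i.+1) = B 0%N - B n.+1.
  rewrite -[RHS]opprB -telescope_sumr // -sumrN.
  by apply: eq_bigr => i _; rewrite opprB.
rewrite 2!big_split /= tel addrCA -addrA -[RHS]addr0; congr (_ + _).
have -> : \sum_(0 <= i < n.+1) \sum_(0 <= j < i) G i.-1 j *~ (-1) ^+ (i + j) =
    \sum_(0 <= i < n) \sum_(0 <= j < i.+1) - (G i j *~ (-1) ^+ (i + j)).
  rewrite big_nat_recl // (@big_geq _ _ _ 0 0) // add0r; apply: eq_bigr => i _.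
  by apply: eq_bigr => j _; rewrite addSn signS.
rewrite (big_nat_recr n) //= (@big_geq _ _ _ n.+1 n.+1) // addr0.
rewrite -big_split exchange_big_nat -big_split /= big_nat big1 // => i /andP[_ lt_in].
rewrite -big_cat_nat //=; last exact: ltnW.
by rewrite -big_split /= big1 // => j _; rewrite addNr.
Qed.

Lemma sum_signs (V : zmodType) n m (x : nat -> nat -> V) :
  \sum_(0 <= i < n) (\sum_(0 <= j < m) x i j *~ (-1) ^+ j) *~ (-1) ^+ i =
  \sum_(0 <= i < n) \sum_(0 <= j < m) x i j *~ (-1) ^+ (i + j).
Proof.
apply: eq_bigr => i _; rewrite mulrz_suml.
by apply: eq_bigr => j _; rewrite -mulrzA exprD mulrC.
Qed.

Lemma cohomotopy_map_homotopic (A B : cosimplicial) (phi psi : csmap A B)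
    (T : forall k, A k.+1 -> B k) :
  (forall k, T k 0 = 0) ->
  (forall x, phi 0%N x - psi 0%N x = T 0%N (cobound x)) ->
  (forall k x, phi k.+1 x - psi k.+1 x = cobound (T k x) + T k.+1 (cobound x)) ->
  forall n (x : cohomotopy A n), cohomotopy_map phi n x = cohomotopy_map psi n x.
Proof.
move=> T0 h0 hS n x; rewrite -[x]reprK.
rewrite -[LHS]/(cohomotopy_fun phi (cohclass (repr x))).
rewrite -[RHS]/(cohomotopy_fun psi (cohclass (repr x))) !cohomotopy_funE.
apply/eqP; rewrite -Quotient.idealrBE; apply/asboolP => /=.
move: (repr x) => {x} z.
have : cobound (cocycle_val z) = 0 by case: z => z /= /eqP.
move: (cocycle_val z) => {z}; case: n => [|n] z z0 /=; first by rewrite h0 z0 T0.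
by exists (T n z); rewrite hS z0 T0 addr0.
Qed.

Lemma threshold_mono n i (j k : 'I_n.+1) : (j <= k)%N ->
  ((if (i <= j)%N then ord_max else ord0 : 'I_2) <=
   (if (i <= k)%N then ord_max else ord0 : 'I_2))%N.
Proof.
by move=> le_jk; case: (leqP i j) => // le_ij; rewrite (leq_trans le_ij le_jk).
Qed.
Definition threshold n i : Delta n 1 := delta_mk (@threshold_mono n i).
Lemma thresholdE n i j : val (threshold n i) j = (i <= j)%N :> nat.
Proof. by rewrite delta_mkE; case: leqP. Qed.

Section HomotopyInvariance.
Variables (p : nat) (F : fieldType) (pF : p \in [pchar F]).
Variables (H : rlieType p F) (U : uea H) (u : renv U) (R : skew_poly p F).
Variables (W : wring u R) (M : lmodType W).
Variables (L : lieType F) (UL : uea L) (g : L -> H).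
Variables (phi : {rmorphism UL -> W}).
Hypothesis phi_in : forall x, phi (uea_in UL x) = w_act W (g x).
Hypothesis phi_scal : forall c, phi c%:A = w_scal W c.
Local Notation E := (rlie_beck pF M).
Local Notation E' := (lie_beck (restr phi M)).

Lemma pull_restrict_subproof (A : lieType F) (B : rlieType p F)
    (a : mor (A : LieCat F) (L : LieCat F))
    (b : mor (B : RLieCat p F) (H : RLieCat p F))
    (k : A -> B) : lie_hom k -> (forall x, b (k x) = g (a x)) ->
  forall d : hom_over E b, (fun x => hom_over_val d (k x)) \in is_over E' a.
Proof.
move=> [k_lin k_br] k_over d.
have /asboolP[[d_lin d_br] _] := hom_overP d.
have [a_lin a_br] := mor_hom a.
apply/asboolP; split=> [c x y|x y]; congr pair.
- exact: a_lin.
- rewrite /= k_lin; have [_ ->] := d_lin c (k x) (k y).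
  congr (_ + _); rewrite -[RHS]/(phi c%:A *: (hom_over_val d (k x) : M)).
  by rewrite phi_scal.
- exact: a_br.
- rewrite /= k_br; have [_ ->] := d_br (k x) (k y).
  rewrite -[RHS]/(phi (uea_in UL (a x)) *: (hom_over_val d (k y) : M)
     - phi (uea_in UL (a y)) *: (hom_over_val d (k x) : M)).
  by rewrite !phi_in -!k_over.
Qed.

Variables (D : augmented (H : RLieCat p F)) (C : augmented (L : LieCat F)).
Local Notation Dl n := ((s_obj D n : rlieType p F) : lieType F).
Local Notation Cl n := (s_obj C n : lieType F).
Local Notation aD := (aug_map (forget_aug D)).
Variable h : smap C (paths aD).
Local Notation hv n c j := (sp_val (h n c : subproduct (prism_family aD n)) j).
Hypothesis h_over : forall n c b,
  aug_map D n (hv n c (end_cell n b)) = g (aug_map C n c).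

Let cods n i : Delta n.+1 n := codeg (inord i).
Let cofs n j : Delta n n.+1 := coface (inord j).

(* The value of a path at the i-th nondegenerate (n+1)-simplex of the prism. *)
Let step n i (c : Cl n) : Dl n.+1 :=
  hv n c (cell (cods n i) (threshold n.+1 i.+1)).

Let step_hom n i : lie_hom (@step n i).
Proof.
have [h_lin h_br] := mor_hom (h n).
split=> [x y z|x y]; rewrite /step.
  by rewrite h_lin.
by rewrite h_br.
Qed.
Let step_over n i c : aug_map D n.+1 (step i c) = g (aug_map C n c).
Proof.
rewrite -(h_over c true).
have [_ ha] := sp_valP (h n c : subproduct (prism_family aD n)).
exact: (ha (cell _ _) (end_cell n true)).
Qed.

(* The prism operator of the homotopy [h]. *)
Let T n (d : hom_cosimplicial E D n.+1) : hom_cosimplicial E' C n :=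
  \sum_(i < n.+1)
    (HomOver (pull_restrict_subproof (@step_hom n i) (@step_over n i) d)
       : hom_over E' (aug_map C n)) *~ (-1) ^+ i.

Let ev n (c : Cl n) (d : hom_over E' (aug_map C n)) : M := hom_over_val d c.
Let ev_additive n c : zmod_morphism (@ev n c).
Proof. by []. Qed.
HB.instance Definition _ n c := GRing.isZmodMorphism.Build
  (hom_over E' (aug_map C n)) M (@ev n c) (@ev_additive n c).
Let evD n (c : Dl n) (d : hom_over E (aug_map D n)) : M := hom_over_val d c.
Let evD_additive n c : zmod_morphism (@evD n c).
Proof. by []. Qed.
HB.instance Definition _ n c := GRing.isZmodMorphism.Build
  (hom_over E (aug_map D n)) M (@evD n c) (@evD_additive n c).

Let ev_T n (c : Cl n) d :
  ev c (T d) = \sum_(0 <= i < n.+1) evD (step i c) d *~ (-1) ^+ i.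
Proof.
rewrite /T raddf_sum big_mkord; apply: eq_bigr => i _.
by rewrite raddfMz.
Qed.

Let evD_cobound n (c : Dl n.+1) (d : hom_cosimplicial E D n) :
  evD c (cobound d) =
  \sum_(0 <= j < n.+2) evD (s_map D (cofs n j) c) d *~ (-1) ^+ j.
Proof.
rewrite /cobound raddf_sum big_mkord; apply: eq_bigr => j _.
by rewrite raddfMz /cofs inord_val.
Qed.

Let ev_cobound n (c : Cl n.+1) (d : hom_cosimplicial E' C n) :
  ev c (cobound d) =
  \sum_(0 <= j < n.+2) ev (s_map C (cofs n j) c) d *~ (-1) ^+ j.
Proof.
rewrite /cobound raddf_sum big_mkord; apply: eq_bigr => j _.
by rewrite raddfMz /cofs inord_val.
Qed.

Let s_cell n (c : Cl n) l m (e : Delta m n) (t : Delta m 1) (f : Delta l m) :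
  s_map D f (hv n c (cell e t)) = hv n c (cell (delta_comp e f) (delta_comp t f)).
Proof.
by have [-> _] := sp_valP (h n c : subproduct (prism_family aD n)).
Qed.

Let step_face n i j (c : Cl n.+1) :
  step i (s_map C (cofs n j) c) =
  hv n.+1 c (cell (delta_comp (cofs n j) (cods n i)) (threshold n.+1 i.+1)).
Proof. by rewrite /step smap_nat. Qed.

Let thrE n i j : val (threshold n i) j = (i <= j)%N :> nat.
Proof. exact: thresholdE. Qed.

Let cell_eq n (c : Cl n) m (e e' : Delta m n) (t t' : Delta m 1) d :
  (forall l, val e l = val e' l :> nat) -> (forall l, val t l = val t' l :> nat) ->
  evD (hv n c (cell e t)) d = evD (hv n c (cell e' t')) d.
Proof. by move=> /deltaP-> /deltaP->. Qed.

Let step_coface n i j (c : Cl n) d :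
  evD (s_map D (cofs n j) (step i c)) d =
  evD (hv n c (cell (delta_comp (cods n i) (cofs n j))
     (delta_comp (threshold n.+1 i.+1) (cofs n j)))) d.
Proof. by rewrite /step s_cell. Qed.

Let codsE n i l : (i <= n)%N ->
  val (cods n i) l = minn (unbump i l) n :> nat.
Proof. by move=> le_in; rewrite codegE inordK // ltnS ltnW. Qed.
Let cofsE n j l : (j <= n.+1)%N -> val (cofs n j) l = bump j l :> nat.
Proof. by move=> le_jn; rewrite cofaceE /= inordK. Qed.

Let diagonal n i (c : Cl n) d : (i <= n)%N ->
  evD (s_map D (cofs n i) (step i c)) d =
    evD (hv n c (cell (delta_id n) (threshold n i))) d /\
  evD (s_map D (cofs n i.+1) (step i c)) d =
    evD (hv n c (cell (delta_id n) (threshold n i.+1))) d.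
Proof.
move=> le_in; have le_in1 := leqW le_in.
split; rewrite step_coface; apply: cell_eq => l; have := ltn_ord l;
  rewrite !delta_compE ?delta_idE ?codsE ?thrE ?cofsE //= /bump /unbump.
all: by move: (nat_of_ord l) => k lt_k; lia.
Qed.

Let boundary n (c : Cl n) d :
  evD (hv n c (cell (delta_id n) (threshold n 0))) d
   - evD (hv n c (cell (delta_id n) (threshold n n.+1))) d =
  evD (hv n c (end_cell n true)) d - evD (hv n c (end_cell n false)) d.
Proof.
congr (_ - _); apply: cell_eq => l //; rewrite thrE delta_constE //=.
by rewrite leqNgt ltn_ord.
Qed.

Lemma prism_homotopy0 (c : Cl 0) (d : hom_cosimplicial E D 0) :
  evD (hv 0 c (end_cell 0 true)) d - evD (hv 0 c (end_cell 0 false)) d =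
  ev c (T (cobound d)).
Proof.
pose A i j := evD (s_map D (cofs 0 j) (step i c)) d.
pose B i := evD (hv 0 c (cell (delta_id 0) (threshold 0 i))) d.
rewrite -boundary -[LHS](@prism_sum M 0 A (fun _ _ => 0) B); first last.
- by case=> [|i] [|[|j]].
- by move=> i /(diagonal c d).
- by case.
rewrite ev_T [RHS](eq_bigr (fun i =>
    (\sum_(0 <= j < 2) A i j *~ (-1) ^+ j) *~ (-1) ^+ i)).
  by rewrite sum_signs [X in _ + X]big1 ?addr0 // => j _; rewrite big_geq.
by move=> i _; rewrite evD_cobound.
Qed.

Lemma prism_homotopyS n (c : Cl n.+1) (d : hom_cosimplicial E D n.+1) :
  evD (hv n.+1 c (end_cell n.+1 true)) d - evD (hv n.+1 c (end_cell n.+1 false)) d =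
  ev c (cobound (T d)) + ev c (T (cobound d)).
Proof.
pose A i j := evD (s_map D (cofs n.+1 j) (step i c)) d.
pose G i j := evD (step i (s_map C (cofs n j) c)) d.
pose B i := evD (hv n.+1 c (cell (delta_id n.+1) (threshold n.+1 i))) d.
rewrite -boundary -[LHS](@prism_sum M n.+1 A G B); first last.
- move=> i j lt_ij le_jn; rewrite /A /G step_face step_coface.
  have := leqW le_jn; case: j lt_ij le_jn => //= j lt_ij le_jn _.
  have [le_in le_in1] : (i <= n)%N /\ (i <= n.+1)%N by lia.
  by apply: cell_eq => l; have := ltn_ord l; rewrite !delta_compE ?thrE ?cofsE ?codsE //=;
    rewrite ?cofsE ?codsE //= /bump /unbump;
    move: (nat_of_ord l) => k lt_k; lia.
- by move=> i /(diagonal c d).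
- move=> i j lt_ji le_in; rewrite /A /G step_face step_coface.
  case: i lt_ji le_in => //= i lt_ji le_in.
  have [le_jn le_jn2] : (j <= n.+1)%N /\ (j <= n.+2)%N by lia.
  have le_in1 := leqW le_in.
  by apply: cell_eq => l; have := ltn_ord l; rewrite !delta_compE ?thrE ?cofsE ?codsE //=;
    rewrite ?cofsE ?codsE //= /bump /unbump;
    move: (nat_of_ord l) => k lt_k; lia.
rewrite addrC; congr (_ + _).
  rewrite ev_cobound [RHS](eq_bigr (fun j =>
      (\sum_(0 <= i < n.+1) G i j *~ (-1) ^+ i) *~ (-1) ^+ j)).
    rewrite (sum_signs _ _ (fun j i => G i j)).
    by apply: eq_bigr => j _; apply: eq_bigr => i _; rewrite addnC.
  by move=> j _; rewrite ev_T.
rewrite ev_T [RHS](eq_bigr (fun i =>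
    (\sum_(0 <= j < n.+3) A i j *~ (-1) ^+ j) *~ (-1) ^+ i)).
  by rewrite sum_signs.
by move=> i _; rewrite evD_cobound.
Qed.

Lemma ends_cohomotopy
    (Phi Psi : csmap (hom_cosimplicial E D) (hom_cosimplicial E' C)) :
  (forall n d c,
    hom_over_val (Phi n d) c = hom_over_val d (hv n c (end_cell n true))) ->
  (forall n d c,
    hom_over_val (Psi n d) c = hom_over_val d (hv n c (end_cell n false))) ->
  forall n x, cohomotopy_map Phi n x = cohomotopy_map Psi n x.
Proof.
move=> PhiE PsiE; apply: (@cohomotopy_map_homotopic _ _ _ _ T).
- move=> n; apply: val_inj; apply/funext => c.
  by rewrite -[LHS]/(ev c (T 0)) ev_T big1 // => i _; rewrite raddf0 mul0rz.
- move=> d; apply: val_inj; apply/funext => c.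
  rewrite -[RHS]/(ev c _) -prism_homotopy0.
  rewrite -[LHS]/(hom_over_val (Phi 0%N d) c - hom_over_val (Psi 0%N d) c : M).
  by rewrite PhiE PsiE.
- move=> n d; apply: val_inj; apply/funext => c.
  rewrite -[RHS]/(ev c _ + ev c _) -prism_homotopyS.
  rewrite -[LHS]/(hom_over_val (Phi n.+1 d) c - hom_over_val (Psi n.+1 d) c : M).
  by rewrite PhiE PsiE.
Qed.

End HomotopyInvariance.

(** * Lifts over the augmentation *)

Section Lifts.
Variables (p : nat) (F : fieldType).
Variables (H : rlieType p F) (L : lieType F) (g : L -> H) (g_hom : lie_hom g).
Variables (D : cofibrant_replacement (H : RLieCat p F)).
Variables (C : cofibrant_replacement (L : LieCat F)).
Local Notation aD := (aug_map (forget_aug D)).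

Lemma forget_aug_lifting : simplex_lifting aD.
Proof. by apply: weq_const_lifting; exact: (@cr_weq _ _ D). Qed.

Let g_mor : mor (L : LieCat F) ((H : lieType F) : LieCat F) :=
  @Mor (LieCat F) L H g g_hom.

Lemma lift_over : exists s : smap C (forget D),
  forall n x, aug_map D n (s n x) = g (aug_map C n x).
Proof.
pose b n : mor (C n) (sconst ((H : lieType F) : LieCat F) n) :=
  mor_comp g_mor (aug_map C n).
have b_nat m n (f : Delta m n) x :
    b m (s_map C f x) = s_map (sconst ((H : lieType F) : LieCat F)) f (b n x).
  by rewrite /= (smap_nat (aug_map C)).
have [s sP] := cr_cofibrant (simplex_lifting_kan forget_aug_lifting)
                            (@cr_weq _ _ D) (SMap b_nat).
by exists s => n x; exact: (sP n x).
Qed.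

Section Homotopy.
Variables s s' : smap C (forget D).
Hypothesis s_over : forall n x, aug_map D n (s n x) = g (aug_map C n x).
Hypothesis s'_over : forall n x, aug_map D n (s' n x) = g (aug_map C n x).

Lemma pair_lift_subproof n (x : (C n : lieType F)) :
  over_pair aD (n := n) (fun b : bool => if b then s n x else s' n x).
Proof. by rewrite /over_pair /= s_over s'_over. Qed.
Let pair_fun n (x : (C n : lieType F)) : subproduct (pair_family aD n) :=
  @Subproduct _ _ _ (pair_family aD n) _ (pair_lift_subproof x).
Let pair_hom n : lie_hom (@pair_fun n).
Proof.
split=> [c x y|x y]; apply: subproductP => -[] /=; rewrite ?lmorP ?lmor_bracket //.
Qed.
Let pair_mor n : mor (C n) (pairs aD n) :=
  @Mor (LieCat F) (C n) (pairs aD n) _ (@pair_hom n).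
Let pair_nat m n (f : Delta m n) x :
  pair_mor m (s_map C f x) = s_map (pairs aD) f (pair_mor n x).
Proof. by apply: subproductP => -[] /=; rewrite smap_nat. Qed.

Lemma lifts_homotopic : exists h : smap C (paths aD), forall n (x : cc_el (C n)),
  let u : subproduct (prism_family aD n) := h n x in
  u (end_cell n true) = s n x /\ u (end_cell n false) = s' n x.
Proof.
have el := ends_lifting forget_aug_lifting.
have [h hP] := cr_cofibrant (simplex_lifting_kan el) (simplex_lifting_weq el)
                            (SMap pair_nat).
exists h => n x /=.
have e := congr1 (fun u : subproduct (pair_family aD n) => sp_val u) (hP n x).
split; first exact: (congr1 (fun u => u true) e).
exact: (congr1 (fun u => u false) e).
Qed.
End Homotopy.

Variables (pF : p \in [pchar F]).
Variables (U : uea H) (u : renv U) (R : skew_poly p F).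
Variables (W : wring u R) (M : lmodType W) (UL : uea L).
Variables (phi : {rmorphism UL -> W}).
Hypothesis phi_in : forall x, phi (uea_in UL x) = w_act W (g x).
Hypothesis phi_scal : forall c, phi c%:A = w_scal W c.
Local Notation E := (rlie_beck pF M).
Local Notation E' := (lie_beck (restr phi M)).

(** The comparison on cohomology depends neither on the lift nor, by naturality
    of lifts, on the cofibrant replacements: [Phi] and [Psi] stand for any two
    constructions that amount to composition with a lift of [g]. *)
Lemma lift_cohomotopy (s s' : smap C (forget D))
    (Phi Psi : csmap (hom_cosimplicial E D) (hom_cosimplicial E' C)) :
  (forall n x, aug_map D n (s n x) = g (aug_map C n x)) ->
  (forall n x, aug_map D n (s' n x) = g (aug_map C n x)) ->
  (forall n d x, hom_over_val (Phi n d) x = hom_over_val d (s n x)) ->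
  (forall n d x, hom_over_val (Psi n d) x = hom_over_val d (s' n x)) ->
  forall n x, cohomotopy_map Phi n x = cohomotopy_map Psi n x.
Proof.
move=> s_over s'_over PhiE PsiE; have [h hP] := lifts_homotopic s_over s'_over.
apply: (ends_cohomotopy phi_in phi_scal (h := h)).
- by move=> n c [] /=; have [e e'] := hP n c; rewrite (e, e') (s_over, s'_over).
- by move=> n d c; have [-> _] := hP n c.
- by move=> n d c; have [_ ->] := hP n c.
Qed.
End Lifts.

(** * Bases *)

Section Bases.
Variables (F : fieldType) (V : lmodType F).
Implicit Types (B : set V) (f : V -> F).

(** The span of the graph of [f] over [B]; it is again the graph of a function
    for every [f] exactly when [B] is linearly independent. *)
Inductive graph_span B f : V -> F -> Prop :=
| graph_span0 : graph_span B f 0 0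
| graph_spanS c x v a : B x -> graph_span B f v a ->
    graph_span B f (c *: x + v) (c * f x + a).

Definition independent B : Prop := forall f a, graph_span B f 0 a -> a = 0.

Lemma graph_span_lin B f c v w a b :
  graph_span B f v a -> graph_span B f w b -> graph_span B f (c *: v + w) (c * a + b).
Proof.
elim=> [|d x {}v {}a Bx _ IHv] wb; first by rewrite scaler0 mulr0 !add0r.
rewrite scalerDr mulrDr scalerA mulrA -!addrA.
by apply: graph_spanS => //; exact: IHv.
Qed.

Lemma graph_span_sub B B' f v a : (B `<=` B')%classic ->
  graph_span B f v a -> graph_span B' f v a.
Proof.
by move=> BB'; elim=> [|c x {}v {}a Bx _ IHv]; [left|right=> //; exact: BB'].
Qed.

Lemma graph_span_fun B f v a b : independent B ->
  graph_span B f v a -> graph_span B f v b -> a = b.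
Proof.
move=> Bi va vb; have := graph_span_lin (-1) va vb.
by rewrite scaleN1r addNr mulN1r => /Bi/eqP; rewrite addrC subr_eq0 => /eqP.
Qed.

Lemma independent1 v : v != 0 -> independent [set v]%classic.
Proof.
move=> v0 f a; have aux w b : graph_span [set v]%classic f w b ->
    exists c, w = c *: v /\ b = c * f v.
  elim=> [|c x {}w {}b -> _ [d [-> ->]]].
    by exists 0; rewrite scale0r mul0r.
  by exists (c + d); rewrite scalerDl mulrDl.
move=> /aux[c [/esym/eqP]]; rewrite scaler_eq0 (negPf v0) orbF => /eqP-> ->.
by rewrite mul0r.
Qed.

(** A maximal independent set spans: an element [v] outside the span of [A] could
    be added to [A], since in a relation that involves [v] its coefficient
    vanishes. *)
Lemma maximal_independent B0 : independent B0 -> exists B, [/\ (B0 `<=` B)%classic,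
  independent B & forall f v, exists a, graph_span B f v a].
Proof.
move=> B0i; pose P A := independent (A `|` B0)%classic.
have [|A [AP Amax]] := @Zorn_bigcup V P.
  move=> Fa FaP Fat f a.
  have aux v b : graph_span (\bigcup_(X in Fa) X `|` B0)%classic f v b ->
      graph_span B0 f v b \/ exists2 X, Fa X & graph_span (X `|` B0)%classic f v b.
    elim=> [|c x {}v {}b xFa _ IHv]; first by left; left.
    case: xFa => [[X FX Xx]|B0x]; last first.
      case: IHv => [?|[X FX ?]]; [left; right=> //|right; exists X => //].
      by right=> //; right.
    right; case: IHv => [vb|[Y FY vb]].
      exists X => //; right; first by left.
      by apply: graph_span_sub vb => y; right.
    have [XY|YX] := Fat _ _ FX FY.
      by exists Y => //; right=> //; left; exact: XY.
    exists X => //; right; first by left.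
    by apply: graph_span_sub vb => y [/YX|]; [left|right].
  by move=> /aux[/B0i//|[X FX]]; exact: FaP FX _ _.
exists (A `|` B0)%classic; split=> // f v.
apply: contrapT => nv.
have nAv : ~ A v.
  move=> Av; apply: nv; exists (1 * f v + 0).
  rewrite -{1}[v]addr0 -{1}[v]scale1r; apply: graph_spanS; last exact: graph_span0.
  by left.
apply: (Amax (A `|` [set v])%classic).
  by split=> [x ?|]; [left|move=> /(_ v) s; apply: nAv; apply: s; right].
move=> h b hb.
have aux w d : graph_span ((A `|` [set v]) `|` B0)%classic h w d ->
    exists t w' d', [/\ graph_span (A `|` B0)%classic h w' d',
      w = t *: v + w' & d = t * h v + d'].
  elim=> [|c x {}w {}d xB _ [t [w' [d' [wd' -> ->]]]]].
    by exists 0, 0, 0; split; [left|rewrite scale0r add0r|rewrite mul0r add0r].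
  have [xv|ABx] : x = v \/ (A `|` B0)%classic x.
    by case: xB => [[?|?]|?]; [right; left|left|right; right].
    exists (c + t), w', d'; rewrite xv; split=> //.
      by rewrite scalerDl addrA.
    by rewrite mulrDl addrA.
  exists t, (c *: x + w'), (c * h x + d'); split; first exact: graph_spanS.
    by rewrite addrCA.
  by rewrite addrCA.
have [t [w [d [wd tw ->]]]] := aux _ _ hb.
have [t0|t0] := eqVneq t 0.
  by move: tw wd; rewrite t0 scale0r mul0r !add0r => <- /AP.
exfalso; apply: nv.
have dom f' w' d' : graph_span (A `|` B0)%classic h w' d' ->
    exists a', graph_span (A `|` B0)%classic f' w' a'.
  elim=> [|c x {}w' {}d' Bx _ [a' wa']]; first by exists 0; left.
  by exists (c * f' x + a'); right.
have [a' wa'] := dom f _ _ wd.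
exists (- t^-1 * a' + 0); have := graph_span_lin (- t^-1) wa' (graph_span0 _ f).
suff -> : - t^-1 *: w + 0 = v by [].
have -> : w = - (t *: v) by apply/eqP; rewrite -addr_eq0 addrC -tw.
by rewrite addr0 scalerN scaleNr opprK scalerA mulVf // scale1r.
Qed.

(** A basis, given by the extension of functions on its index set to linear
    functionals, and by an induction principle expressing that it spans. *)
Record basis := Basis {
  bs_idx : choiceType;
  bs_vec : bs_idx -> V;
  bs_ext : (bs_idx -> F) -> V -> F;
  bs_ext_lin : forall (f : bs_idx -> F) c v w,
    bs_ext f (c *: v + w) = c * bs_ext f v + bs_ext f w;
  bs_extE : forall (f : bs_idx -> F) i, bs_ext f (bs_vec i) = f i;
  bs_ind : forall P : V -> Prop, P 0 ->
    (forall c i v, P v -> P (c *: bs_vec i + v)) -> forall v, P v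
}.

Lemma basis_extending B0 : independent B0 ->
  exists b : basis, forall x, B0 x -> exists i, bs_vec (b := b) i = x.
Proof.
move=> /maximal_independent[B [B0B Bi Bs]].
pose I : choiceType := {x : V | `[< B x >]}.
pose up (f : I -> F) x := oapp f 0 (insub x).
have upE (f : I -> F) (i : I) : up f (val i) = f i by rewrite /up valK.
pose ext (f : I -> F) v := projT1 (cid (Bs (up f) v)).
have extP (f : I -> F) v : graph_span B (up f) v (ext f v).
  exact: (projT2 (cid (Bs (up f) v))).
have ext_lin (f : I -> F) c v w : ext f (c *: v + w) = c * ext f v + ext f w.
  exact: graph_span_fun Bi (extP _ _) (graph_span_lin _ (extP _ _) (extP _ _)).
have extE (f : I -> F) (i : I) : ext f (val i) = f i.
  apply: graph_span_fun Bi (extP _ _) _.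
  have := graph_spanS 1 (asboolP _ (valP i)) (graph_span0 B (up f)).
  by rewrite scale1r !addr0 mul1r upE.
have ind (P : V -> Prop) : P 0 -> (forall c (i : I) v, P v -> P (c *: val i + v)) ->
    forall v, P v.
  move=> P0 PS v; have [a] := Bs (fun _ => 0) v.
  elim=> // c x w _ Bx _ Pw; have Bx' : `[< B x >] by apply/asboolP.
  exact: (PS c (exist _ x Bx' : I)).
exists (Basis ext_lin extE ind) => x /B0B Bx.
have Bx' : `[< B x >] by apply/asboolP.
by exists (exist _ x Bx' : I).
Qed.

Lemma basis_exists : inhabited basis.
Proof.
have [|b _] := @basis_extending set0; last exact: inhabits.
move=> f a; suff aux v b : graph_span set0 f v b -> b = 0 by exact: aux.
by elim.
Qed.

Lemma separating_functional v : v != 0 -> exists2 l : V -> F,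
  (forall c x y, l (c *: x + y) = c * l x + l y) & l v = 1.
Proof.
move=> /independent1/basis_extending[b bv].
have [i <-] := bv v erefl; exists (bs_ext (b := b) (fun _ => 1)).
  exact: bs_ext_lin.
exact: bs_extE.
Qed.
End Bases.

Lemma strict_order_exists (T : choiceType) : exists lt : rel T,
  [/\ irreflexive lt, transitive lt & forall x y, x != y -> lt x y || lt y x].
Proof.
have [R Rwo] := well_ordering_principle T.
have min_of (s : seq T) x : x \in s -> exists2 z, z \in s & forall y, y \in s -> R z y.
  move=> xs; have [|z [[zs zmin] _]] := Rwo [in s]; first by exists x.
  by exists z.
have anti x y : R x y -> R y x -> x = y.
  move=> xy yx; have [|z [[zs zmin] zu]] := Rwo [in [:: x; y]].
    by exists x; rewrite inE eqxx.
  have xx : R x x.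
    have [w] := @min_of [:: x] x (mem_head _ _).
    by rewrite !inE => /eqP-> ->; rewrite ?mem_head.
  have yy : R y y.
    have [w] := @min_of [:: y] y (mem_head _ _).
    by rewrite !inE => /eqP-> ->; rewrite ?mem_head.
  rewrite -(zu x) ?(zu y) //; split; rewrite ?inE ?eqxx ?orbT // => w.
    by rewrite !inE => /orP[] /eqP->.
  by rewrite !inE => /orP[] /eqP->.
have tot x y : R x y || R y x.
  have [z] := @min_of [:: x; y] x (mem_head _ _).
  rewrite !inE => /orP[] /eqP-> zmin; apply/orP; [left|right]; apply: zmin.
    by rewrite !inE eqxx orbT.
  by rewrite !inE eqxx.
have tr : transitive R.
  move=> y x z xy yz; have [w] := @min_of [:: x; y; z] x (mem_head _ _).
  rewrite !inE => /or3P[] /eqP-> wmin.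
  - by apply: wmin; rewrite !inE eqxx !orbT.
  - by rewrite (anti x y) // wmin // !inE eqxx.
  - by rewrite -(anti y z) // wmin // !inE eqxx ?orbT.
exists (fun x y => (x != y) && R x y); split=> [x|y x z|x y xy].
- by rewrite eqxx.
- move=> /andP[xy Rxy] /andP[yz Ryz]; rewrite (tr y) // andbT.
  by apply: contraNneq xy => xz; apply/eqP/anti; rewrite // xz.
- by rewrite xy eq_sym xy tot.
Qed.

Section BasisTheory.
Variables (F : fieldType) (V : lmodType F) (b : basis V).
Local Notation ext := (bs_ext (b := b)).
Local Notation e := (bs_vec (b := b)).

Lemma ext0 f : ext f 0 = 0.
Proof. by have := bs_ext_lin f (-1) 0 0; rewrite scaler0 add0r mulN1r addNr. Qed.
Lemma extD f v w : ext f (v + w) = ext f v + ext f w.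
Proof. by have := bs_ext_lin f 1 v w; rewrite scale1r mul1r. Qed.
Lemma extZ f c v : ext f (c *: v) = c * ext f v.
Proof. by rewrite -[c *: v]addr0 bs_ext_lin ext0 addr0. Qed.
Lemma extN f v : ext f (- v) = - ext f v.
Proof. by rewrite -scaleN1r extZ mulN1r. Qed.

Lemma bs_eq (l l' : V -> F) :
  (forall c x y, l (c *: x + y) = c * l x + l y) ->
  (forall c x y, l' (c *: x + y) = c * l' x + l' y) ->
  (forall i, l (e i) = l' (e i)) -> forall v, l v = l' v.
Proof.
move=> lin lin' ll'; have z (h : V -> F) :
    (forall c x y, h (c *: x + y) = c * h x + h y) -> h 0 = 0.
  by move=> hl; have := hl (-1) 0 0; rewrite scaler0 add0r mulN1r addNr.
by apply: (bs_ind (b := b)) => [|c i v IH]; rewrite ?z // lin lin' ll' IH.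
Qed.

Lemma ext_linf c f g v : ext (fun i => c * f i + g i) v = c * ext f v + ext g v.
Proof.
move: v; apply: bs_eq => [d x y|d x y|i]; rewrite ?bs_ext_lin ?bs_extE //.
by rewrite mulrDr addrACA !mulrA (mulrC c) -addrA mulrDr mulrA addrA.
Qed.
Lemma ext_eqf f g v : f =1 g -> ext f v = ext g v.
Proof. by move=> /funext->. Qed.
Lemma ext_addf f g v : ext (fun i => f i + g i) v = ext f v + ext g v.
Proof. by rewrite -[ext f v]mul1r -ext_linf; apply: ext_eqf => i; rewrite mul1r. Qed.
Lemma ext_subf f g v : ext (fun i => f i - g i) v = ext f v - ext g v.
Proof.
rewrite [RHS]addrC -mulN1r -ext_linf; apply: ext_eqf => i.
by rewrite mulN1r addrC.
Qed.

Lemma ext_zerof v : ext (fun _ => 0) v = 0.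
Proof.
by have := ext_subf (fun _ => 0) (fun _ => 0) v; rewrite !subrr.
Qed.

(** Both sides are the value at [v] and [w] of the bilinear extension of
    [G]. *)
Lemma ext_swap (G : _ -> _ -> F) v w :
  ext (fun i => ext (fun j => G i j) w) v = ext (fun j => ext (fun i => G i j) v) w.
Proof.
move: v; apply: bs_eq => [c x y|c x y|i].
- by rewrite bs_ext_lin.
- by rewrite -ext_linf; apply: ext_eqf => j; rewrite bs_ext_lin.
- by rewrite bs_extE; apply: ext_eqf => j; rewrite bs_extE.
Qed.
End BasisTheory.

(** * The theorem of Poincare, Birkhoff and Witt *)

Lemma bracketC (F : fieldType) (L : lieType F) (x y : L) :
  bracket x y = - bracket y x.
Proof.
apply/eqP; rewrite -addr_eq0; have := bracketxx (x + y).
by rewrite bracketDl !bracketDr !bracketxx add0r addr0 => ->.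
Qed.

Lemma bracketNl (F : fieldType) (L : lieType F) (x y : L) :
  bracket (- x) y = - bracket x y.
Proof. by rewrite -scaleN1r bracketZl scaleN1r. Qed.

Section Words.
Variables (T : choiceType) (lt : rel T).
Hypothesis lt_trans : transitive lt.
Hypothesis lt_irr : irreflexive lt.

Fixpoint inversions (w : seq T) : nat :=
  if w is x :: w' then (count (lt^~ x) w' + inversions w')%N else 0%N.

Lemma inversions_swap a x y c : lt y x ->
  inversions (a ++ x :: y :: c) = (inversions (a ++ y :: x :: c)).+1.
Proof.
move=> yx; elim: a => [|z a IHa] /=.
  have /negPf-> : ~~ lt x y by apply/negP => /(lt_trans yx); rewrite lt_irr.
  by rewrite yx; lia.
by rewrite IHa addnS !count_cat /= [(lt x z + _)%N]addnCA.
Qed.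

Fixpoint first_descent (w : seq T) : option (seq T * T * T * seq T) :=
  match w with
  | x :: ((y :: c) as w') =>
    if lt y x then Some ([::], x, y, c)
    else if first_descent w' is Some (a, x', y', c') then Some (x :: a, x', y', c')
    else None
  | _ => None
  end.

Lemma first_descentP w : match first_descent w with
  | Some (a, x, y, c) => w = a ++ x :: y :: c /\ lt y x
  | None => forall a x y c, w = a ++ x :: y :: c -> ~~ lt y x
  end.
Proof.
elim: w => [|x [|y c] IHw] /=; try by case=> [|? []].
case: ifP => [|/negbT] yx; first by [].
move: IHw => /=; case: (match c with [::] => _ | _ => _ end).
  by case=> [[[a x'] y'] c'] [-> lt'].
move=> IH; case=> [|z a] x' y' c'; first by case=> <- <- _.
by case=> _; exact: IH.
Qed.

Lemma two_descents (a a' : seq T) x y c x' y' c' :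
  a ++ x :: y :: c = a' ++ x' :: y' :: c' -> (size a <= size a')%N ->
  [\/ [/\ a = a', x = x', y = y' & c = c'],
      [/\ a' = rcons a x, x' = y & c = y' :: c']
    | exists d, a' = a ++ x :: y :: d /\ c = d ++ x' :: y' :: c'].
Proof.
elim: a a' => [|z a IHa] [|z' a'] //=.
- by case=> -> -> -> _; constructor 1.
- case=> <-; case: a' => [|y1 a'] /=.
    by case=> -> -> _; constructor 2.
  by case=> <- -> _; constructor 3; exists a'.
- case=> <- /IHa{}IHa; rewrite ltnS => /IHa[[-> -> -> ->]|[-> -> ->]|[d [-> ->]]].
  + by constructor 1.
  + by constructor 2.
  + by constructor 3; exists d.
Qed.
End Words.

Section Straightening.
Variables (F : fieldType) (L : lieType F) (b : basis L).
Local Notation I := (bs_idx b).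
Local Notation e := (bs_vec (b := b)).
Local Notation ext := (bs_ext (b := b)).
Variable lt : rel I.
Hypotheses (lt_irr : irreflexive lt) (lt_trans : transitive lt).
Hypothesis lt_total : forall x y, x != y -> lt x y || lt y x.
Implicit Types (phi : seq I -> F) (a c w : seq I).

(** The functions [phi] on words are the linear functionals on the tensor
    algebra of [L]; those with [swap_rel] everywhere are the functionals on
    its quotient [U(L)]. *)
Definition swap_rel phi a i j c : Prop :=
  phi (a ++ i :: j :: c) =
  phi (a ++ j :: i :: c) + ext (fun k => phi (a ++ k :: c)) (bracket (e i) (e j)).

Lemma swap_rel_sym phi a i j c : swap_rel phi a i j c -> swap_rel phi a j i c.
Proof. by rewrite /swap_rel => ->; rewrite [bracket (e i) _]bracketC extN subrK. Qed.

Lemma swap_rel_vector phi a c j : (forall i, swap_rel phi a i j c) -> forall v,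
  ext (fun k => phi (a ++ k :: j :: c)) v - ext (fun k => phi (a ++ j :: k :: c)) v =
  ext (fun k => phi (a ++ k :: c)) (bracket v (e j)).
Proof.
move=> rel; apply: (bs_eq (b := b)) => [d x y|d x y|i].
- by rewrite !bs_ext_lin; ring.
- by rewrite bracketDl bracketZl bs_ext_lin.
- by rewrite !bs_extE rel addrC addKr.
Qed.

Section Confluence.
Variables (phi : seq I -> F) (n m : nat).
Hypothesis low : forall a i j c,
  (size (a ++ i :: j :: c) < n)%N -> swap_rel phi a i j c.
Hypothesis same : forall a i j c, size (a ++ i :: j :: c) = n ->
  (inversions lt (a ++ i :: j :: c) < m)%N -> lt j i -> swap_rel phi a i j c.

Local Notation reduct a x y c :=
  (phi (a ++ y :: x :: c) + ext (fun k => phi (a ++ k :: c)) (bracket (e x) (e y))).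

(** The two swaps commute, and so do the two commutators ([ext_swap]). *)
Lemma confluence_disjoint a x y d x' y' c :
  size (a ++ x :: y :: d ++ x' :: y' :: c) = n ->
  inversions lt (a ++ x :: y :: d ++ x' :: y' :: c) = m -> lt y x -> lt y' x' ->
  reduct a x y (d ++ x' :: y' :: c) = reduct (a ++ x :: y :: d) x' y' c.
Proof.
move=> wn wm yx yx'.
have := inversions_swap lt_trans lt_irr a (d ++ x' :: y' :: c) yx; rewrite wm => wm1.
have := inversions_swap lt_trans lt_irr (a ++ x :: y :: d) c yx'.
rewrite -!catA /= wm => wm2.
have extA t r v : ext (fun k => phi ((a ++ t :: r :: d) ++ k :: c)) v =
    ext (fun k => phi (a ++ t :: r :: d ++ k :: c)) v.
  by apply: ext_eqf => k; rewrite -catA.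
rewrite extA.
have := @same (a ++ y :: x :: d) x' y' c.
rewrite /swap_rel extA -!catA /= => ->; first last.
- by [].
- by rewrite wm1.
- by rewrite -wn !size_cat.
have := @same a x y (d ++ y' :: x' :: c); rewrite /swap_rel => ->; first last.
- by [].
- by rewrite wm2.
- by rewrite -wn !size_cat /= !size_cat.
rewrite -!addrA; congr (_ + _).
have -> : ext (fun k => phi (a ++ k :: d ++ x' :: y' :: c)) (bracket (e x) (e y)) =
    ext (fun k => phi (a ++ k :: d ++ y' :: x' :: c)) (bracket (e x) (e y)) +
    ext (fun k => ext (fun l => phi (a ++ k :: d ++ l :: c)) (bracket (e x') (e y')))
      (bracket (e x) (e y)).
  rewrite -ext_addf; apply: ext_eqf => k.
  have := @low (a ++ k :: d) x' y' c; rewrite /swap_rel -!catA /= => ->.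
    by congr (_ + _); apply: ext_eqf => l; rewrite -catA.
  by rewrite -wn !size_cat /= !size_cat /=; lia.
have -> : ext (fun k => phi (a ++ x :: y :: d ++ k :: c)) (bracket (e x') (e y')) =
    ext (fun k => phi (a ++ y :: x :: d ++ k :: c)) (bracket (e x') (e y')) +
    ext (fun k => ext (fun l => phi (a ++ l :: d ++ k :: c)) (bracket (e x) (e y)))
      (bracket (e x') (e y')).
  rewrite -ext_addf; apply: ext_eqf => k.
  have := @low a x y (d ++ k :: c); rewrite /swap_rel => -> //.
  by rewrite -wn !size_cat /= !size_cat /=; lia.
by rewrite ext_swap addrCA addrA.
Qed.

(** The Jacobi identity resolves the overlap of two descents. *)
Lemma confluence_overlap a x y z c :
  size (a ++ x :: y :: z :: c) = n ->
  inversions lt (a ++ x :: y :: z :: c) = m -> lt y x -> lt z y ->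
  reduct a x y (z :: c) = reduct (rcons a x) y z c.
Proof.
move=> wn wm yx zy; have zx := lt_trans zy yx.
have cat1 t w : rcons a t ++ w = a ++ t :: w by rewrite cat_rcons.
have inv := inversions_swap lt_trans lt_irr.
have m1 := inv a _ _ (z :: c) yx; have m2 := inv (rcons a y) _ _ c zx.
have m3 := inv a _ _ (x :: c) zy; have m4 := inv (rcons a x) _ _ c zy.
have m5 := inv a _ _ (y :: c) zx; have m6 := inv (rcons a z) _ _ c yx.
rewrite !cat1 in m2 m4 m6.
have sz s t r : size (a ++ s :: t :: r :: c) = n by rewrite -wn !size_cat.
rewrite cat1.
have := @same (rcons a y) x z c; rewrite /swap_rel !cat1 => -> //; last by lia.
have := @same a y z (x :: c); rewrite /swap_rel => -> //; last by lia.
have := @same a x z (y :: c); rewrite /swap_rel => -> //; last by lia.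
have := @same (rcons a z) x y c; rewrite /swap_rel !cat1 => -> //; last by lia.
have lowv t v : ext (fun k => phi (a ++ k :: t :: c)) v =
    ext (fun k => phi (a ++ t :: k :: c)) v +
    ext (fun k => phi (a ++ k :: c)) (bracket v (e t)).
  have rel i : swap_rel phi a i t c.
    by apply: low; rewrite -wn !size_cat /=; lia.
  by rewrite -(swap_rel_vector rel v) addrC subrK.
under [X in _ = _ + X]ext_eqf do rewrite cat1.
have -> : ext (fun k => phi (rcons a y ++ k :: c)) (bracket (e x) (e z)) =
          ext (fun k => phi (a ++ y :: k :: c)) (bracket (e x) (e z)).
  by apply: ext_eqf => k; rewrite cat1.
have -> : ext (fun k => phi (rcons a z ++ k :: c)) (bracket (e x) (e y)) =
          ext (fun k => phi (a ++ z :: k :: c)) (bracket (e x) (e y)).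
  by apply: ext_eqf => k; rewrite cat1.
rewrite !lowv.
have jac0 : ext (fun k => phi (a ++ k :: c)) (bracket (bracket (e x) (e y)) (e z))
  - ext (fun k => phi (a ++ k :: c)) (bracket (bracket (e x) (e z)) (e y))
  + ext (fun k => phi (a ++ k :: c)) (bracket (bracket (e y) (e z)) (e x)) = 0.
  rewrite -extN -!extD -[RHS](ext0 (fun k => phi (a ++ k :: c))); congr (ext _ _).
  rewrite (bracketC _ (e z)) (bracketC _ (e x)).
  rewrite (bracketC (e x) (e z)) bracketNl -(bracketC (e y)).
  rewrite -[RHS]oppr0 -(jacobi (e x) (e y) (e z)) !opprD.
  by rewrite addrC [X in _ + X]addrC addrA.
move: jac0; set A := ext _ (bracket (bracket (e x) (e y)) _).
set B := ext _ (bracket (bracket (e x) (e z)) _).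
set C := ext _ (bracket (bracket (e y) (e z)) _).
set X := ext _ (bracket (e x) (e y)); set Y := ext _ (bracket (e x) (e z)).
set Z := ext _ (bracket (e y) (e z)).
move: (phi _) A B C X Y Z => P A B C X Y Z ABC.
have -> : B = A + C by rewrite -[B]add0r -ABC; ring.
by ring.
Qed.

(** The diamond lemma for words of length [n] with [m] inversions: it does not
    matter which descent is sorted first. The relations [low] and [same] are
    those of the induction on the length and on the number of inversions. *)
Lemma confluence a x y c a' x' y' c' :
  a ++ x :: y :: c = a' ++ x' :: y' :: c' ->
  size (a ++ x :: y :: c) = n -> inversions lt (a ++ x :: y :: c) = m ->
  lt y x -> lt y' x' -> reduct a x y c = reduct a' x' y' c'.
Proof.
wlog le_aa' : a x y c a' x' y' c' / (size a <= size a')%N.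
  move=> hw ww' wn wm yx yx'; case/orP: (leq_total (size a) (size a')) => le.
    exact: hw.
  by apply/esym/hw; rewrite -?ww'.
move=> ww' wn wm yx yx'.
have [[<- <- <- <- //]|[ea ex ec]|[d [ea ec]]] := two_descents ww' le_aa'.
  by subst a' x' c; exact: confluence_overlap.
by subst a' c; exact: confluence_disjoint.
Qed.
End Confluence.

Section Extension.
Variable psi : seq I -> F.

(** Bubble sort of a word, with [m] swaps allowed; [phi] evaluates the shorter
    words that the commutators produce. *)
Fixpoint straighten phi m w : F :=
  match first_descent lt w, m with
  | Some (a, x, y, c), m'.+1 => straighten phi m' (a ++ y :: x :: c)
      + ext (fun k => phi (a ++ k :: c)) (bracket (e x) (e y))
  | _, _ => psi w
  end.

Fixpoint pbw_upto n : seq I -> F :=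
  if n is n'.+1 then fun w => straighten (pbw_upto n') (inversions lt w) w else psi.

Definition pbw_functional w : F := pbw_upto (size w) w.

Lemma pbw_functionalE w : pbw_functional w =
  if first_descent lt w is Some (a, x, y, c) then
    pbw_functional (a ++ y :: x :: c)
      + ext (fun k => pbw_functional (a ++ k :: c)) (bracket (e x) (e y))
  else psi w.
Proof.
rewrite /pbw_functional; have := first_descentP lt w.
case fw: (first_descent lt w) => [[[[a x] y] c]|] => [[wE yx]|_]; last first.
  have str0 phi m v : first_descent lt v = None -> straighten phi m v = psi v.
    by case: m => [|m] /= ->.
  by case: (w) fw => [|z v] // fv; exact: str0.
have -> : size w = (size a + size c).+2 by rewrite wE size_cat /= !addnS.
have -> : size (a ++ [:: y, x & c]) = (size a + size c).+2.
  by rewrite size_cat /= !addnS.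
rewrite /= [in LHS]wE (inversions_swap lt_trans lt_irr) // -wE.
rewrite [LHS]/= fw; congr (_ + _); apply: ext_eqf => k.
by rewrite size_cat /= addnS.
Qed.

(** Existence in the theorem of Poincare, Birkhoff and Witt. By definition the
    relation holds at the first descent of each word; confluence extends it to
    all descents. *)
Theorem pbw_functional_rel a i j c : swap_rel pbw_functional a i j c.
Proof.
have [n] := ubnP (size (a ++ i :: j :: c)).
elim: n => // n IHn in a i j c *.
rewrite ltnS leq_eqVlt => /orP[/eqP wn|]; last exact: IHn.
move: i j wn; suff desc i j : lt j i -> size (a ++ i :: j :: c) = n ->
    swap_rel pbw_functional a i j c.
  move=> i j wn; have [->|/lt_total/orP[ij|ji]] := eqVneq i j.
  - by rewrite /swap_rel bracketxx ext0 addr0.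
  - by apply/swap_rel_sym/desc; rewrite // -wn !size_cat.
  - exact: desc.
have [m] := ubnP (inversions lt (a ++ i :: j :: c)).
elim: m => // m IHm in a i j c *; rewrite ltnS => wm ji wn.
rewrite /swap_rel pbw_functionalE; have := first_descentP lt (a ++ i :: j :: c).
case: first_descent => [[[[a' x] y] c'] [wE yx]|/(_ _ _ _ _ erefl)]; last by rewrite ji.
apply: (@confluence _ n (inversions lt (a ++ i :: j :: c)) IHn) => //.
- move=> a1 i1 j1 c1 wn1 wm1 ji1; apply: IHm => //.
  exact: leq_trans wm1 wm.
- by rewrite -wE.
- by rewrite -wE.
Qed.

Lemma pbw_functional_sorted w :
  first_descent lt w = None -> pbw_functional w = psi w.
Proof. by rewrite pbw_functionalE => ->. Qed.
End Extension.

Lemma constant_no_descent w : constant w -> first_descent lt w = None.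
Proof.
case: w => // i w /all_pred1P->; elim: (size w) => //= n.
by rewrite lt_irr => ->.
Qed.
End Straightening.

(** Powers of basis elements are sorted words for any order on the basis. *)
Theorem functional_on_powers (F : fieldType) (L : lieType F) (b : basis L)
    (psi : seq (bs_idx b) -> F) :
  exists2 phi : seq (bs_idx b) -> F, forall a i j c, swap_rel phi a i j c &
    forall w, constant w -> phi w = psi w.
Proof.
have [lt [lt_irr lt_trans lt_total]] := strict_order_exists (bs_idx b).
exists (pbw_functional lt psi); first exact: pbw_functional_rel.
by move=> w wc; rewrite pbw_functional_sorted // constant_no_descent.
Qed.

(** * The coinduced module *)

Section Endomorphisms.
Variables (F : fieldType) (V : lmodType F).

Definition is_linear : {pred V -> V} := fun f => `[< linear f >].
Lemma is_linear_submod : submod_closed is_linear.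
Proof.
split=> [|a f g /asboolP f_lin /asboolP g_lin]; apply/asboolP => c x y.
  by rewrite /= scaler0 addr0.
rewrite -[LHS]/(a *: f (c *: x + y) + g (c *: x + y)).
rewrite -[RHS]/(c *: (a *: f x + g x) + (a *: f y + g y)).
by rewrite f_lin g_lin !scalerDr !scalerA (mulrC a) addrACA.
Qed.
HB.instance Definition _ := GRing.isSubmodClosed.Build F (V -> V) is_linear
  is_linear_submod.

Record endo_sub := Endo { endo_fun :> V -> V; endoP : endo_fun \in is_linear }.
HB.instance Definition _ := [isSub for endo_fun].
HB.instance Definition _ := [Choice of endo_sub by <:].
HB.instance Definition _ := [SubChoice_isSubZmodule of endo_sub by <:].
HB.instance Definition _ := [SubZmodule_isSubLmodule of endo_sub by <:].

Lemma endo_linear (f : endo_sub) : linear f.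
Proof. exact/asboolP/endoP. Qed.
Lemma endo_eq (f g : endo_sub) : f =1 g -> f = g.
Proof. by move=> /funext fg; apply: val_inj. Qed.

Lemma endo_one_subproof : (fun x : V => x) \in is_linear.
Proof. exact/asboolP. Qed.
Definition endo_one := Endo endo_one_subproof.
Lemma endo_mul_subproof (f g : endo_sub) : (fun x => f (g x)) \in is_linear.
Proof. by apply/asboolP => c x y; rewrite !endo_linear. Qed.
Definition endo_mul f g := Endo (endo_mul_subproof f g).

(** The nontriviality of [V] makes the endomorphism ring nonzero. *)
Definition endo (nz : exists v : V, v != 0) : Type := (fun _ => endo_sub) nz.

Variable nz : exists v : V, v != 0.
HB.instance Definition _ := GRing.Lmodule.copy (endo nz) endo_sub.

Lemma endo_mulA : associative (endo_mul : endo nz -> endo nz -> endo nz).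
Proof. by move=> f g h; apply: endo_eq. Qed.
Lemma endo_mul1 : left_id (endo_one : endo nz) endo_mul.
Proof. by move=> f; apply: endo_eq. Qed.
Lemma endo_mulr1 : right_id (endo_one : endo nz) endo_mul.
Proof. by move=> f; apply: endo_eq. Qed.
Lemma endo_mulDl : left_distributive (endo_mul : endo nz -> endo nz -> endo nz) +%R.
Proof. by move=> f g h; apply: endo_eq. Qed.
Lemma endo_mulDr : right_distributive (endo_mul : endo nz -> endo nz -> endo nz) +%R.
Proof.
move=> f g h; apply: endo_eq => x.
rewrite -[LHS]/((f : endo_sub) ((g : endo_sub) x + (h : endo_sub) x)).
by have := endo_linear f 1 ((g : endo_sub) x) ((h : endo_sub) x); rewrite !scale1r.
Qed.
Lemma endo_1neq0 : (endo_one : endo nz) != 0.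
Proof.
have [v v0] := nz; apply: contraNneq v0 => /(congr1 (fun f : endo_sub => f v)) e.
by apply/eqP.
Qed.
HB.instance Definition _ := GRing.Zmodule_isNzRing.Build (endo nz)
  endo_mulA endo_mul1 endo_mulr1 endo_mulDl endo_mulDr endo_1neq0.

Lemma endo_scaleAl c (f g : endo nz) : c *: (f * g) = (c *: f) * g.
Proof. exact: endo_eq. Qed.
HB.instance Definition _ := GRing.Lmodule_isLalgebra.Build F (endo nz) endo_scaleAl.
Lemma endo_scaleAr c (f g : endo nz) : c *: (f * g) = f * (c *: g).
Proof.
apply: endo_eq => x.
rewrite -[RHS]/((f : endo_sub) (c *: (g : endo_sub) x)).
rewrite -[LHS]/(c *: (f : endo_sub) ((g : endo_sub) x)).
have f0 : (f : endo_sub) 0 = 0.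
  by have := endo_linear f (-1) 0 0; rewrite !scaleN1r !addNr.
by have := endo_linear f c ((g : endo_sub) x) 0; rewrite f0 !addr0.
Qed.
HB.instance Definition _ := GRing.Lalgebra_isAlgebra.Build F (endo nz) endo_scaleAr.
End Endomorphisms.

Section CoinducedModule.
Variables (F : fieldType) (L : lieType F) (b : basis L).
Local Notation I := (bs_idx b).
Local Notation e := (bs_vec (b := b)).
Local Notation ext := (bs_ext (b := b)).

(** The dual of [U(L)], which is the coinduced module: its elements are the
    functionals on words in the basis that respect the relations of [U(L)]. *)
Definition is_udual : {pred seq I -> F^o} :=
  fun phi => `[< forall a i j c, swap_rel phi a i j c >].
Lemma is_udual_submod : submod_closed is_udual.
Proof.
split=> [|t f g /asboolP fP /asboolP gP]; apply/asboolP => a i j c.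
  by rewrite /swap_rel [X in _ + X]ext_zerof addr0.
rewrite /swap_rel -[LHS]/(t * f (a ++ i :: j :: c) + g (a ++ i :: j :: c)).
rewrite -[RHS]/(t * f (a ++ j :: i :: c) + g (a ++ j :: i :: c)
  + ext (fun k => t * f (a ++ k :: c) + g (a ++ k :: c)) (bracket (e i) (e j))).
by rewrite fP gP ext_linf mulrDr addrACA.
Qed.
HB.instance Definition _ := GRing.isSubmodClosed.Build F (seq I -> F^o) is_udual
  is_udual_submod.

Record udual := Udual { udual_val :> seq I -> F^o; udualP : udual_val \in is_udual }.
HB.instance Definition _ := [isSub for udual_val].
HB.instance Definition _ := [Choice of udual by <:].
HB.instance Definition _ := [SubChoice_isSubZmodule of udual by <:].
HB.instance Definition _ := [SubZmodule_isSubLmodule of udual by <:].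

Lemma udual_rel (phi : udual) a i j c : swap_rel phi a i j c.
Proof. by have /asboolP := udualP phi. Qed.

Lemma udual_on_powers (psi : seq I -> F) : exists phi : udual,
  forall w, constant w -> phi w = psi w.
Proof.
have [phi phi_rel phiE] := functional_on_powers psi.
have phiP : (phi : seq I -> F^o) \in is_udual by apply/asboolP.
by exists (Udual phiP).
Qed.

Lemma udual_nontrivial : exists phi : udual, phi != 0.
Proof.
have [phi phiE] := udual_on_powers (fun _ => 1).
exists phi; apply: contraTneq isT => phi0.
by have := phiE [::] isT; rewrite phi0 => /esym/eqP; rewrite oner_eq0.
Qed.

Lemma udual_act_subproof (v : L) (phi : udual) :
  (fun w => ext (fun k => phi (w ++ [:: k])) v) \in is_udual.
Proof.
apply/asboolP => a i j c; rewrite /swap_rel -ext_swap -ext_addf.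
apply: ext_eqf => k; rewrite -!catA /= udual_rel; congr (_ + _).
by apply: ext_eqf => l; rewrite -catA.
Qed.
Definition udual_act v phi := Udual (udual_act_subproof v phi).

Lemma udual_act_linear v : udual_act v \in is_linear (V := udual).
Proof.
apply/asboolP => c f g; apply: val_inj; apply/funext => w /=.
exact: (ext_linf c (fun k => f (w ++ [:: k])) (fun k => g (w ++ [:: k])) v).
Qed.

(** [L] acts on the functionals on [U(L)] by right translation. *)
Definition translation v : endo udual_nontrivial := Endo (udual_act_linear v).

Lemma translation_rep : lie_rep translation.
Proof.
split=> [c v w|v w]; apply: endo_eq => phi; apply: val_inj; apply/funext => a.
  exact: (bs_ext_lin (fun k => phi (a ++ [:: k])) c v w).
rewrite -[RHS]/(ext (fun k => ext (fun l => phi ((a ++ [:: k]) ++ [:: l])) w) v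
   - ext (fun k => ext (fun l => phi ((a ++ [:: k]) ++ [:: l])) v) w).
rewrite -[LHS]/(ext (fun k => phi (a ++ [:: k])) (bracket v w)).
have assoc x y : ext (fun k => ext (fun l => phi ((a ++ [:: k]) ++ [:: l])) y) x =
    ext (fun k => ext (fun l => phi (a ++ [:: k; l])) y) x.
  by apply: ext_eqf => k; apply: ext_eqf => l; rewrite -catA.
rewrite !assoc [X in _ - X]ext_swap -ext_subf.
move: w; apply: (bs_eq (b := b)) => [c x y|c x y|j].
- by rewrite bracketDr bracketZr bs_ext_lin.
- rewrite -ext_linf; apply: ext_eqf => k.
  by rewrite !bs_ext_lin mulrBr opprD addrACA.
move: v; apply: (bs_eq (b := b)) => [c x y|c x y|i].
- by rewrite bracketDl bracketZl bs_ext_lin.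
- by rewrite bs_ext_lin.
rewrite !bs_extE; have := udual_rel phi a i j [::]; rewrite /swap_rel /= => ->.
by rewrite addrC addKr.
Qed.

Lemma translation_exp i n (phi : udual) a :
  ((translation (e i) ^+ n : endo_sub udual) phi : udual) a = phi (a ++ nseq n i).
Proof.
elim: n a => [|n IHn] a; first by rewrite expr0 cats0.
rewrite exprS -[LHS]/(ext (fun k =>
  ((translation (e i) ^+ n : endo_sub udual) phi : udual) (a ++ [:: k])) (e i)).
by rewrite bs_extE IHn -catA.
Qed.
End CoinducedModule.

(** * The universal property of the p-envelope *)

Lemma commutatorC (R : pzRingType) (x y : R) : commutator x y = - commutator y x.
Proof. by rewrite /commutator opprB. Qed.

Lemma commutator_linl (F : fieldType) (A : algType F) c (x y z : A) :
  commutator (c *: x + z) y = c *: commutator x y + commutator z y.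
Proof.
rewrite /commutator mulrDl mulrDr -scalerAl -scalerAr.
by rewrite scalerBr opprD addrACA.
Qed.

Lemma commutator_linr (F : fieldType) (A : algType F) c (x y z : A) :
  commutator x (c *: y + z) = c *: commutator x y + commutator x z.
Proof. by rewrite !(commutatorC x) commutator_linl opprD scalerN. Qed.

Lemma commutator_exp (p : nat) (R : nzRingType) (pR : p \in [pchar R]) (x y : R) k :
  commutator (x ^+ (p ^ k)) y = iter (p ^ k) (commutator x) y.
Proof.
elim: k y => [|k IHk] y; first by rewrite expn0 expr1.
rewrite expnSr exprM -(iter_commutator_pchar pR) mulnC iterM.
by apply: eq_iter.
Qed.

Section RestrictedTheory.
Variables (p : nat) (F : fieldType) (H : rlieType p F).

Lemma bracket_iter_pmap (x y : H) k :
  bracket (iter k pmap x) y = iter (p ^ k) (bracket x) y.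
Proof.
elim: k y => [|k IHk] y; first by rewrite expn0.
rewrite iterS ad_pmap expnS iterM.
by apply: eq_iter.
Qed.
End RestrictedTheory.

Section PowerSpan.
Variables (p : nat) (F : fieldType) (pF : p \in [pchar F]) (H : rlieType p F).
Variable b : basis H.
Local Notation e := (bs_vec (b := b)).
Local Notation A := (endo (udual_nontrivial b)).
Local Notation rho := (translation b).

Let pA : p \in [pchar A]. Proof. by rewrite pchar_lalg. Qed.
Let p_pr : prime p := pcharf_prime pF.
Let rho_lin : linear rho := (translation_rep b).1.
Let rho_br x y : rho (bracket x y) = commutator (rho x) (rho y).
Proof. exact: (translation_rep b).2. Qed.
Let rho0 : rho 0 = 0.
Proof. by have := rho_lin (-1) 0 0; rewrite !scaleN1r !addNr. Qed.
Let rhoN x : rho (- x) = - rho x.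
Proof. by have := rho_lin (-1) x 0; rewrite rho0 !addr0 !scaleN1r. Qed.

(** The span of the pairs [(x^(p^k), x^[p]^k)], for [x] in the basis. In the
    product of the endomorphism algebra and [H], it is a restricted Lie
    subalgebra, and it is the graph of a function. *)
Inductive power_span : A -> H -> Prop :=
| power_span0 : power_span 0 0
| power_spanS c k i u h : power_span u h ->
    power_span (c *: rho (e i) ^+ (p ^ k) + u) (c *: iter k pmap (e i) + h).

Lemma power_span_lin c u v h h' : power_span u h -> power_span v h' ->
  power_span (c *: u + v) (c *: h + h').
Proof.
elim=> [|d k i {}u {}h _ IHu] vh; first by rewrite !scaler0 !add0r.
rewrite !scalerDr !scalerA -!addrA.
by apply: power_spanS; exact: IHu.
Qed.

Lemma power_span_rho x : power_span (rho x) x.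
Proof.
move: x; apply: (bs_ind (b := b)) => [|c i x IH]; first by rewrite rho0; left.
by have := power_spanS c 0 i IH; rewrite expn0 expr1 -rho_lin.
Qed.

Let adjoint (u : A) h := forall y, commutator u (rho y) = rho (bracket h y).

Let iter_adjoint u h y k : adjoint u h ->
  iter k (commutator u) (rho y) = rho (iter k (bracket h) y).
Proof. by move=> uh; elim: k => //= k ->. Qed.

Let power_span_adjoint u h : power_span u h -> adjoint u h.
Proof.
elim=> [|c k i {}u {}h _ IHu] y.
  by rewrite bracket0l rho0 /commutator mul0r mulr0 subrr.
rewrite commutator_linl IHu bracket_linearl rho_lin; congr (_ *: _ + _).
by rewrite commutator_exp // (@iter_adjoint _ (e i)) ?bracket_iter_pmap.
Qed.

(** In characteristic p, the adjoint action of [x^(p^k)] is the [p^k]-th power of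
    that of [x]; as one application to [rho y] already lands in the image of [H],
    so does every commutator of two powers. *)
Lemma power_span_commutator u h v h' : power_span u h -> power_span v h' ->
  commutator u v = rho (bracket h h').
Proof.
move=> /power_span_adjoint uh; elim=> [|c k i {}v {}h' _ IHv].
  by rewrite bracket0r rho0 /commutator mul0r mulr0 subrr.
rewrite commutator_linr IHv bracket_linearr rho_lin; congr (_ *: _ + _).
rewrite commutatorC bracketC rhoN commutator_exp //; congr (- _).
rewrite bracket_iter_pmap; have : (0 < p ^ k)%N by rewrite expn_gt0 prime_gt0.
case: (p ^ k)%N => // m _; rewrite !iterSr commutatorC uh -rhoN -bracketC.
by apply: iter_adjoint => y; rewrite rho_br.
Qed.

Lemma power_span_bracket u h v h' : power_span u h -> power_span v h' ->
  power_span (commutator u v) (bracket h h').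
Proof.
by move=> uh vh; rewrite (power_span_commutator uh vh); exact: power_span_rho.
Qed.

Lemma power_spanD u h v h' : power_span u h -> power_span v h' ->
  power_span (u + v) (h + h').
Proof. by move=> s1 s2; have := power_span_lin 1 s1 s2; rewrite !scale1r. Qed.

Lemma power_span_jac u h v h' k i : power_span u h -> power_span v h' ->
  power_span (jac (@commutator A) u v k i) (jac bracket h h' k i).
Proof.
move=> uh vh; elim: k i => [|k IHk] [|i] /=; first by [].
- exact: power_span0.
- by rewrite !addr0; exact: power_span_bracket.
- by apply: power_spanD; exact: power_span_bracket.
Qed.

(** Jacobson's formula expresses the p-th power of a sum through p-th powers and
    commutators. *)
Lemma power_span_pmap u h : power_span u h -> power_span (u ^+ p) (pmap h).
Proof.
have p0 := prime_gt0 p_pr.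
elim=> [|c k i {}u {}h uh IHu].
  have pmap0 : pmap (0 : H) = 0.
    by have := pmapZ (0 : F) (0 : H); rewrite scale0r expr0n gtn_eqF // scale0r.
  by rewrite expr0n gtn_eqF // pmap0; left.
set x := c *: rho (e i) ^+ (p ^ k); set y := c *: iter k pmap (e i).
have xy : power_span x y.
  by have := power_spanS c k i power_span0; rewrite !addr0.
have [s [-> sJ]] := jacobson pA x u; rewrite pmapD -!addrA.
rewrite {1}/x {1}/y exprZn pmapZ -exprM -expnSr -iterS.
apply/power_spanS/power_spanD => //.
rewrite big_nat_cond [X in power_span _ X]big_nat_cond.
apply: (big_ind2 power_span); first exact: power_span0.
  by move=> *; exact: power_spanD.
move=> j /andP[/andP[j0 jp] _].
have -> : s j = (j%:R : F)^-1 *: jac (@commutator A) x u p.-1 j.-1.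
  rewrite -sJ // -scaler_nat scalerA mulVf ?scale1r //.
  by rewrite -(dvdn_pcharf pF) gtnNdvd.
have := power_span_lin (j%:R : F)^-1 (power_span_jac p.-1 j.-1 xy uh) power_span0.
by rewrite !addr0.
Qed.

(** The theorem of Poincare, Birkhoff and Witt provides a functional on [U(H)]
    with prescribed values on the powers of basis elements; these can be those
    of a given functional on [H], which recovers the second component of a pair
    from the first one. *)
Lemma power_span_inj h : power_span 0 h -> h = 0.
Proof.
move=> h0; apply/eqP; apply: contraT => /separating_functional[l l_lin lh].
have l0 : l 0 = 0 by have := l_lin (-1) 0 0; rewrite scaler0 add0r mulN1r addNr.
pose psi (w : seq (bs_idx b)) :=
  if w is i :: _ then l (iter (trunc_log p (size w)) pmap (e i)) else 0.
have [phi phiE] := udual_on_powers psi.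
have ev u v : power_span u v -> ((u : endo_sub (udual b)) phi : udual b) [::] = l v.
  elim=> [|c k i {}u {}v _ IHu]; first by rewrite l0.
  rewrite l_lin -IHu.
  rewrite -[LHS]/(c * ((rho (e i) ^+ (p ^ k) : endo_sub (udual b)) phi : udual b) [::]
     + ((u : endo_sub (udual b)) phi : udual b) [::]).
  rewrite translation_exp /= phiE; last first.
    by case: (p ^ k)%N => //= n; apply/all_pred1P; rewrite size_nseq.
  congr (_ * _ + _); rewrite /psi; have := size_nseq (p ^ k) i.
  have : (0 < p ^ k)%N by rewrite expn_gt0 prime_gt0.
  case E : (p ^ k)%N => [|n] //= _ ->; rewrite -E trunc_expnK //.
  exact: prime_gt1.
by have := ev _ _ h0; rewrite lh => /esym/eqP; rewrite oner_eq0.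
Qed.

Lemma power_span_uniq u h h' : power_span u h -> power_span u h' -> h = h'.
Proof.
move=> uh uh'; have := power_span_lin (-1) uh' uh.
by rewrite !scaleN1r addNr addrC => /power_span_inj/eqP; rewrite subr_eq0 => /eqP.
Qed.
End PowerSpan.

(** The universal property of the p-envelope. The elements of [U(L)] whose action
    on the dual of [U(H)] is the first component of a pair in [power_span] contain
    [L] and are stable under the operations that generate the p-envelope; the
    second component of the pair is the value of the extension. *)
Theorem penv_extension (p : nat) (F : fieldType) (pF : p \in [pchar F])
    (L : lieType F) (U : uea L) (H : rlieType p F) (g : L -> H) : lie_hom g ->
  exists2 k : penv pF U -> H, rlie_hom k & forall x, k (penv_unit pF U x) = g x.
Proof.
move=> [g_lin g_br]; have [b] := basis_exists H.
have [rho_lin rho_br] := translation_rep b.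
have rep : lie_rep (fun x => translation b (g x)).
  by split=> [c x y|x y]; rewrite (g_lin, g_br) (rho_lin, rho_br).
pose f : {lrmorphism U -> endo (udual_nontrivial b)} := uea_ext U rep.
have ex (x : penv pF U) : exists h, power_span (f (penv_val x)) h.
  have /penv_predP := penv_valP (x : penv_sub p U).
  elim=> [_ [y _ <-]||c u v _ [h uh] _ [h' vh]|u v _ [h uh] _ [h' vh]|u _ [h uh]].
  - by exists (g y); rewrite uea_extE; exact: power_span_rho.
  - by exists 0; rewrite raddf0; exact: power_span0.
  - by exists (c *: h + h'); rewrite linearP; exact: power_span_lin.
  - exists (bracket h h'); rewrite /commutator rmorphB !rmorphM.
    exact: (power_span_bracket pF).
  - by exists (pmap h); rewrite rmorphXn; exact: (power_span_pmap pF).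
pose k x := projT1 (cid (ex x)).
have kP x : power_span (f (penv_val x)) (k x) := projT2 (cid (ex x)).
have kE x h : power_span (f (penv_val x)) h -> k x = h.
  exact: (power_span_uniq pF (kP x)).
exists k; last by move=> x; apply: kE; rewrite uea_extE; exact: power_span_rho.
split; first split=> [c x y|x y]; last move=> x; apply: kE.
- by rewrite linearP; exact: (power_span_lin c (kP x) (kP y)).
- rewrite /= /commutator rmorphB !rmorphM.
  exact: (power_span_bracket pF (kP x) (kP y)).
- by rewrite /= rmorphXn; exact: (power_span_pmap pF (kP x)).
Qed.

(** * The comparison maps *)

Lemma penv_hom_eq (p : nat) (F : fieldType) (pF : p \in [pchar F])
    (L : lieType F) (U : uea L) (H : rlieType p F) (k k' : penv pF U -> H) :
  rlie_hom k -> rlie_hom k' ->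
  (forall x, k (penv_unit pF U x) = k' (penv_unit pF U x)) -> k =1 k'.
Proof.
move=> [[k_lin k_br] k_p] [[k'_lin k'_br] k'_p] kk' x.
have /penv_predP := penv_valP (x : penv_sub p U).
move: (erefl (penv_val (x : penv_sub p U))); move: {2 3}(penv_val _) => v xv vP.
have k0 : k 0 = 0 by have := k_lin (-1) 0 0; rewrite !scaleN1r !addNr.
have k'0 : k' 0 = 0 by have := k'_lin (-1) 0 0; rewrite !scaleN1r !addNr.
elim: vP x xv => {v}
  [v [y _ <-]||c v w vP IHv wP IHw|v w vP IHv wP IHw|v vP IHv] x xv.
- by rewrite (_ : x = penv_unit pF U y) ?kk' //; apply: val_inj.
- by rewrite (_ : x = 0) ?k0 ?k'0 //; apply: val_inj.
- have /penv_predP v' := vP; have /penv_predP w' := wP.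
  rewrite (_ : x = c *: (Penv v' : penv pF U) + (Penv w' : penv pF U)).
    rewrite k_lin k'_lin (IHv (Penv v' : penv pF U) erefl).
    by rewrite (IHw (Penv w' : penv pF U) erefl).
  exact: val_inj.
- have /penv_predP v' := vP; have /penv_predP w' := wP.
  rewrite (_ : x = bracket (Penv v' : penv pF U) (Penv w' : penv pF U)).
    rewrite k_br k'_br (IHv (Penv v' : penv pF U) erefl).
    by rewrite (IHw (Penv w' : penv pF U) erefl).
  exact: val_inj.
- have /penv_predP v' := vP.
  rewrite (_ : x = pmap (Penv v' : penv pF U)).
    by rewrite k_p k'_p (IHv (Penv v' : penv pF U) erefl).
  exact: val_inj.
Qed.

Section EnvelopeLift.
Variables (p : nat) (F : fieldType) (pF : p \in [pchar F]).
Variables (L : lieType F) (U : uea L).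
Variables (D : cofibrant_replacement (penv pF U : RLieCat p F)).
Variables (C : cofibrant_replacement (L : LieCat F)).
Variables (UC : forall n : nat, uea (C n : lieType F)).

(** A lift [C -> forget D] extends to the p-envelopes degree by degree, and
    uniqueness of the extensions makes the result simplicial. *)
Lemma over_map_env : inhabited (over_map (env_aug pF U UC) D).
Proof.
have [s sP] := lift_over (penv_unit_hom pF U) D C.
have ext n : exists k : penv pF (UC n) -> (D n : rlieType p F), rlie_hom k /\
    forall x, k (penv_unit pF (UC n) x) = s n x.
  have [k k_hom kP] := penv_extension pF (UC n) (mor_hom (s n)).
  by exists k.
pose k n := projT1 (cid (ext n)).
have k_hom n : rlie_hom (k n) by have [] := projT2 (cid (ext n)).
have k_unit n x : k n (penv_unit pF (UC n) x) = s n x.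
  by have [_ kP] := projT2 (cid (ext n)); exact: kP.
pose km n : mor (env_aug pF U UC n) (D n) :=
  @Mor (RLieCat p F) (penv pF (UC n)) (D n) (k n) (k_hom n).
have k_nat m n (f : Delta m n) x :
    km m (s_map (env_aug pF U UC) f x) = s_map D f (km n x).
  have := @penv_hom_eq _ _ pF _ (UC n) (D m)
    (fun x => km m (s_map (env_aug pF U UC) f x)) (fun x => s_map D f (km n x)).
  apply=> {x} [||x].
  - exact: rlie_hom_comp (mor_hom (s_map (env_aug pF U UC) f)) (k_hom m).
  - exact: rlie_hom_comp (k_hom n) (mor_hom (s_map D f)).
  - by rewrite /= penv_map_unit !k_unit smap_nat.
have k_over n x : aug_map D n (SMap k_nat n x) = aug_map (env_aug pF U UC) n x.
  have := @penv_hom_eq _ _ pF _ (UC n) (penv pF U)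
    (fun x => aug_map D n (km n x)) (aug_map (env_aug pF U UC) n).
  apply=> {x} [||x].
  - exact: rlie_hom_comp (k_hom n) (mor_hom (aug_map D n)).
  - exact: (mor_hom (aug_map (env_aug pF U UC) n)).
  - by rewrite /= penv_map_unit k_unit sP.
exact: inhabits (OverMap k_over).
Qed.
End EnvelopeLift.

Section Comparison.
Variables (p : nat) (F : fieldType) (pF : p \in [pchar F]).
Variables (H : rlieType p F) (U : uea H) (u : renv U) (R : skew_poly p F).
Variables (W : wring u R) (M : lmodType W).
Variables (L : lieType F) (UL : uea L) (g : L -> H) (g_hom : lie_hom g).
Variables (phi : {rmorphism UL -> W}).
Hypothesis phi_in : forall x, phi (uea_in UL x) = w_act W (g x).
Hypothesis phi_scal : forall c, phi c%:A = w_scal W c.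
Local Notation E := (rlie_beck pF M).
Local Notation E' := (lie_beck (restr phi M)).

Definition comparison_lift (D : cofibrant_replacement (H : RLieCat p F))
    (C : cofibrant_replacement (L : LieCat F)) :=
  cid (lift_over g_hom D C).

Definition comparison (D : cofibrant_replacement (H : RLieCat p F))
    (C : cofibrant_replacement (L : LieCat F)) n :
    {additive HQ E D n -> HQ E' C n} :=
  cohomotopy_map
    (lie_restrict pF M phi_in phi_scal (projT2 (comparison_lift D C))) n.

Lemma comparisonE (D : cofibrant_replacement (H : RLieCat p F))
    (C : cofibrant_replacement (L : LieCat F)) (s : smap C (forget D))
    (Phi : csmap (hom_cosimplicial E D) (hom_cosimplicial E' C)) :
  (forall n x, aug_map D n (s n x) = g (aug_map C n x)) ->
  (forall n d x, hom_over_val (Phi n d) x = hom_over_val d (s n x)) ->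
  forall n x, comparison D C n x = cohomotopy_map Phi n x.
Proof.
move=> s_over PhiE.
exact: (lift_cohomotopy phi_in phi_scal (projT2 (comparison_lift D C)) s_over).
Qed.

Lemma cohomotopy_map_comp (A B C : cosimplicial) (psi : csmap B C)
    (phi' : csmap A B) n x :
  cohomotopy_map psi n (cohomotopy_map phi' n x) =
  cohomotopy_map (csmap_comp psi phi') n x.
Proof.
rewrite -[x]reprK -[LHS]/(cohomotopy_fun psi (cohomotopy_fun phi' (cohclass (repr x)))).
rewrite -[RHS]/(cohomotopy_fun _ (cohclass (repr x))) !cohomotopy_funE.
by congr cohclass; apply: val_inj.
Qed.

(** Both composites are composition with a map [C -> forget D'] that lifts
    [g]. *)
Lemma comparison_natural (D D' : cofibrant_replacement (H : RLieCat p F))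
    (C C' : cofibrant_replacement (L : LieCat F))
    (v : over_map D D') (w : over_map C C') n (x : HQ E D' n) :
  HQ_pull E' w n (comparison D' C' n x) = comparison D C n (HQ_pull E v n x).
Proof.
rewrite /HQ_pull !cohomotopy_map_comp.
pose s := projT1 (comparison_lift D C).
pose s' := projT1 (comparison_lift D' C').
have sP n' y : aug_map D n' (s n' y) = g (aug_map C n' y).
  exact: (projT2 (comparison_lift D C)).
have s'P n' y : aug_map D' n' (s' n' y) = g (aug_map C' n' y).
  exact: (projT2 (comparison_lift D' C')).
pose vs n' : mor (C n') (forget D' n') := mor_comp (forget_mor (v n')) (s n').
have vs_nat m k (f : Delta m k) y : vs m (s_map C f y) = s_map (forget D') f (vs k y).
  by rewrite /= smap_nat /= smap_nat.
pose sw n' : mor (C n') (forget D' n') := mor_comp (s' n') (w n').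
have sw_nat m k (f : Delta m k) y : sw m (s_map C f y) = s_map (forget D') f (sw k y).
  by rewrite /= !smap_nat.
apply: (lift_cohomotopy phi_in phi_scal (s := SMap sw_nat) (s' := SMap vs_nat)) => //.
- by move=> k y /=; rewrite s'P over_aug.
- by move=> k y /=; rewrite over_aug sP.
Qed.
End Comparison.

Theorem proposition13p3 (p : nat) (F : fieldType) (pF : p \in [pchar F]) :
  (forall (L : lieType F) (U : uea L) (V : uea (penv pF U)) (u : renv V)
      (R : skew_poly p F) (W : wring u R) (M : lmodType W),
    let E := rlie_beck pF M in
    let E' := lie_beck (restr (uea_to_w W) M) in
    exists Phi : forall (D : cofibrant_replacement (penv pF U : RLieCat p F))
        (C : cofibrant_replacement (L : LieCat F)) (n : nat),
        {additive HQ E D n -> HQ E' C n},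
      (forall (D : cofibrant_replacement (penv pF U : RLieCat p F))
          (C : cofibrant_replacement (L : LieCat F))
          (UC : forall n : nat, uea (C n : lieType F)),
        inhabited (over_map (env_aug pF U UC) D) /\
        forall (t : over_map (env_aug pF U UC) D) (n : nat) (x : HQ E D n),
          Phi D C n x = cohomotopy_map (env_comparison M t) n x) /\
      (forall (D D' : cofibrant_replacement (penv pF U : RLieCat p F))
          (C C' : cofibrant_replacement (L : LieCat F))
          (v : over_map D D') (w : over_map C C') (n : nat) (x : HQ E D' n),
        HQ_pull E' w n (Phi D' C' n x) = Phi D C n (HQ_pull E v n x)))
  /\
  (forall (H : rlieType p F) (U : uea H) (u : renv U)
      (R : skew_poly p F) (W : wring u R) (M : lmodType W),
    let E := rlie_beck pF M in
    let E' := lie_beck (restr (theta W) M) in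
    exists Phi : forall (D : cofibrant_replacement (H : RLieCat p F))
        (C : cofibrant_replacement ((H : lieType F) : LieCat F)) (n : nat),
        {additive HQ E D n -> HQ E' C n},
      (forall (D : cofibrant_replacement (H : RLieCat p F))
          (C : cofibrant_replacement ((H : lieType F) : LieCat F)),
        inhabited (over_map C (forget_aug D)) /\
        forall (t : over_map C (forget_aug D)) (n : nat) (x : HQ E D n),
          Phi D C n x = cohomotopy_map (forget_comparison pF M t) n x) /\
      (forall (D D' : cofibrant_replacement (H : RLieCat p F))
          (C C' : cofibrant_replacement ((H : lieType F) : LieCat F))
          (v : over_map D D') (w : over_map C C') (n : nat) (x : HQ E D' n),
        HQ_pull E' w n (Phi D' C' n x) = Phi D C n (HQ_pull E v n x))).
Proof.
split=> [L U V u R W M E E'|H U u R W M E E'].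
  exists (comparison pF M (penv_unit_hom pF U) (uea_to_w_in (pF := pF) W)
            (uea_to_w_scal W)); split; last exact: comparison_natural.
  move=> D C UC; split; first exact: over_map_env.
  move=> t n x.
  pose s k : mor (C k) (forget D k) := mor_comp (forget_mor (t k)) (env_unit pF UC k).
  have s_nat m k (f : Delta m k) y : s m (s_map C f y) = s_map (forget D) f (s k y).
    exact: (etrans (congr1 (t m) (env_unit_nat pF UC f y)) (smap_nat t f _)).
  apply: (comparisonE _ _ _ (s := SMap s_nat)) => // k y /=.
  exact: (etrans (over_aug t _) (env_unit_over pF U UC y)).
exists (comparison pF M (lie_hom_id H) (fun x => erefl (theta W (uea_in U x)))
          (theta_scal W)); split; last exact: comparison_natural.
move=> D C; split.
  have [s sP] := lift_over (lie_hom_id H) D C.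
  by apply: inhabits; exists s; exact: sP.
by move=> t n x; apply: (comparisonE _ _ _ (s := t)) => // k y; exact: (over_aug t).
Qed.
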